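(* Let $A>0$. There exist constants $C(A)$ and $y_0(A)$, depending only on $A$, such that the following holds. For all $y,q\ge y_0(A)$ with $q\le y^{A}$ there is a subgroup $H$ of $(\mathbb{Z}/q\mathbb{Z})^{*}$ of index at most $C(A)$ such that for all $a,b\in(\mathbb{Z}/q\mathbb{Z})^*$ with $a/b\in H$, $$\Psi(x,y;q,a)-\Psi(x,y;q,b)=o\!\left(\frac{\Psi_q(x,y)}{\phi(q)}\right)\quad\text{as }\log x/\log q\to\infty,$$ i.e. for every $\varepsilon>0$ there is $V=V(A,\varepsilon)$ such that $|\Psi(x,y;q,a)-\Psi(x,y;q,b)|\le\varepsilon\,\Psi_q(x,y)/\phi(q)$ whenever $x\ge y$ and $\log x/\log q\ge V$.
   Context: For $y\ge 1$, $\mathcal{S}(y)$ denotes the set of positive integers all of whose prime factors are $\le y$. For $x\ge1$ and integers $a,q\ge1$, $\Psi_q(x,y)=\#\{n\le x:\ \gcd(n,q)=1,\ n\in\mathcal{S}(y)\}$ and $\Psi(x,y;q,a)=\#\{n\le x:\ n\equiv a\pmod q,\ n\in\mathcal{S}(y)\}$; here $a$ is identified with its residue class. $\phi$ is Euler's totient function. *)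

(* Defs.v *)
From HB Require Import structures.
From mathcomp Require Import all_boot all_order all_algebra fingroup.
From mathcomp Require Import reals exp.

Set Implicit Arguments.
Unset Strict Implicit.
Unset Printing Implicit Defensive.

Import Order.TTheory GRing.Theory Num.Theory.
Local Open Scope ring_scope.

Section SmoothNumbers.
Variable R : realType.

Definition smooth (y : R) (n : nat) : bool :=
  (0 < n)%N && all (fun p : nat => p%:R <= y) (primes n).

(* For x >= 0 and n : nat, n <= x iff n <= Num.truncn x, the integer part of x;
   n = 0 is excluded by smooth. *)
Definition Psi_coprime (q : nat) (x y : R) : nat :=
  #|[set n : 'I_(Num.truncn x).+1 | coprime n q && smooth y n]|.

(* 'Z_q is Z/qZ only for q >= 2, so this is meaningful only for such q. *)
Definition Psi_ap (x y : R) (q : nat) (a : 'Z_q) : nat :=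
  #|[set n : 'I_(Num.truncn x).+1 | ((n : nat)%:R == a) && smooth y n]|.

End SmoothNumbers.

Arguments Psi_ap {R} x y q a.

(* Main.v *)
From HB Require Import structures.
From mathcomp Require Import all_boot all_order all_algebra fingroup.
From mathcomp Require Import boolp reals sequences exp ring lra zify.
Require Import Defs.

Set Implicit Arguments.
Unset Strict Implicit.
Unset Printing Implicit Defensive.

Import Order.TTheory GRing.Theory Num.Theory.
Local Open Scope ring_scope.

(** Let [F g t] count the [y]-smooth integers up to [t] in the residue class [g]
    and let [N t] be their total.  Weighting by [ln n] gives the walk identity
      [F g t * ln t = \int F g s / s ds + \sum_(p ^ j) ln p * F (g / p ^ j) (t / p ^ j)],
    which is also satisfied by [N] and by the differences [F g - F (g h)].
    Iterate it along [k] primes close to [y] and sort their products [M] in very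
    short bins.  If the class counts of a typical bin and their translates by
    [h1] overlap, then the contributions of [M] and [M'] of classes [x] and
    [x h1] may be regrouped, which replaces differences along [h] by differences
    along [h / h1] and [h h1].  Selberg's sieve bounds every class count of a
    bin, so by Cauchy-Schwarz a positive proportion of the group consists of
    such [h1]; they generate a subgroup [H] of bounded index, and every element
    of [H] is a word of bounded length in them.  With weights concave in the
    word length, the regrouping contracts the largest discrepancy over [H] by a
    fixed factor each time the range of [ln t / ln y] is doubled.  A
    supersolution of the walk identity carries the bound to all larger [t].

    Two ranges remain.  If [x] is below a fixed power of [y], then [q] is a tiny
    power of [y], and induction over the decomposition in smooth and rough parts
    gives equidistribution in all classes.  If [y] is bounded, multiplication by
    a fixed smooth number moves one class into another at negligible cost. *)

(** * Chebyshev and Mertens estimates *)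

(** The order of the constants shapes the proof. The subgroup may depend on [Y], [q] and [B] but not
    on [eps], whereas the threshold on [Y] beyond which the contraction works depends on [eps]. For
    [Y] below that threshold the same subgroup must serve, so it has to be shown to consist of
    classes of smooth numbers. Within the contraction, the range [Y ^ U] is chosen after the factor
    gained per step, which must therefore not depend on [U]; this is why
    [N (lam * b) <= C1 * lam * N b] is proved with one constant, fixed at the scale [Y ^ 6], for [b]
    up to [Y ^ U]. A single step near [Y ^ V] gains only a factor [1 - contr / V]. Normalising [kk]
    primes by [1 / (2 * V)] each costs [V ^ kk], and a product [M] of them returns [V ^ (kk - 1)],
    since [M * N (t / M)] is at least of order [N t * V ^ (kk - 1)]. A step shortens the range by a
    bounded power of [Y], so about [V] steps fit between [Y ^ (V / 2)] and [Y ^ V], and together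
    they gain a fixed factor. Sizes are measured by the harmonic sum [S] over the [n <= D] coprime
    to [q]: it is the density in Selberg's sieve and, divided by [L], that of [N]. *)

Section PrimeSums.
Variable R : realType.

Definition lnn (n : nat) : R := ln n%:R.

Lemma lnn0 : lnn 0 = 0. Proof. by rewrite /lnn ln0. Qed.
Lemma lnn1 : lnn 1 = 0. Proof. by rewrite /lnn ln1. Qed.

Lemma lnn_ge0 n : 0 <= lnn n.
Proof.
case: n => [|n]; first by rewrite lnn0.
by rewrite /lnn ln_ge0 // ler1n.
Qed.

Lemma lnn_gt0 n : (1 < n)%N -> 0 < lnn n.
Proof. by move=> n1; rewrite /lnn ln_gt0 // ltr1n. Qed.

Lemma lnn_le m n : (m <= n)%N -> lnn m <= lnn n.
Proof.
case: m => [|m] mn; first by rewrite lnn0 lnn_ge0.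
rewrite /lnn ler_ln ?ler_nat // posrE ltr0n //.
exact: leq_trans mn.
Qed.

Lemma lnnM m n : (0 < m)%N -> (0 < n)%N -> lnn (m * n) = lnn m + lnn n.
Proof. by move=> m0 n0; rewrite /lnn natrM lnM ?posrE ?ltr0n. Qed.

Lemma lnnX m k : (0 < m)%N -> lnn (m ^ k) = k%:R * lnn m.
Proof. by move=> m0; rewrite /lnn natrX lnXn ?ltr0n // mulr_natl. Qed.

Lemma lnn_le_nat n : lnn n <= n%:R.
Proof.
case: n => [|n]; first by rewrite lnn0.
by apply: ltW; apply: ln_sublinear; rewrite ltr0n.
Qed.

Lemma lnnS_sub_ge0 s : 0 <= lnn s.+1 - lnn s.
Proof. by rewrite subr_ge0 lnn_le. Qed.

Lemma lnnS_sub_le s : (0 < s)%N -> lnn s.+1 - lnn s <= s%:R^-1.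
Proof.
move=> s0; have s0' : 0 < s%:R :> R by rewrite ltr0n.
rewrite /lnn -ln_div ?posrE ?ltr0n //.
have -> : s.+1%:R / s%:R = 1 + s%:R^-1 :> R.
  by rewrite -natr1 mulrDl divff ?gt_eqF // mul1r.
apply: le_ln1Dx; apply: lt_trans (_ : 0 < _); first by lra.
by rewrite invr_gt0.
Qed.

Lemma lnn2_ge : 2^-1 <= lnn 2.
Proof.
have h : ln (1 + (- 2^-1)) <= - 2^-1 :> R by apply: le_ln1Dx; lra.
have e : 1 + (- 2^-1) = 2^-1 :> R by lra.
rewrite e lnV ?posrE // in h.
rewrite /lnn; lra.
Qed.

Lemma sum_lnnS a b : (a <= b)%N ->
  \sum_(a <= s < b) (lnn s.+1 - lnn s) = lnn b - lnn a.
Proof. exact: telescope_sumr. Qed.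

Lemma sum_multiples (V : nmodType) d t (f : nat -> V) : (0 < d)%N ->
  \sum_(1 <= n < t.+1 | (d %| n)%N) f n = \sum_(1 <= m < (t %/ d).+1) f (d * m)%N.
Proof.
move=> d0; elim: t => [|t IH]; first by rewrite div0n !big_geq.
rewrite big_mkcond big_nat_recr //= -big_mkcond IH /=.
rewrite divnS //; case: ifP => h; last by rewrite addr0 add0n.
rewrite add1n [in RHS]big_nat_recr //=; congr (_ + f _).
have e : (t.+1 %/ d = (t %/ d).+1)%N by rewrite divnS // h add1n.
by rewrite -e mulnC divnK.
Qed.

Lemma lnn_prod (r : seq nat) (P : pred nat) (F : nat -> nat) :
  (forall i, P i -> (0 < F i)%N) ->
  lnn (\prod_(i <- r | P i) F i) = \sum_(i <- r | P i) lnn (F i).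
Proof.
move=> F0; elim: r => [|i r IH]; first by rewrite !big_nil lnn1.
rewrite !big_cons; case: ifP => // Pi.
by rewrite lnnM ?IH ?F0 // prodn_cond_gt0.
Qed.

Lemma lnn_prod_logn n Y : (0 < n)%N -> all (leq^~ Y) (primes n) ->
  lnn n = \sum_(1 <= p < Y.+1 | prime p) (logn p n)%:R * lnn p.
Proof.
move=> n0 nY; pose t := maxn n Y.
have L0 p : ~~ (prime p && (p <= Y)%N) -> logn p n = 0%N.
  move=> h; apply/eqP; rewrite -leqn0 leqNgt; apply: contra h; rewrite logn_gt0 => h.
  by rewrite (allP nY) // andbT; move: h; rewrite mem_primes => /andP[].
have -> : lnn n = \sum_(0 <= p < t.+1) (logn p n)%:R * lnn p.
  rewrite -{1}(partnT n0) (@widen_partn t) ?leq_maxl // lnn_prod; last first.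
    by move=> p _; rewrite pfactor_gt0.
  apply: eq_big => // p _; case: p => [|p]; last by rewrite lnnX.
  by rewrite L0 // expn0 lnn1 mul0r.
rewrite (big_cat_nat (n := Y.+1)) //=; last by rewrite ltnS leq_maxr.
rewrite [X in _ + X]big_nat_cond [X in _ + X]big1 ?addr0; last first.
  by move=> p /andP[/andP[h _] _]; rewrite L0 ?mul0r // leqNgt h andbF.
rewrite big_ltn // L0 // mul0r add0r [RHS]big_mkcond; apply: eq_big_nat => p _.
by case: ifP => // h; rewrite L0 ?mul0r // h.
Qed.

Lemma sum_iverson_leq l t : (l <= t)%N ->
  (\sum_(1 <= j < t.+1) (j <= l)%N = l)%N.
Proof.
move=> lt; rewrite (big_cat_nat (n := l.+1)) //=.
rewrite (eq_big_nat _ _ (F2 := fun=> 1%N)); last first.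
  by move=> i /andP[_]; rewrite ltnS => ->.
rewrite sum_nat_const_nat muln1 subn1 /=.
rewrite (eq_big_nat _ _ (F2 := fun=> 0%N)); last first.
  by move=> i /andP[h _]; rewrite leqNgt h.
by rewrite sum_nat_const_nat muln0 addn0.
Qed.

Lemma logn_count p n t : prime p -> (0 < n)%N -> (n <= t)%N ->
  (logn p n = \sum_(1 <= j < t.+1) (p ^ j %| n))%N.
Proof.
move=> pp n0 nt; rewrite -[LHS](@sum_iverson_leq _ t).
  by apply: eq_bigr => j _; rewrite pfactor_dvdn.
apply: leq_trans nt; apply: ltnW.
exact: ltn_logl.
Qed.

Lemma lnn_sum_prime_powers n Y t : (0 < n)%N -> (n <= t)%N -> all (leq^~ Y) (primes n) ->
  lnn n = \sum_(1 <= p < Y.+1 | prime p) \sum_(1 <= j < t.+1 | (p ^ j %| n)%N) lnn p.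
Proof.
move=> n0 nt nY; rewrite (lnn_prod_logn n0 nY); apply: eq_bigr => p pp.
rewrite (logn_count pp n0 nt) natr_sum mulr_suml [RHS]big_mkcond.
by apply: eq_bigr => j _; case: ifP => _; rewrite ?mul1r ?mul0r.
Qed.

Lemma primes_leq n : all (leq^~ n) (primes n).
Proof.
by apply/allP => p; rewrite mem_primes => /and3P[_ n0 /dvdn_leq]; exact.
Qed.

Definition ln_fact n : R := \sum_(1 <= m < n.+1) lnn m.

Lemma ln_factS n : ln_fact n.+1 = ln_fact n + lnn n.+1.
Proof. by rewrite /ln_fact big_nat_recr. Qed.

Lemma primes_leqW n m : (m <= n)%N -> all (leq^~ n) (primes m).
Proof. by move=> mn; apply: sub_all (primes_leq m) => p /= h; apply: leq_trans mn. Qed.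

Lemma sum_nat1 n : \sum_(1 <= m < n.+1) 1 = n%:R :> R.
Proof. by rewrite big_const_nat iter_addr addr0 subn1. Qed.

Lemma ln_fact_legendre n Y : (n <= Y)%N -> ln_fact n =
  \sum_(1 <= p < Y.+1 | prime p) \sum_(1 <= j < Y.+1) (n %/ p ^ j)%:R * lnn p.
Proof.
move=> nY; rewrite /ln_fact.
rewrite (eq_big_nat _ _ (F2 := fun m => \sum_(1 <= p < Y.+1 | prime p)
   \sum_(1 <= j < Y.+1 | (p ^ j %| m)%N) lnn p)); last first.
  move=> m /andP[m0 mn]; apply: lnn_sum_prime_powers => //.
    by lia.
  by apply: primes_leqW; lia.
rewrite exchange_big_nat /=; apply: eq_bigr => p pp.
under eq_bigr do rewrite big_mkcond.
rewrite exchange_big_nat /=; apply: eq_bigr => j _.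
rewrite -big_mkcond sum_multiples ?expn_gt0 ?prime_gt0 //.
by rewrite -sum_nat1 mulr_suml; apply: eq_bigr => i _; rewrite mul1r.
Qed.

Lemma ln_fact_ge n : n%:R * lnn n - n%:R <= ln_fact n.
Proof.
elim: n => [|n IH]; first by rewrite mul0r /ln_fact big_geq // subr0.
rewrite ln_factS -natr1.
have h : n%:R * (lnn n.+1 - lnn n) <= 1.
  case: n {IH} => [|n]; first by rewrite mul0r.
  have n0 : 0 < n.+1%:R :> R by rewrite ltr0n.
  by rewrite mulrC -ler_pdivlMr // div1r lnnS_sub_le.
rewrite mulrDl mul1r; rewrite mulrBr in h; lra.
Qed.

Lemma ln_fact_le n : ln_fact n <= n%:R * lnn n.
Proof.
rewrite /ln_fact -[X in X * _]sum_nat1 mulr_suml; apply: ler_sum_nat => i /andP[_ h].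
by rewrite mul1r lnn_le.
Qed.

Definition theta n : R := \sum_(1 <= p < n.+1 | prime p) lnn p.

Lemma leq_divn_double n d : (0 < d)%N -> (2 * (n %/ d) <= n.*2 %/ d)%N.
Proof. by move=> d0; rewrite leq_divRL // -mulnA -mul2n leq_mul2l leq_trunc_div orbT. Qed.

(** The primes of []n, 2n]] divide the central binomial coefficient. In Legendre's formula this is a
    termwise comparison: [floor (2n / p^j) - 2 floor (n / p^j)] is nonnegative, and at least 1 for
    [j = 1] and [n < p <= 2n]. *)
Lemma theta_le_double n : theta n.*2 - theta n <= ln_fact n.*2 - 2 * ln_fact n.
Proof.
have nn : (n <= n.*2)%N by lia.
rewrite (@ln_fact_legendre n n.*2) // (@ln_fact_legendre n.*2 n.*2) //.
have -> : theta n = \sum_(1 <= p < n.*2.+1 | prime p) (if (p <= n)%N then lnn p else 0).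
  rewrite (big_cat_nat (n := n.+1)) //=.
  rewrite [X in _ = _ + X]big_nat_cond [X in _ = _ + X]big1 ?addr0; last first.
    by move=> p /andP[/andP[h _] _]; rewrite leqNgt h.
  rewrite /theta [LHS]big_nat_cond [RHS]big_nat_cond; apply: eq_bigr => p /andP[/andP[_ h] _].
  by rewrite -ltnS h.
rewrite /theta mulr_sumr -!sumrB big_nat_cond [leRHS]big_nat_cond.
apply: ler_sum => p /andP[/andP[p1 p2] pp].
rewrite mulr_sumr -sumrB big_ltn //=; last by rewrite ltnS (leq_trans p1).
rewrite expn1.
have l0 := lnn_ge0 p.
have -> : forall x : R, lnn p - (if (p <= n)%N then lnn p else 0) <= x
   = (((n < p)%N)%:R * lnn p <= x).
  move=> x; case: (leqP p n) => h; by rewrite ?subrr ?mul0r // subr0 mul1r.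
rewrite -[leLHS]addr0; apply: lerD.
  rewrite mulrA -mulrBl ler_wpM2r // lerBrDr -natrM -natrD ler_nat.
  case: (ltnP n p) => h /=.
    rewrite (divn_small h) muln0 addn0 divn_gt0 ?prime_gt0 //; lia.
  by rewrite add0n leq_divn_double ?prime_gt0.
apply: sumr_ge0 => j _.
rewrite mulrA -mulrBl mulr_ge0 // subr_ge0 -natrM ler_nat.
by rewrite leq_divn_double // expn_gt0 prime_gt0.
Qed.

(** The step from [n] to [n + 1] multiplies the central binomial coefficient by
    [(2n+2)(2n+1) / (n+1)^2], which is at most 4. *)
Lemma ln_fact_double n : ln_fact n.*2 - 2 * ln_fact n <= n.*2%:R * lnn 2.
Proof.
elim: n => [|n IH]; first by rewrite /ln_fact !big_geq // mul0r mulr0 subr0.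
rewrite doubleS !ln_factS.
have e1 : lnn n.*2.+2 = lnn 2 + lnn n.+1.
  by rewrite -lnnM //; congr lnn; lia.
have e2 : lnn n.*2.+1 <= lnn 2 + lnn n.+1 by rewrite -e1 lnn_le.
rewrite -[n.*2.+2%:R]natr1 -natr1; lra.
Qed.

Lemma lnn2_le : lnn 2 <= 1.
Proof.
have h := @lnnS_sub_le 1 isT; move: h; rewrite lnn1; lra.
Qed.

(** Halving an even argument [2m] costs [2m], and an odd one a further [lnn (2m+1) <= 2m+1]; the
    constant 4 absorbs both. *)
Lemma theta_le n : theta n <= 4 * n%:R.
Proof.
have D m : theta m.*2 <= theta m + 2 * m%:R.
  have h1 := theta_le_double m; have h2 := ln_fact_double m; have h3 := lnn2_le.
  have : m.*2%:R * lnn 2 <= m.*2%:R by rewrite ler_piMr.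
  rewrite -[m.*2]muln2 natrM in h1 h2 *; lra.
have [k] := ubnP n; elim: k n => // k IH n nk.
case: (posnP n) => [->|n0]; first by rewrite /theta big_geq // mulr0.
have h := IH n./2 ltac:(lia); have h2 := D n./2; have m0 : 0 <= n./2%:R :> R by [].
have [e|e] : n = n./2.*2 \/ n = n./2.*2.+1 by lia.
  rewrite e; set m := n./2 in h h2 *; rewrite -[m.*2]muln2 natrM; rewrite -muln2 in h2; lra.
rewrite e; set m := n./2 in h h2 *.
have h3 : theta m.*2.+1 <= theta m.*2 + lnn m.*2.+1.
  rewrite {1}/theta big_mkcond big_nat_recr //= -big_mkcond /= lerD2l.
  by case: ifP => _ //; rewrite lnn_ge0.
have h4 := lnn_le_nat m.*2.+1.
have e' : m.*2.+1%:R = m%:R * 2 + 1 :> R by rewrite -natr1 -muln2 natrM.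
rewrite e' in h4 *; rewrite -/m in m0; lra.
Qed.

Definition mertens n : R := \sum_(1 <= p < n.+1 | prime p) lnn p / p%:R.

(** The powers [j >= 2] in Legendre's formula are dropped and [n / p <= floor (n / p) + 1]; this
    rounding costs [theta n <= 4n]. *)
Lemma mertens_le n : (0 < n)%N -> mertens n <= lnn n + 4.
Proof.
move=> n0; have n0' : 0 < n%:R :> R by rewrite ltr0n.
rewrite -(ler_pM2l n0') mulrDr.
have h1 := ln_fact_le n; have h2 := theta_le n.
suff : n%:R * mertens n <= ln_fact n + theta n by move=> ?; lra.
rewrite (@ln_fact_legendre n n) // /mertens /theta mulr_sumr -big_split /=.
rewrite big_nat_cond [leRHS]big_nat_cond; apply: ler_sum => p /andP[/andP[p1 p2] pp].
rewrite big_ltn //= expn1 -addrA [X in _ + X]addrC addrA.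
have p0 : 0 < p%:R :> R by rewrite ltr0n.
apply: ler_wpDr; first by apply: sumr_ge0 => j _; rewrite mulr_ge0 ?lnn_ge0.
rewrite mulrCA mulrC -{3}(mul1r (lnn p)) -mulrDl ler_wpM2r ?lnn_ge0 //.
by rewrite ler_pdivrMr // natr1 -natrM ler_nat ltnW // -ltn_divLR //.
Qed.

Lemma sum_geom_le p J : (1 < p)%N ->
  \sum_(1 <= j < J.+1) (p ^ j)%:R^-1 <= (p%:R - 1)^-1 :> R.
Proof.
move=> p1; have p0 : 0 < p%:R - 1 :> R by rewrite subr_gt0 ltr1n.
have P0 k : 0 < (p ^ k)%:R :> R by rewrite ltr0n expn_gt0; lia.
suff -> : \sum_(1 <= j < J.+1) (p ^ j)%:R^-1 = (p%:R - 1)^-1 - (p%:R - 1)^-1 / (p ^ J)%:R :> R.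
  by rewrite gerBl divr_ge0 // ?invr_ge0 ltW.
elim: J => [|J IH]; first by rewrite big_geq // expn0 divr1 subrr.
rewrite big_nat_recr //= IH expnS natrM; have := P0 J; move: p0.
set a := (p ^ J)%:R; set b := p%:R => b0 a0; field.
by rewrite !gt_eqF //; lra.
Qed.

Lemma sum_ln_pred_le n : (0 < n)%N ->
  \sum_(1 <= m < n.+1 | (1 < m)%N) lnn m / (m%:R * (m%:R - 1)) <= 2.
Proof.
move=> n0.
(* The stronger bound passes through the induction: the term at [m] is at most the drop of
   [(lnn m + 2) / m] from [m - 1] to [m]. *)
suff : \sum_(1 <= m < n.+1 | (1 < m)%N) lnn m / (m%:R * (m%:R - 1)) <= 2 - (lnn n + 2) / n%:R.
  move=> h; apply: le_trans h _; rewrite gerBl divr_ge0 // addr_ge0 // lnn_ge0 //.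
case: n n0 => // n _; elim: n => [|n IH].
  by rewrite big_mkcond big_nat1 /= lnn1; lra.
rewrite big_mkcond big_nat_recr //= -big_mkcond /=.
apply: le_trans (lerD IH (lexx _)) _.
have h := @lnnS_sub_le n.+1 isT; have e : n.+2%:R = n.+1%:R + 1 :> R by rewrite natr1.
have a0 : 0 < n.+1%:R :> R by rewrite ltr0n.
have a1 : 1 <= n.+1%:R :> R by rewrite ler1n.
rewrite e addrK; set a := n.+1%:R in h a0 a1 *; set l := lnn n.+1 in h *; set l' := lnn n.+2 in h *.
rewrite -subr_ge0.
have -> : 2 - (l' + 2) / (a + 1) - (2 - (l + 2) / a + l' / ((a + 1) * a))
  = (l - l' + (2 - a * (l' - l))) / ((a + 1) * a).
  by field; rewrite !gt_eqF //; lra.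
have h' : a * (l' - l) <= 1 by rewrite mulrC -ler_pdivlMr // div1r.
have h'' : l' - l <= 1 by apply: le_trans h _; rewrite invf_le1.
rewrite divr_ge0 //; first by lra.
by rewrite mulr_ge0 //; lra.
Qed.

(** The powers [j >= 2] of [p] add up to at most [lnn p / (p (p - 1))], which is then summed over
    all integers instead of primes. *)
Lemma prime_power_sum_le n J : (0 < n)%N ->
  \sum_(1 <= p < n.+1 | prime p) \sum_(1 <= j < J.+1) lnn p / (p ^ j)%:R <= mertens n + 2.
Proof.
move=> n0; apply: le_trans (lerD (lexx _) (sum_ln_pred_le n0)).
rewrite /mertens [X in _ <= _ + X](bigID prime) /= addrA.
apply: ler_wpDr.
  apply: sumr_ge0 => m /andP[m1 _].
  by rewrite divr_ge0 ?lnn_ge0 // mulr_ge0 // subr_ge0 ler1n ltnW.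
rewrite [X in _ <= _ + X](eq_bigl prime); last first.
  by move=> p; case pp: (prime p); rewrite ?andbF // prime_gt1.
rewrite -big_split /=; apply: ler_sum => p pp; have p1 := prime_gt1 pp.
rewrite -mulr_sumr; apply: le_trans (ler_wpM2l (lnn_ge0 p) (sum_geom_le J p1)) _.
have b0 : 1 < p%:R :> R by rewrite ltr1n.
set b := p%:R in b0 *; rewrite le_eqVlt; apply/orP; left; apply/eqP; field.
by rewrite !gt_eqF //; lra.
Qed.

(** Removing the floors in Legendre's formula gives [ln n! <= n (mertens n + 2)], to be compared
    with [ln n! >= n ln n - n]. *)
Lemma mertens_ge n : (0 < n)%N -> lnn n - 3 <= mertens n.
Proof.
move=> n0; have n0' : 0 < n%:R :> R by rewrite ltr0n.
have h1 := ln_fact_ge n; have h2 := prime_power_sum_le n n0.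
suff h : ln_fact n <= n%:R * (mertens n + 2).
  have : n%:R * (lnn n - 3) <= n%:R * mertens n by rewrite mulrBr; rewrite mulrDr in h; lra.
  by rewrite ler_pM2l.
apply: le_trans (ler_wpM2l (ltW n0') h2).
rewrite (@ln_fact_legendre n n) // mulr_sumr; apply: ler_sum => p pp.
rewrite mulr_sumr; apply: ler_sum => j _.
have P0 : 0 < (p ^ j)%:R :> R by rewrite ltr0n expn_gt0 prime_gt0.
rewrite mulrCA mulrC ler_wpM2l ?lnn_ge0 // ler_pdivlMr // -natrM ler_nat.
exact: leq_trunc_div.
Qed.

Lemma mertensB a b : (a <= b)%N ->
  mertens b - mertens a = \sum_(a.+1 <= p < b.+1 | prime p) lnn p / p%:R.
Proof.
by move=> ab; rewrite /mertens (big_cat_nat (n := a.+1) (p := b.+1)) //= addrAC subrr add0r.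
Qed.

Lemma sum_ln_prime_dvd q b : (0 < q)%N ->
  \sum_(1 <= p < b.+1 | prime p && ~~ coprime p q) lnn p <= lnn q.
Proof.
move=> q0; pose t := maxn b q.
rewrite (@lnn_prod_logn q t) //; last by apply: primes_leqW; rewrite leq_maxr.
rewrite [leRHS](big_cat_nat (n := b.+1)) //=; last by rewrite ltnS leq_maxl.
rewrite -[leLHS]addr0; apply: lerD; last first.
  by apply: sumr_ge0 => p _; rewrite mulr_ge0 ?lnn_ge0.
rewrite big_mkcondr; apply: ler_sum => p pp; case: ifP => h.
  rewrite ler_peMl ?lnn_ge0 // ler1n logn_gt0 mem_primes pp q0 /=.
  by rewrite prime_coprime // negbK in h.
by rewrite mulr_ge0 ?lnn_ge0.
Qed.

(** The loss 7 adds the errors 4 and 3 of the two Mertens bounds. The logarithms of the primes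
    dividing [q] add up to at most [lnn q], so those above [a] weigh at most [lnn q / a]. *)
Lemma mertens_window a b q : (0 < a)%N -> (a <= b)%N -> (0 < q)%N ->
  lnn b - lnn a - 7 - lnn q / a%:R <=
  \sum_(a.+1 <= p < b.+1 | prime p && coprime p q) lnn p / p%:R.
Proof.
move=> a0 ab q0; have b0 := leq_trans a0 ab.
have h1 := mertens_ge b0; have h2 := mertens_le a0; have h3 := mertensB ab.
rewrite (bigID (fun p => coprime p q)) /= in h3.
suff : \sum_(a.+1 <= p < b.+1 | prime p && ~~ coprime p q) lnn p / p%:R <= lnn q / a%:R.
  by move=> h4; lra.
have a0' : 0 < a%:R :> R by rewrite ltr0n.
apply: le_trans (ler_wpM2r _ (sum_ln_prime_dvd b q0)); last by rewrite invr_ge0 ltW.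
rewrite mulr_suml [leRHS](big_cat_nat (n := a.+1)) //=.
apply: ler_wpDl; first by apply: sumr_ge0 => p _; rewrite divr_ge0 ?lnn_ge0.
rewrite big_nat_cond [leRHS]big_nat_cond; apply: ler_sum => p /andP[/andP[h _] _].
by rewrite ler_wpM2l ?lnn_ge0 // lef_pV2 ?posrE ?ltr0n ?ler_nat //; lia.
Qed.

Lemma mertens_window_le a b : (0 < a)%N -> (a <= b)%N ->
  \sum_(a.+1 <= p < b.+1 | prime p) lnn p / p%:R <= lnn b - lnn a + 7.
Proof.
move=> a0 ab; have b0 := leq_trans a0 ab.
have h1 := mertens_le b0; have h2 := mertens_ge a0; have h3 := mertensB ab.
by rewrite -h3; lra.
Qed.

(** A lower Chebyshev bound out of Mertens: the window []x / 2^16, x]] has logarithmic length at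
    least 8, one more than the error 7. Its sum of [lnn p / p] is thus at least 1, and every [p] in
    it exceeds the integer part of [x / 2^16]. *)
Lemma theta_coprime_ge x q : (0 < q)%N ->
  (x %/ 2 ^ 16)%:R - lnn q <= \sum_(1 <= p < x.+1 | prime p && coprime p q) lnn p.
Proof.
move=> q0; have h := sum_ln_prime_dvd x q0.
suff : (x %/ 2 ^ 16)%:R <= theta x.
  rewrite /theta (bigID (fun p => coprime p q)) /=; lra.
set a := (x %/ 2 ^ 16)%N.
case: (posnP a) => [->|a0]; first by apply: sumr_ge0 => p _; rewrite lnn_ge0.
have a0' : 0 < a%:R :> R by rewrite ltr0n.
have ax : (a <= x)%N by apply: leq_div.
have x0 := leq_trans a0 ax.
have h1 := mertens_ge x0; have h2 := mertens_le a0; have h3 := mertensB ax.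
have h4 : lnn a + 8 <= lnn x.
  have : lnn (a * 2 ^ 16) <= lnn x by apply: lnn_le; rewrite leq_trunc_div.
  rewrite lnnM // lnnX //; have := lnn2_ge; lra.
have h5 : 1 <= \sum_(a.+1 <= p < x.+1 | prime p) lnn p / p%:R by lra.
rewrite /theta (big_cat_nat (n := a.+1)) //=.
apply: ler_wpDl; first by apply: sumr_ge0 => p _; rewrite lnn_ge0.
rewrite -[leLHS]mulr1; apply: le_trans (ler_wpM2l (ltW a0') h5) _.
rewrite mulr_sumr [leLHS]big_nat_cond [leRHS]big_nat_cond; apply: ler_sum => p /andP[/andP[h' _] _].
have p0 : 0 < p%:R :> R by rewrite ltr0n (leq_trans a0) // ltnW.
by rewrite mulrCA ger_pMr ?ler_pdivrMr ?mul1r ?ler_nat 1?ltnW // lnn_gt0 //; lia.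
Qed.

Lemma nat_root k x : (0 < k)%N -> exists s, (s ^ k <= x < s.+1 ^ k)%N.
Proof.
move=> k0; elim: x => [|x [s /andP[h1 h2]]].
  by exists 0%N; rewrite exp0n // exp1n.
case: (leqP (s.+1 ^ k) x.+1) => h.
  exists s.+1; rewrite h /=; apply: leq_ltn_trans (_ : _ <= s.+1 ^ k)%N _ => //.
  by rewrite ltn_exp2r.
by exists s; rewrite h (leq_trans h1).
Qed.

Lemma sum_trunc_log (c : R) p m t : (1 < p)%N -> (m <= t)%N ->
  \sum_(1 <= j < t.+1 | (p ^ j <= m)%N) c = (trunc_log p m)%:R * c.
Proof.
move=> p1 mt; case: (posnP m) => [->|m0].
  rewrite trunc_log0 mul0r big1 // => j; rewrite leqn0 expn_eq0; lia.
have e j : (p ^ j <= m)%N = (j <= trunc_log p m)%N.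
  apply/idP/idP => [|h]; first exact: trunc_log_max.
  by apply: leq_trans (trunc_logP p1 m0); rewrite leq_pexp2l // ltnW.
have lt : (trunc_log p m <= t)%N.
  apply: leq_trans mt; apply: leq_trans (trunc_logP p1 m0).
  by apply: ltnW; apply: ltn_expl.
rewrite -[X in X%:R * _](sum_iverson_leq lt) natr_sum mulr_suml big_mkcond.
by apply: eq_bigr => j _; rewrite e; case: ifP; rewrite ?mul1r ?mul0r.
Qed.

Lemma trunc_log_lnn_le p m : (1 < p)%N -> (trunc_log p m)%:R * lnn p <= lnn m.
Proof.
move=> p1; case: (posnP m) => [->|m0]; first by rewrite trunc_log0 mul0r lnn0.
by rewrite -lnnX ?lnn_le ?trunc_logP // ltnW.
Qed.

Lemma lnn_sq_root s x : (x < s.+1 ^ 2)%N -> lnn x <= 2 * s%:R.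
Proof.
move=> h; apply: le_trans (_ : lnn (s.+1 ^ 2) <= _); first by rewrite lnn_le // ltnW.
rewrite lnnX // ler_wpM2l // /lnn -natr1 addrC; apply: le_ln1Dx.
by apply: lt_le_trans (_ : 0 <= _); rewrite ?ltrN10.
Qed.

Lemma sum_prime_sq_le (c : R) Y s x : 0 <= c -> (x < s.+1 ^ 2)%N ->
  \sum_(1 <= p < Y.+1 | prime p && (p ^ 2 <= x)%N) c <= s%:R * c.
Proof.
move=> c0 xs; rewrite big_mkcond.
apply: le_trans (_ : \sum_(1 <= p < Y.+1) (if (p <= s)%N then c else 0) <= _).
  apply: ler_sum => p _; case: ifP => [/andP[_ h]|_]; last by case: ifP.
  suff -> : (p <= s)%N by [].
  by rewrite -ltnS -(ltn_exp2r _ _ (isT : 0 < 2)%N); apply: leq_ltn_trans xs.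
rewrite -[X in X%:R * _](@sum_iverson_leq s (maxn s Y)) ?leq_maxl // natr_sum mulr_suml.
rewrite [leRHS](big_cat_nat (n := Y.+1)) //=; last by rewrite ltnS leq_maxr.
apply: ler_wpDr; first by apply: sumr_ge0 => j _; rewrite mulr_ge0.
by apply: ler_sum => p _; case: ifP; rewrite ?mul1r ?mul0r.
Qed.

(** A prime [p <= x] contributes [lnn p], or at most [lnn x] if [p ^ 2 <= x]. The primes of the
    second kind number at most [sqrt x], and [lnn x] is at most twice the integer part of [sqrt x],
    whence [4 + 2]. *)
Lemma psi_le Y t x : (x <= t)%N ->
  \sum_(1 <= p < Y.+1 | prime p) \sum_(1 <= j < t.+1 | (p ^ j <= x)%N) lnn p <= 6 * x%:R.
Proof.
move=> xt; have [s /andP[s1 s2]] := @nat_root 2 x isT.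
apply: le_trans (_ : \sum_(1 <= p < Y.+1 | prime p)
   ((if (p <= x)%N then lnn p else 0) + (if (p ^ 2 <= x)%N then lnn x else 0)) <= _).
  apply: ler_sum => p pp; have p1 := prime_gt1 pp; rewrite sum_trunc_log //.
  have h0 := trunc_log_lnn_le x p1; have l0 := lnn_ge0 p; have l1 := lnn_ge0 x.
  case: (leqP p x) => h1; last first.
    have -> : trunc_log p x = 0%N by apply/eqP; rewrite trunc_log_eq0; lia.
    by rewrite mul0r add0r; case: ifP.
  case: (leqP (p ^ 2) x) => h2; first by lra.
  have -> : trunc_log p x = 1%N by apply: trunc_log_eq; rewrite // expn1 h1.
  by rewrite mul1r addr0.
rewrite big_split /=.
have h1 : \sum_(1 <= p < Y.+1 | prime p) (if (p <= x)%N then lnn p else 0) <= theta x.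
  rewrite -big_mkcondr /= /theta.
  apply: le_trans (_ : \sum_(1 <= p < (maxn x Y).+1 | prime p && (p <= x)%N) lnn p <= _).
    rewrite [leRHS](big_cat_nat (n := Y.+1)) //=; last by rewrite ltnS leq_maxr.
    by apply: ler_wpDr => //; apply: sumr_ge0 => j _; rewrite lnn_ge0.
  rewrite (big_cat_nat (n := x.+1)) //=; last by rewrite ltnS leq_maxl.
  rewrite [X in _ + X]big_nat_cond [X in _ + X]big1 ?addr0; last first.
    by move=> p /andP[/andP[h _] /andP[_ h']]; lia.
  by rewrite big_mkcondr; apply: ler_sum => p _; case: ifP => _ //; rewrite lnn_ge0.
have h2 := theta_le x.
have h3 : \sum_(1 <= p < Y.+1 | prime p) (if (p ^ 2 <= x)%N then lnn x else 0) <= s%:R * lnn x.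
  by rewrite -big_mkcondr; apply: sum_prime_sq_le => //; rewrite lnn_ge0.
have h4 := lnn_sq_root s2.
have h5 : s%:R * lnn x <= 2 * x%:R.
  apply: le_trans (ler_wpM2l _ h4) _ => //.
  by rewrite mulrCA ler_wpM2l // -natrM ler_nat.
lra.
Qed.

(** A prime above [sqrt Y] has [lnn Y <= 2 * lnn p], so these cost [2 * theta Y <= 8Y]; the primes
    up to [sqrt Y] cost at most [2Y]. *)
Lemma prime_count_le Y : (\sum_(1 <= p < Y.+1 | prime p) 1) * lnn Y <= 10 * Y%:R.
Proof.
have [s /andP[s1 s2]] := @nat_root 2 Y isT.
rewrite mulr_suml.
apply: le_trans (_ : \sum_(1 <= p < Y.+1 | prime p)
   ((if (p ^ 2 <= Y)%N then lnn Y else 0) + 2 * lnn p) <= _).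
  apply: ler_sum => p pp; have l0 := lnn_ge0 p; case: ifP => h; first by lra.
  rewrite mul1r add0r; have : lnn Y <= lnn (p ^ 2) by rewrite lnn_le // ltnW // ltnNge h.
  by rewrite lnnX // prime_gt0.
rewrite big_split /= -mulr_sumr -/(theta Y).
have h2 := theta_le Y.
have h3 : \sum_(1 <= p < Y.+1 | prime p) (if (p ^ 2 <= Y)%N then lnn Y else 0) <= s%:R * lnn Y.
  by rewrite -big_mkcondr; apply: sum_prime_sq_le => //; rewrite lnn_ge0.
have h4 := lnn_sq_root s2.
have h5 : s%:R * lnn Y <= 2 * Y%:R.
  apply: le_trans (ler_wpM2l _ h4) _ => //.
  by rewrite mulrCA ler_wpM2l // -natrM ler_nat.
lra.
Qed.
End PrimeSums.

(** * Harmonic sums over integers coprime to [q] *)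

Section HarmonicSums.
Variable R : realType.
Notation lnn := (lnn R).

(** Encoded as a [nat_pred] so that [(lep Z).-nat] are the [Z]-smooth and [(lep Z)^'.-nat] the
    [Z]-rough numbers, with the theory of [pi]-parts at hand. *)
Definition lep (Z : nat) : nat_pred := [pred p | (p <= Z)%N].

Lemma lep_natE Z n : (lep Z).-nat n = (0 < n)%N && all (leq^~ Z) (primes n).
Proof. by []. Qed.

Lemma lep_nat_leq Z n : (0 < n <= Z)%N -> (lep Z).-nat n.
Proof. by move=> /andP[n0 nZ]; rewrite lep_natE n0 primes_leqW. Qed.

Definition hsum (P : pred nat) X : R := \sum_(1 <= n < X.+1 | P n) n%:R^-1.

Lemma hsum_ge0 P X : 0 <= hsum P X.
Proof. by apply: sumr_ge0 => n _; rewrite invr_ge0. Qed.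

Lemma hsum_le P X X' : (X <= X')%N -> hsum P X <= hsum P X'.
Proof.
move=> h; rewrite /hsum [leRHS](big_cat_nat (n := X.+1)) //=.
by apply: ler_wpDr => //; apply: sumr_ge0 => n _; rewrite invr_ge0.
Qed.

Lemma hsum_sub (P Q : pred nat) X :
  (forall n, (0 < n)%N -> P n -> Q n) -> hsum P X <= hsum Q X.
Proof.
move=> h; rewrite /hsum [leLHS]big_mkcond [leRHS]big_mkcond; apply: ler_sum_nat => n /andP[n0 _].
case: ifP => [/(h _ n0) ->//|_]; by case: ifP => // _; rewrite invr_ge0.
Qed.

Lemma hsum_ge1 (P : pred nat) X : P 1%N -> (0 < X)%N -> 1 <= hsum P X.
Proof.
move=> P1 X0; rewrite /hsum big_ltn_cond // P1 invr1 lerDl.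
by apply: sumr_ge0 => n _; rewrite invr_ge0.
Qed.

Lemma hsumT_ge X : lnn X.+1 <= hsum predT X.
Proof.
elim: X => [|X IH]; first by rewrite lnn1 hsum_ge0.
rewrite /hsum big_nat_recr //= -/(hsum predT _).
have := lnnS_sub_le R (isT : 0 < X.+1)%N; rewrite lerBlDr => h.
by apply: le_trans h _; rewrite [leLHS]addrC lerD2r.
Qed.

Lemma hsumT_le X : hsum predT X <= 1 + lnn X.
Proof.
case: X => [|X]; first by rewrite /hsum big_geq // lnn0 addr0.
elim: X => [|X IH]; first by rewrite /hsum big_nat1 invr1 lnn1 addr0.
rewrite /hsum big_nat_recr //= -/(hsum predT _).
have h : X.+2%:R^-1 <= lnn X.+2 - lnn X.+1.
  have a0 : 0 < X.+1%:R :> R by rewrite ltr0n.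
  have h : ln (1 + (- X.+2%:R^-1)) <= - X.+2%:R^-1 :> R.
    by apply: le_ln1Dx; rewrite ltrN2 invf_lt1 ?ltr1n ?ltr0n.
  have e : 1 + (- X.+2%:R^-1) = X.+1%:R / X.+2%:R :> R.
    rewrite -[X.+2%:R]natr1; set a := X.+1%:R in a0 *; field; rewrite gt_eqF //; lra.
  rewrite e ln_div ?posrE ?ltr0n // in h.
  by rewrite -lerN2 opprB.
rewrite -(subrK (lnn X.+1) (lnn X.+2)) addrCA addrC lerD // addrC.
Qed.

Lemma hsum_multiples (P P' : pred nat) d X : (0 < d)%N ->
  (forall n, (0 < n)%N -> P (d * n)%N -> P' n) ->
  \sum_(1 <= n < X.+1 | P n && (d %| n)%N) n%:R^-1 <= d%:R^-1 * hsum P' (X %/ d) :> R.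
Proof.
move=> d0 h; rewrite (eq_bigl (fun n => (d %| n)%N && P n)); last by move=> n; rewrite andbC.
rewrite big_mkcondr sum_multiples // /hsum mulr_sumr [leRHS]big_mkcond.
apply: ler_sum_nat => n /andP[n0 _]; case: ifP => [/(h _ n0) ->|_].
  by rewrite natrM invfM.
by case: ifP => // _; rewrite mulr_ge0 ?invr_ge0.
Qed.

(** A finite Euler product. The [n] divisible by [p] are [p] times numbers of the same kind and
    contribute at most [E / p]; hence [E (1 - 1 / p)] is bounded by the sum for the remaining
    primes. *)
Lemma hsum_smooth_seq (ps : seq nat) X : all prime ps ->
  hsum [pred d | all [in ps] (primes d)] X <= \prod_(p <- ps) (1 - p%:R^-1)^-1.
Proof.
elim: ps => [|p ps IH] /=.
  move=> _; rewrite big_nil /hsum.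
  case: X => [|X]; first by rewrite big_geq.
  rewrite big_ltn_cond //= invr1 big_nat_cond big1 ?addr0 //.
  move=> n /andP[/andP[n1 _]]; have : pdiv n \in primes n by rewrite mem_primes pdiv_prime // pdiv_dvd ltnW.
  by move=> + /allP h => /h.
move=> /andP[pp aps]; rewrite big_cons.
have p1 := prime_gt1 pp; have p1' : 1 < p%:R :> R by rewrite ltr1n.
have c0 : 0 < 1 - p%:R^-1 :> R by rewrite subr_gt0 invf_lt1 // ltr0n prime_gt0.
rewrite ler_pdivlMl //.
apply: le_trans (IH aps).
set E := hsum _ _; rewrite mulrBl mul1r lerBlDr.
rewrite {1}/E /hsum (bigID (fun n => (p %| n)%N)) /= addrC; apply: lerD.
  rewrite [leLHS]big_mkcond [leRHS]big_mkcond; apply: ler_sum_nat => n /andP[n0 _].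
  case: ifP => [/andP[/allP h1 h2]|_]; last by case: ifP => // _; rewrite invr_ge0.
  suff -> : all [in ps] (primes n) by [].
  apply/allP => r hr; have := h1 _ hr; rewrite inE => /orP[/eqP e|//].
  by move: hr h2; rewrite e mem_primes => /and3P[_ _ ->].
apply: le_trans (_ : _ <= p%:R^-1 * hsum [pred d | all [in p :: ps] (primes d)] (X %/ p)) _.
  apply: hsum_multiples; first exact: prime_gt0.
  move=> n n0 /= /allP h; apply/allP => r hr; apply: h.
  by move: hr; rewrite !mem_primes muln_gt0 n0 (ltnW p1) => /and3P[-> _ /dvdn_mull ->].
by rewrite ler_wpM2l ?invr_ge0 // hsum_le // leq_div.
Qed.

Lemma partition_sum_nat (V : nmodType) (g : nat -> nat) (P Q : pred nat) X X' (f : nat -> V) :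
  (forall n, (1 <= n < X.+1)%N -> P n -> (1 <= g n < X'.+1)%N && Q (g n)) ->
  \sum_(1 <= n < X.+1 | P n) f n =
  \sum_(1 <= a < X'.+1 | Q a) \sum_(1 <= n < X.+1 | P n && (g n == a)) f n.
Proof.
move=> h; under [RHS]eq_bigr do rewrite big_mkcond.
rewrite exchange_big_nat /= big_mkcond; apply: eq_big_nat => n hn.
case: ifP => Pn; last by rewrite big1.
have /andP[h1 h2] := h _ hn Pn.
rewrite -big_mkcondr /= (eq_bigl (fun a => (a == g n) && Q a)); last first.
  by move=> a; rewrite andbC eq_sym.
by rewrite big_mkcondr big_nat1_eq h1 h2.
Qed.

(** Every [n] is its [pi]-part times its [pi^']-part, and the fibre over a [pi]-part [a] consists of
    products [a * b] with [b] a [pi^']-number. *)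
Lemma hsum_part_le (pi : nat_pred) (P : pred nat) X :
  (forall n, (0 < n)%N -> P n -> P (n`_pi)%N) ->
  hsum P X <= hsum (predI P (pnat pi)) X * hsum (pnat pi^') X.
Proof.
move=> h; rewrite {1}/hsum (partition_sum_nat (g := fun n => (n`_pi)%N) (X' := X)
  (Q := predI P (pnat pi))); last first.
  move=> n /andP[n0 nX] Pn; rewrite /= h // part_pnat part_gt0 !andbT.
  by apply: leq_ltn_trans nX; apply: dvdn_leq => //; apply: dvdn_part.
rewrite {2}/hsum mulr_suml [leLHS]big_nat_cond [leRHS]big_nat_cond; apply: ler_sum => a.
move=> /andP[/andP[a0 aX] /andP[Pa pa]].
apply: le_trans (_ : \sum_(1 <= n < X.+1 | (n`_pi == a)%N && (a %| n)%N) n%:R^-1 <= _).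
  rewrite [leLHS]big_mkcond [leRHS]big_mkcond; apply: ler_sum => n _.
  case: ifP => [/andP[_ h']|_]; last by case: ifP => // _; rewrite invr_ge0.
  by rewrite h' -(eqP h') dvdn_part.
apply: le_trans (hsum_multiples (P := fun n => (n`_pi == a)%N) (P' := pnat pi^') _ _ _) _ => //.
  move=> n n0; rewrite partnM // (part_pnat_id pa) => /eqP e.
  rewrite -partn_eq1 //; apply/eqP; have : (a * n`_pi = a * 1)%N by rewrite e muln1.
  by move/eqP; rewrite eqn_pmul2l // => /eqP.
by rewrite ler_wpM2l ?invr_ge0 // hsum_le // leq_div.
Qed.

(** The product of the two sums runs over products [a * b], which are distinct because [a] and [b]
    are the [pi]-part and the [pi^']-part of [a * b]. *)
Lemma hsum_mul_le (pi : nat_pred) (P Q : pred nat) X1 X2 :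
  (forall a b, (0 < a)%N -> P a -> pi^'.-nat b -> (b <= X2)%N -> Q (a * b)%N) ->
  hsum (predI P (pnat pi)) X1 * hsum (pnat pi^') X2 <= hsum Q (X1 * X2).
Proof.
move=> h; case: (posnP X2) => [->|X20].
  by rewrite muln0 {2}/hsum [X in _ * X]big_geq // mulr0 hsum_ge0.
rewrite [leRHS]/hsum (partition_sum_nat (g := fun n => (n`_pi)%N) (X' := (X1 * X2)%N)
  (Q := pnat pi)); last first.
  move=> n /andP[n0 nX] Pn; rewrite /= part_pnat part_gt0 !andbT.
  by apply: leq_ltn_trans nX; apply: dvdn_leq => //; apply: dvdn_part.
have XX : (X1 <= X1 * X2)%N by apply: leq_pmulr.
rewrite [leRHS](big_cat_nat (n := X1.+1)) //=.
apply: ler_wpDr.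
  by do 2 (apply: sumr_ge0 => ? _); rewrite invr_ge0.
rewrite {1}/hsum mulr_suml [leLHS]big_mkcond [leRHS]big_mkcond; apply: ler_sum_nat => a /andP[a0 aX].
case: ifP => [/andP[Pa pa]|_]; last first.
  by case: ifP => // _; apply: sumr_ge0 => ? _; rewrite invr_ge0.
rewrite pa.
apply: le_trans (_ : \sum_(1 <= n < (X1 * X2).+1 | (a %| n)%N) (if Q n && (n`_pi == a)%N then n%:R^-1 else 0) <= _); last first.
  rewrite [leLHS]big_mkcond [leRHS]big_mkcond; apply: ler_sum => n _.
  case: ifP => _ //; by case: ifP => _ //; rewrite invr_ge0.
rewrite sum_multiples // /hsum mulr_sumr.
have h1 : (X2 <= (X1 * X2) %/ a)%N by rewrite leq_divRL // mulnC leq_mul2r -ltnS aX orbT.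
rewrite [leRHS](big_cat_nat (n := X2.+1)) //=.
apply: ler_wpDr; first by apply: sumr_ge0 => ? _; case: ifP => _ //; rewrite invr_ge0.
rewrite [leLHS]big_mkcond; apply: ler_sum_nat => b /andP[b0 bX].
case: ifP => [pb|_]; last by case: ifP => _ //; rewrite invr_ge0.
rewrite h // partnM // (part_pnat_id pa) part_p'nat // muln1 eqxx /=.
by rewrite natrM invfM.
Qed.

Lemma lep_pnat'_coprime q Z b : (0 < q <= Z)%N -> (lep Z)^'.-nat b -> coprime b q.
Proof.
by move=> h hb; rewrite coprime_sym; apply: pnat_coprime hb; apply: lep_nat_leq.
Qed.

Notation copr q := (fun n => coprime n q).

Lemma sum_lnn_expand (P : pred nat) Z X (f : nat -> R) :
  (forall n, (0 < n)%N -> P n -> (lep Z).-nat n) ->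
  \sum_(1 <= n < X.+1 | P n) lnn n * f n =
  \sum_(1 <= p < Z.+1 | prime p) \sum_(1 <= j < X.+1)
     lnn p * \sum_(1 <= n < X.+1 | P n && (p ^ j %| n)%N) f n.
Proof.
move=> h; rewrite [LHS]big_mkcond.
rewrite (eq_big_nat _ _ (F2 := fun n => \sum_(1 <= p < Z.+1 | prime p)
      \sum_(1 <= j < X.+1) (if P n && (p ^ j %| n)%N then lnn p * f n else 0))); last first.
  move=> n /andP[n0 nX]; case: ifP => Pn /=; last first.
    by rewrite big1 // => p _; rewrite big1.
  have /andP[_ sm] := h _ n0 Pn.
  rewrite (lnn_sum_prime_powers R n0 nX sm) mulr_suml; apply: eq_bigr => p _.
  by rewrite mulr_suml big_mkcond.
rewrite exchange_big_nat /=; apply: eq_bigr => p _.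
rewrite exchange_big_nat /=; apply: eq_bigr => j _.
by rewrite -big_mkcond mulr_sumr.
Qed.

(* Markov's inequality for [ln n]: at least half of the smooth mass lies below [Z ^ 3]. *)
Lemma hsum_smooth_markov q Z X : 12 <= lnn Z ->
  hsum (predI (copr q) (pnat (lep Z))) X <= 2 * hsum (copr q) (Z ^ 3).
Proof.
move=> Z12; have Z1 : (1 < Z)%N.
  by rewrite ltnNge; apply/negP => h; have := lnn_le R h; rewrite lnn1; lra.
set P := predI _ _; set A := hsum P X.
have A0 : 0 <= A by rewrite hsum_ge0.
(* The mean of [lnn a] under the weights [1 / a] is at most the sum of [lnn p / p ^ j]; the 6 adds
   Mertens' error 4 and the bound 2 for higher powers. *)
have AL : \sum_(1 <= a < X.+1 | P a) lnn a * a%:R^-1 <= (lnn Z + 6) * A.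
  rewrite (sum_lnn_expand (Z := Z)); last by move=> n _ /andP[].
  have h := prime_power_sum_le R X (ltnW Z1); have h' := mertens_le R (ltnW Z1).
  apply: le_trans (_ : (mertens R Z + 2) * A <= _); last by rewrite ler_wpM2r //; lra.
  apply: le_trans (ler_wpM2r A0 h); rewrite mulr_suml; apply: ler_sum => p pp.
  rewrite mulr_suml; apply: ler_sum => j _.
  rewrite -mulrA ler_wpM2l ?lnn_ge0 //.
  have pj : (0 < p ^ j)%N by rewrite expn_gt0 prime_gt0.
  apply: le_trans (hsum_multiples (P' := P) _ pj _) _.
    by move=> n n0 /andP[]; rewrite coprimeMl pnatM => /andP[_ h1] /andP[_ h2]; apply/andP.
  by rewrite ler_wpM2l ?invr_ge0 // hsum_le // leq_div.
have h2 : \sum_(1 <= a < X.+1 | P a && (Z ^ 3 < a)%N) a%:R^-1 <= A / 2.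
  have L0 : 0 < 3 * lnn Z by lra.
  rewrite -(ler_pM2l L0).
  apply: le_trans (_ : (lnn Z + 6) * A <= _); last first.
    have -> : 3 * lnn Z * (A / 2) = (3 * lnn Z / 2) * A by ring.
    by rewrite ler_wpM2r //; lra.
  apply: le_trans AL; rewrite mulr_sumr big_mkcondr; apply: ler_sum => a _.
  case: ifP => h; last by rewrite mulr_ge0 ?lnn_ge0 ?invr_ge0.
  rewrite ler_wpM2r ?invr_ge0 //; have := lnn_le R (ltnW h).
  by rewrite lnnX // ltnW.
have h3 : \sum_(1 <= a < X.+1 | P a && ~~ (Z ^ 3 < a)%N) a%:R^-1 <= hsum (copr q) (Z ^ 3).
  apply: le_trans (_ : \sum_(1 <= a < (maxn X (Z ^ 3)).+1 | P a && ~~ (Z ^ 3 < a)%N) a%:R^-1 <= _).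
    rewrite [leRHS](big_cat_nat (n := X.+1)) //=; last by rewrite ltnS leq_maxl.
    by apply: ler_wpDr => //; apply: sumr_ge0 => j _; rewrite invr_ge0.
  rewrite (big_cat_nat (n := (Z ^ 3).+1)) //=; last by rewrite ltnS leq_maxr.
  rewrite [X in _ + X]big_nat_cond [X in _ + X]big1 ?addr0; last first.
    by move=> a /andP[/andP[h _] /andP[_ h']]; rewrite h in h'.
  rewrite /hsum [leLHS]big_mkcond [leRHS]big_mkcond; apply: ler_sum => a _.
  case: ifP => [/andP[/andP[/= -> _] _]//|_]; by case: ifP => _ //; rewrite invr_ge0.
have : A = \sum_(1 <= a < X.+1 | P a && (Z ^ 3 < a)%N) a%:R^-1 +
   \sum_(1 <= a < X.+1 | P a && ~~ (Z ^ 3 < a)%N) a%:R^-1.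
  by rewrite /A /hsum (bigID (fun a => (Z ^ 3 < a)%N)).
lra.
Qed.

(** Integers up to [Z] are smooth and have harmonic sum at least [lnn Z]; their products with rough
    numbers up to [X] are distinct integers up to [Z * X]. *)
Lemma hsum_rough_le Z X : hsum (pnat (lep Z)^') X * lnn Z <= 1 + lnn (Z * X).
Proof.
apply: le_trans (hsumT_le _); rewrite mulrC.
apply: le_trans _ (@hsum_mul_le (lep Z) predT predT Z X _); last by [].
rewrite ler_wpM2r ?hsum_ge0 //.
apply: le_trans (_ : hsum predT Z <= _).
  by apply: le_trans (hsumT_ge _); rewrite lnn_le.
rewrite /hsum [leLHS]big_nat_cond [leRHS]big_nat_cond (eq_bigl (fun n => (0 < n < Z.+1)%N && predI predT (lep Z).-nat n)) // => n.
by rewrite /= andbT; case e: (0 < n < Z.+1)%N => //=; rewrite lep_nat_leq.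
Qed.

(** Uniform in [q]: Markov confines the smooth part below [Z ^ 3], and the rough part, bounded
    without regard to [q], brings a factor that is linear in [lnn X]. *)
Lemma hsum_coprime_growth q Z X : 12 <= lnn Z ->
  hsum (copr q) X * lnn Z <= 2 * hsum (copr q) (Z ^ 3) * (1 + lnn (Z * X)).
Proof.
move=> Z12.
have h1 : hsum (copr q) X <=
    hsum (predI (copr q) (pnat (lep Z))) X * hsum (pnat (lep Z)^') X.
  apply: hsum_part_le => n n0 h; apply: coprime_dvdl h; exact: dvdn_part.
have h2 := hsum_smooth_markov q X Z12.
have h3 := hsum_rough_le Z X.
have r0 := hsum_ge0 (pnat (lep Z)^') X.
apply: le_trans (ler_wpM2r (lnn_ge0 R Z) h1) _; rewrite -[leLHS]mulrA.
apply: le_trans (ler_wpM2r _ h2) _; first by rewrite mulr_ge0 // lnn_ge0.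
by rewrite ler_wpM2l // mulr_ge0 // hsum_ge0.
Qed.

(** The opposite direction. As [q <= Z], multiplication by [Z]-rough numbers preserves coprimality
    to [q], and the harmonic sum of the rough numbers up to [X] is at least of order
    [lnn X / lnn Z]. *)
Lemma hsum_coprime_long q Z X : 12 <= lnn Z -> (0 < q <= Z)%N ->
  hsum (copr q) Z * lnn X <= 2 * (1 + 3 * lnn Z) * hsum (copr q) (Z * X).
Proof.
move=> Z12 qZ; have Z1 : (0 < Z)%N by lia.
have h1 : hsum predT X <= hsum (predI predT (pnat (lep Z))) X * hsum (pnat (lep Z)^') X.
  exact: hsum_part_le.
have h2 : hsum (predI predT (pnat (lep Z))) X <= 2 * (1 + 3 * lnn Z).
  have := hsum_smooth_markov 1 X Z12; have := hsumT_le (Z ^ 3); rewrite lnnX //.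
  have -> : hsum (copr 1) (Z ^ 3) = hsum predT (Z ^ 3).
    by apply: eq_bigl => n; rewrite coprimen1.
  have -> : hsum (predI (copr 1) (lep Z).-nat) X = hsum (predI predT (pnat (lep Z))) X.
    by apply: eq_bigl => n; rewrite /= coprimen1.
  lra.
have h3 : hsum (copr q) Z * hsum (pnat (lep Z)^') X <= hsum (copr q) (Z * X).
  apply: le_trans _ (@hsum_mul_le (lep Z) (copr q) (copr q) Z X _); last first.
    by move=> a b a0 Pa hb _; rewrite coprimeMl Pa (lep_pnat'_coprime qZ).
  rewrite ler_wpM2r ?hsum_ge0 // /hsum [leLHS]big_nat_cond [leRHS]big_nat_cond.
  rewrite (eq_bigl (fun n => (0 < n < Z.+1)%N && predI (copr q) (lep Z).-nat n)) // => n.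
  by rewrite /=; case e: (0 < n < Z.+1)%N => //=; rewrite lep_nat_leq // andbT.
have h4 := le_trans (lnn_le R (leqnSn X)) (hsumT_ge X).
have r0 := hsum_ge0 (pnat (lep Z)^') X.
have s0 := hsum_ge0 (copr q) Z.
apply: le_trans (ler_wpM2l s0 (le_trans h4 h1)) _.
rewrite mulrCA; apply: le_trans (ler_pM _ _ h2 h3) => //; first by rewrite hsum_ge0.
by rewrite mulr_ge0.
Qed.

Lemma totient_frac q : (0 < q)%N ->
  (totient q)%:R / q%:R = \prod_(p <- primes q) (1 - p%:R^-1) :> R.
Proof.
move=> q0; rewrite totientE //.
have -> : q%:R = \prod_(p <- primes q) (p ^ logn p q)%:R :> R.
  by rewrite -natr_prod {1}(prod_prime_decomp q0) prime_decompE big_map.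
rewrite natr_prod -prodf_div big_seq [RHS]big_seq; apply: eq_bigr => p hp.
have pp : prime p by move: hp; rewrite mem_primes => /andP[].
have l0 : (0 < logn p q)%N by rewrite logn_gt0.
have p0 : p%:R != 0 :> R by rewrite pnatr_eq0 -lt0n prime_gt0.
rewrite -{2}(prednK l0) expnS !natrM.
have e0 : (p ^ (logn p q).-1)%:R != 0 :> R by rewrite pnatr_eq0 -lt0n expn_gt0 prime_gt0.
have -> : p.-1%:R = p%:R - 1 :> R by rewrite -{2}(prednK (prime_gt0 pp)) -natr1 addrK.
by field; rewrite e0 p0.
Qed.

(** Each integer is a product of primes dividing [q] times a number coprime to [q], and the former
    factors have harmonic sum at most the Euler product [q / totient q]. *)
Lemma hsum_coprime_ge q X : (0 < q)%N ->
  (totient q)%:R / q%:R * lnn X <= hsum (copr q) X.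
Proof.
move=> q0; rewrite totient_frac //; set T := \prod_(p <- _) _.
have ap : all prime (primes q) by apply/allP => p; rewrite mem_primes => /andP[].
have T0 : 0 < T.
  rewrite /T big_seq; apply: prodr_gt0 => p hp; have pp := allP ap _ hp.
  by rewrite subr_gt0 invf_lt1 ?ltr1n ?prime_gt1 // ltr0n prime_gt0.
have h1 : hsum predT X <= hsum (predI predT (pnat \pi(q))) X * hsum (pnat (\pi(q))^') X.
  exact: hsum_part_le.
have h2 : hsum (predI predT (pnat \pi(q))) X <= T^-1.
  rewrite /T -prodfV; apply: le_trans (hsum_smooth_seq X ap).
  by apply: hsum_sub => n n0 /andP[_ /andP[_ h]].
have h3 : hsum (pnat (\pi(q))^') X = hsum (copr q) X.
  rewrite /hsum [LHS]big_nat_cond [RHS]big_nat_cond; apply: eq_bigl => n.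
  case: (ltnP 0 n) => //= n0; rewrite -coprime_pi' // coprime_sym //.
have h4 := le_trans (lnn_le R (leqnSn X)) (hsumT_ge X).
rewrite mulrC -ler_pdivlMr // mulrC; rewrite h3 in h1.
apply: le_trans h4 (le_trans h1 _); by rewrite ler_wpM2r // hsum_ge0.
Qed.
End HarmonicSums.

(** * Selberg's sieve in a residue class *)

Section Residues.
Variable q : nat.
Hypothesis q1 : (1 < q)%N.

(** The [n] that are not coprime to [q] get the default class 1; the counts below restrict to [n]
    coprime to [q], where the default does not occur. *)
Definition cls (n : nat) : {unit 'Z_q} := insubd (1%g : {unit 'Z_q}) (n%:R : 'Z_q).

Lemma unit_natr n : ((n%:R : 'Z_q) \is a GRing.unit) = coprime n q.
Proof. by rewrite unitZpE // coprime_sym. Qed.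

Lemma val_cls n : coprime n q -> val (cls n) = n%:R.
Proof. by move=> h; rewrite /cls insubdK // unit_natr. Qed.

Lemma natr_eq_unit n (g : {unit 'Z_q}) : (n%:R == val g) = coprime n q && (cls n == g).
Proof.
apply/idP/andP => [/eqP h|[c /eqP <-]]; last by rewrite val_cls.
have c : coprime n q by rewrite -unit_natr h (valP g).
by split=> //; rewrite -val_eqE /= val_cls // h.
Qed.

Lemma clsM m n : coprime m q -> coprime n q -> cls (m * n) = (cls m * cls n)%g.
Proof.
move=> cm cn; apply: val_inj; rewrite val_cls ?coprimeMl ?cm //=.
rewrite natrM -!val_cls //.
Qed.

Lemma cls1 : cls 1 = 1%g.
Proof. by apply: val_inj; rewrite val_cls ?coprime1n. Qed.

Lemma clsX m k : coprime m q -> cls (m ^ k) = (cls m ^+ k)%g.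
Proof.
move=> cm; elim: k => [|k IH]; first by rewrite expn0 cls1 expg0.
by rewrite expnS clsM ?coprimeXl // IH expgS.
Qed.

Lemma unit_mulC (g h : {unit 'Z_q}) : (g * h = h * g)%g.
Proof. by apply: val_inj; rewrite /= mulrC. Qed.

Lemma card_unit : #|[set: {unit 'Z_q}]| = totient q.
Proof. by rewrite -card_units_Zp // ltnW. Qed.

Lemma sum_mod_eq r x : (r < q)%N ->
  (\sum_(0 <= n < x) (n %% q == r) = (x + (q - r.+1)) %/ q)%N.
Proof.
move=> rq; elim: x => [|x IH].
  by rewrite big_geq // add0n divn_small //; lia.
rewrite big_nat_recr //= IH addSn divnS; last by lia.
rewrite addnC; congr (_ + _)%N; congr nat_of_bool.
have -> : ((x + (q - r.+1)).+1 = (x + q) - r)%N by lia.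
by rewrite -eqn_mod_dvd; [rewrite modnDr (modn_small rq)|lia].
Qed.
End Residues.

Section Counting.
Variable R : realType.
Variable q : nat.
Hypothesis q1 : (1 < q)%N.
Local Notation cls := (cls q).

Definition cnt (g : {unit 'Z_q}) x : R := \sum_(1 <= n < x.+1 | (n%:R == val g)) 1.

Lemma cnt_approx g x : `|cnt g x - x%:R / q%:R| <= 2.
Proof.
have q0 : 0 < q%:R :> R by rewrite ltr0n ltnW.
pose r := nat_of_ord (val g).
have rq : (r < q)%N by rewrite /r -[X in (_ < X)%N](Zp_cast q1).
have e n : (n%:R == val g) = (n %% q == r)%N.
  by rewrite -(inj_eq val_inj) /= val_Zp_nat.
(* [sum_mod_eq] starts at 0 and [cnt] at 1, whence the correction by the term at 0. *)
have -> : cnt g x = ((x.+1 + (q - r.+1)) %/ q)%:R - ((0 %% q)%N == r)%:R.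
  rewrite -sum_mod_eq // big_ltn // natrD addrAC subrr add0r natr_sum /cnt big_mkcond.
  by apply: eq_bigr => n _; rewrite e; case: ifP.
set c := (_ + _)%N; set b := (0 %% q == r)%N.
have h1 : (c %/ q)%:R * q%:R <= c%:R :> R by rewrite -natrM ler_nat leq_trunc_div.
have h2 : c%:R <= ((c %/ q)%:R + 1) * q%:R :> R.
  by rewrite natr1 -natrM ler_nat ltnW // -ltn_divLR // ltnW.
have h3a : x%:R <= c%:R :> R by rewrite ler_nat /c; lia.
have h3b : c%:R <= x%:R + q%:R :> R by rewrite -natrD ler_nat /c; lia.
have h4a : 0 <= b%:R :> R by [].
have h4b : b%:R <= 1 :> R by rewrite lern1 leq_b1.
rewrite -ler_pdivlMr // in h1; rewrite -ler_pdivrMr // in h2.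
have h5 : x%:R / q%:R <= c%:R / q%:R :> R by rewrite ler_pM2r ?invr_gt0.
have h6 : c%:R / q%:R <= x%:R / q%:R + 1 :> R.
  by rewrite -[X in _ + X](@divff _ q%:R) ?gt_eqF // -mulrDl ler_pM2r ?invr_gt0.
rewrite ler_norml; move: h1 h2 h5 h6.
set A := x%:R / q%:R; set B := c%:R / q%:R; set C := (c %/ q)%:R; set E := b%:R.
by move: h4a h4b; rewrite -/E => *; apply/andP; split; lra.
Qed.

Lemma cnt_multiples d (g : {unit 'Z_q}) x : coprime d q -> (0 < d)%N ->
  `|\sum_(1 <= n < x.+1 | (d %| n)%N && (n%:R == val g)) 1 - x%:R / (d * q)%:R| <= 3 :> R.
Proof.
move=> cd d0; rewrite big_mkcondr sum_multiples //.
have -> : \sum_(1 <= m < (x %/ d).+1) (if (d * m)%:R == val g then 1 else 0) =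
          cnt ((cls d)^-1 * g)%g (x %/ d).
  rewrite /cnt [RHS]big_mkcond; apply: eq_bigr => m _.
  rewrite !natr_eq_unit // coprimeMl cd /=; case cm: (coprime m q) => //=.
  by rewrite clsM // -(inj_eq (mulgI (cls d)^-1%g)) mulKg.
have q0 : 0 < q%:R :> R by rewrite ltr0n ltnW.
have d0' : 0 < d%:R :> R by rewrite ltr0n.
have := cnt_approx ((cls d)^-1 * g)%g (x %/ d); set c := cnt _ _ => h.
have h1 : (x %/ d)%:R <= x%:R / d%:R :> R by rewrite ler_pdivlMr // -natrM ler_nat leq_trunc_div.
have h2 : x%:R / d%:R <= (x %/ d)%:R + 1 :> R.
  by rewrite ler_pdivrMr // natr1 -natrM ler_nat ltnW // -ltn_divLR.
have e : x%:R / (d * q)%:R = (x%:R / d%:R) / q%:R :> R by rewrite natrM invfM mulrA.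
rewrite e; move: h1 h2; set u := x%:R / d%:R; set v := (x %/ d)%:R in h *.
have qq : q%:R^-1 <= 1 :> R by rewrite invf_le1 // ler1n ltnW.
move=> h1 h2.
have h3 : v / q%:R <= u / q%:R by rewrite ler_pM2r ?invr_gt0.
have h4 : u / q%:R <= v / q%:R + 1.
  apply: le_trans (_ : (v + 1) / q%:R <= _); first by rewrite ler_pM2r ?invr_gt0.
  by rewrite mulrDl mul1r lerD2l.
move: h; rewrite !ler_norml => /andP[a1 a2]; apply/andP; split; lra.
Qed.

(** The weight at [p] is [v0 p] plus [v1 p - v0 p] on the multiples of [p]. The induction expands
    one prime at a time, [d] collecting the primes whose divisibility is imposed. The main term is a
    product of local means, and 6 is twice the error of [cnt_multiples]. *)
Lemma sieve_product (ps : seq nat) (v0 v1 : nat -> R) a b (g : {unit 'Z_q}) d :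
  (a <= b)%N -> uniq ps -> all prime ps -> (forall p, p \in ps -> coprime p q) ->
  (forall p, p \in ps -> coprime p d) -> coprime d q -> (0 < d)%N ->
  `|\sum_(a.+1 <= n < b.+1 | (d %| n)%N && (n%:R == val g))
       \prod_(p <- ps) (if (p %| n)%N then v1 p else v0 p)
    - (b%:R - a%:R) / (d * q)%:R * \prod_(p <- ps) (v0 p + (v1 p - v0 p) / p%:R)|
  <= 6 * \prod_(p <- ps) (`|v0 p| + `|v1 p - v0 p|).
Proof.
move=> ab; elim: ps d => [|p ps IH] d.
  move=> _ _ _ _ cd d0; rewrite !big_nil !mulr1.
  under eq_bigr do rewrite big_nil.
  have h1 := cnt_multiples g a cd d0; have h2 := cnt_multiples g b cd d0.
  move: h2; rewrite (big_cat_nat (n := a.+1) (p := b.+1)) //=.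
  rewrite mulrBl; move: h1; rewrite !ler_norml => /andP[? ?] /andP[? ?]; apply/andP; split; lra.
move=> /= /andP[pps ups] /andP[pp aps] cq cpd cd d0.
have Ip := IH d ups aps _ _ cd d0; have Jp := IH (d * p)%N ups aps _ _ _ _.
have c1 : forall r, r \in ps -> coprime r q by move=> r hr; apply: cq; rewrite inE hr orbT.
have c2 : forall r, r \in ps -> coprime r d by move=> r hr; apply: cpd; rewrite inE hr orbT.
have c3 : coprime p q by apply: cq; rewrite mem_head.
have c4 : coprime p d by apply: cpd; rewrite mem_head.
have c5 : forall r, r \in ps -> coprime r (d * p).
  move=> r hr; rewrite coprimeMr c2 //= prime_coprime ?(allP aps) //.
  apply/negP => h; have := dvdn_prime2 (allP aps _ hr) pp; rewrite h => /esym/eqP e.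
  by rewrite -e hr in pps.
have {Ip}h1 := Ip c1 c2.
have {Jp}h2 := Jp c1 c5 ltac:(by rewrite coprimeMl cd) ltac:(by rewrite muln_gt0 d0 prime_gt0).
under eq_bigr do rewrite big_cons.
rewrite !big_cons.
set F := fun n => \prod_(j <- ps) (if (j %| n)%N then v1 j else v0 j).
have -> : \sum_(a.+1 <= n < b.+1 | (d %| n)%N && (n%:R == val g))
     (if (p %| n)%N then v1 p else v0 p) * F n =
   v0 p * \sum_(a.+1 <= n < b.+1 | (d %| n)%N && (n%:R == val g)) F n +
   (v1 p - v0 p) * \sum_(a.+1 <= n < b.+1 | (d * p %| n)%N && (n%:R == val g)) F n.
  rewrite [X in _ + _ * X]big_mkcond [X in _ = _ * X + _]big_mkcond [LHS]big_mkcond !mulr_sumr -big_split /=.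
  apply: eq_bigr => n _; rewrite Gauss_dvd; last by rewrite coprime_sym.
  case: (n%:R == val g); rewrite ?andbT ?andbF ?mulr0 ?addr0 //.
  case: (d %| n)%N; rewrite /= ?mulr0 ?addr0 //; case: ifP => _; ring.
have p0 : 0 < p%:R :> R by rewrite ltr0n prime_gt0.
move: h1 h2; rewrite -/F.
set S1 := \sum_(_ <= _ < _ | _) _; set S2 := \sum_(_ <= _ < _ | _) _.
set M := \prod_(_ <- _) _; set E := \prod_(_ <- _) _.
have -> : (b%:R - a%:R) / (d * p * q)%:R * M = ((b%:R - a%:R) / (d * q)%:R * M) / p%:R.
  rewrite !natrM; field; rewrite !pnatr_eq0 -!lt0n d0 prime_gt0 //=; lia.
set X := (b%:R - a%:R) / (d * q)%:R * M => h1 h2.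
have -> : (b%:R - a%:R) / (d * q)%:R * ((v0 p + (v1 p - v0 p) / p%:R) * M) =
  v0 p * X + (v1 p - v0 p) * (X / p%:R) by rewrite /X; ring.
have -> : v0 p * S1 + (v1 p - v0 p) * S2 - (v0 p * X + (v1 p - v0 p) * (X / p%:R)) =
   v0 p * (S1 - X) + (v1 p - v0 p) * (S2 - X / p%:R) by ring.
apply: le_trans (ler_normD _ _) _; rewrite !normrM.
have -> : 6 * ((`|v0 p| + `|v1 p - v0 p|) * E) = `|v0 p| * (6 * E) + `|v1 p - v0 p| * (6 * E) by ring.
by apply: lerD; rewrite ler_wpM2l.
Qed.

Definition sqf (m : nat) := m == (\prod_(p <- primes m) p)%N.
Definition rad (m : nat) := (\prod_(p <- primes m) p)%N.

Lemma primes_rad m : primes (rad m) = primes m.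
Proof.
apply/eq_primes => p; apply/idP/idP.
  rewrite mem_primes => /and3P[pp _]; rewrite /rad => h.
  have : (has (fun r => (p %| r)%N) (primes m)).
    by rewrite Euclid_dvd_prod // big_has in h.
  move=> /hasP[r hr]; have pr : prime r by move: hr; rewrite mem_primes => /andP[].
  by rewrite dvdn_prime2 // => /eqP ->.
move=> h; have pp : prime p by move: h; rewrite mem_primes => /andP[].
rewrite mem_primes pp /=; apply/andP; split.
  rewrite /rad big_seq; apply: prodn_cond_gt0 => r; rewrite mem_primes => /andP[/prime_gt0 //].
by rewrite /rad (big_rem p) //= dvdn_mulr.
Qed.

Lemma sqf_rad m : sqf (rad m).
Proof. by rewrite /sqf primes_rad. Qed.

Lemma rad_le m : (0 < m)%N -> (rad m <= m)%N.
Proof.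
move=> m0; rewrite {2}(prod_prime_decomp m0) prime_decompE big_map /= /rad.
rewrite [X in (X <= _)%N]big_seq [X in (_ <= X)%N]big_seq; apply: leq_prod => p hp.
have l0 : (0 < logn p m)%N by rewrite logn_gt0.
have pp : prime p by move: hp; rewrite mem_primes => /andP[].
by rewrite -{1}(expn1 p) leq_pexp2l // prime_gt0.
Qed.

Lemma rad_gt0 m : (0 < rad m)%N.
Proof. by rewrite /rad big_seq; apply: prodn_cond_gt0 => r; rewrite mem_primes => /andP[/prime_gt0 //]. Qed.

Lemma coprime_primes m n : (0 < n)%N -> (0 < m)%N -> coprime m n = all (fun p => ~~ (p %| n)%N) (primes m).
Proof.
move=> n0 m0; rewrite coprime_sym coprime_has_primes // -all_predC.
apply: eq_in_all => p /=; rewrite [in X in X -> _]mem_primes => /andP[pp _].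
by rewrite mem_primes pp n0.
Qed.

Definition pset (ps : seq nat) (n : nat) := all [in ps] (primes n) && all [in primes n] ps.

(** Each prime of the set contributes [1/p + 1/p^2 + ... = 1/(p-1)]. After division by [p] the set
    of primes is unchanged or loses [p], which gives [E <= (E + M) / p]. *)
Lemma hsum_pset (ps : seq nat) X : uniq ps -> all prime ps ->
  hsum R (pset ps) X <= \prod_(p <- ps) (p%:R - 1)^-1.
Proof.
elim: ps => [|p ps IH] /=.
  move=> _ _; have := @hsum_smooth_seq R [::] X isT; rewrite !big_nil; apply: le_trans.
  by apply: hsum_sub => n _ /andP[].
move=> /andP[pps ups] /andP[pp aps]; rewrite big_cons.
have p1 := prime_gt1 pp; have p1' : 1 < p%:R :> R by rewrite ltr1n.
have {IH}h := IH ups aps.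
set E := hsum _ _ _; set M := \prod_(_ <- _) _ in h *.
suff hE : E <= p%:R^-1 * (E + M).
  rewrite ler_pdivlMl; last by lra.
  move: hE; rewrite ler_pdivlMl; last by lra.
  by rewrite mulrBl mul1r; lra.
rewrite {1}/E /hsum.
apply: le_trans (_ : \sum_(1 <= n < X.+1 | pset (p :: ps) n && (p %| n)%N) n%:R^-1 <= _).
  rewrite [leLHS]big_mkcond [leRHS]big_mkcond; apply: ler_sum => n _.
  case: ifP => [h'|//].
  suff -> : (p %| n)%N by [].
  by move: h' => /andP[_ /= /andP[]]; rewrite mem_primes => /and3P[].
apply: le_trans (hsum_multiples R (P' := fun n => pset (p :: ps) n || pset ps n) X (prime_gt0 pp) _) _.
  move=> n n0 /andP[/allP h1 /= /andP[_ /allP h2]].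
  have hp r : r \in primes n -> r \in primes (p * n).
    by rewrite !mem_primes muln_gt0 n0 (ltnW p1) => /and3P[-> _ /dvdn_mull ->].
  have hq r : r \in ps -> r \in primes n.
    move=> hr; have := h2 _ hr; rewrite !mem_primes n0 => /and3P[-> _] /=.
    rewrite Euclid_dvdM ?(allP aps) // (dvdn_prime2 (allP aps _ hr) pp).
    by case/orP => // /eqP e; rewrite -e hr in pps.
  apply/orP; case e: (p \in primes n); [left|right]; apply/andP; split.
  - by apply/allP => r /hp /h1.
  - by rewrite /= e; apply/allP.
  - apply/allP => r hr; have := h1 _ (hp _ hr); rewrite inE => /orP[/eqP e'|//].
    by rewrite -e' hr in e.
  - by apply/allP.
rewrite ler_wpM2l ?invr_ge0 //.
apply: le_trans (lerD (lexx E) h).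
rewrite /E.
apply: le_trans (_ : hsum R (fun n => pset (p :: ps) n || pset ps n) X <= _).
  by apply: hsum_le; rewrite leq_div.
rewrite /hsum [leLHS]big_mkcond [X in _ <= X + _]big_mkcond [X in _ <= _ + X]big_mkcond -big_split /=.
apply: ler_sum => n _; have n0 : 0 <= n%:R^-1 :> R by rewrite invr_ge0.
by case: ifP => /=; case: ifP => /=; case: ifP => //=; lra.
Qed.

(** * The Selberg weights and their orthogonality *)

Section Selberg.
Variable D : nat.
Let ps := [seq p <- index_iota 1 D.+1 | prime p && coprime p q].
Let M (m : nat) := sqf m && coprime m q.

Lemma ps_mem p : (p \in ps) = [&& prime p, coprime p q & (p <= D)%N].
Proof.
rewrite mem_filter mem_index_iota ltnS -andbA; case pp: (prime p) => //=.
by rewrite prime_gt0.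
Qed.

Lemma ps_uniq : uniq ps. Proof. by rewrite filter_uniq // iota_uniq. Qed.
Lemma ps_prime : all prime ps. Proof. by apply/allP => p; rewrite ps_mem => /andP[]. Qed.

Lemma big_ps_dvd (V : comPzRingType) (F : nat -> V) m : M m -> (0 < m <= D)%N ->
  \prod_(p <- ps) (if (p %| m)%N then F p else 1) = \prod_(p <- primes m) F p.
Proof.
move=> /andP[_ cm] /andP[m0 mD]; rewrite -big_mkcond -big_filter; apply: perm_big.
apply: uniq_perm; rewrite ?primes_uniq //; first by apply: filter_uniq; exact: ps_uniq.
move=> p.
rewrite mem_filter ps_mem mem_primes m0 /=.
case pm: (p %| m)%N; rewrite ?andbF //= andbT.
by rewrite (coprime_dvdl pm cm) (leq_trans (dvdn_leq m0 pm) mD) !andbT.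
Qed.

(** For squarefree [m <= D] coprime to [q] this is [1 / totient m], the usual Selberg weight. *)
Let h m : R := \prod_(p <- ps) (if (p %| m)%N then (p%:R - 1)^-1 else 1).
(* The sieve majorant of the indicator of [D]-rough [n] is [(G^-1 * \sum_m T m n) ^+ 2]. *)
Let T m n : R := \prod_(p <- ps)
  (if (p %| m)%N then (if (p %| n)%N then -1 else (p%:R - 1)^-1) else 1).
Let G : R := \sum_(1 <= m < D.+1 | M m) h m.

(** The [n] are sorted by their radical: those of radical [m] have harmonic sum at most the product
    of [1 / (p - 1)] over [p] dividing [m]. *)
Lemma sieve_weight_ge : hsum R (fun n => coprime n q) D <= G.
Proof.
rewrite /hsum (partition_sum_nat (g := rad) (X' := D) (Q := M)); last first.
  move=> n /andP[n0 nD] cn; rewrite rad_gt0 ltnS (leq_trans (rad_le n0) nD) /= /M sqf_rad /=.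
  by rewrite coprime_primes ?rad_gt0 1?ltnW // primes_rad -coprime_primes // ltnW.
rewrite /G [leLHS]big_nat_cond [leRHS]big_nat_cond; apply: ler_sum => m /andP[hm Mm].
rewrite /h big_ps_dvd //.
apply: le_trans (hsum_pset D (primes_uniq m) _); last first.
  by apply/allP => p; rewrite mem_primes => /andP[].
rewrite /hsum [leLHS]big_mkcond [leRHS]big_mkcond; apply: ler_sum => n _.
case: ifP => [/andP[_ /eqP e]|_]; last by case: ifP => // _; rewrite invr_ge0.
suff -> : pset (primes m) n by [].
by rewrite /pset -e primes_rad; apply/andP; split; apply/allP.
Qed.

Let v0 m m' p : R := (if (p %| m)%N then (p%:R - 1)^-1 else 1) * (if (p %| m')%N then (p%:R - 1)^-1 else 1).
Let v1 m m' p : R := (if (p %| m)%N then -1 else 1) * (if (p %| m')%N then -1 else 1).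

Lemma sieve_error_factor m m' p : prime p ->
  `|v0 m m' p| + `|v1 m m' p - v0 m m' p| <=
   (if (p %| m)%N then p%:R ^+ 2 else 1) * (if (p %| m')%N then p%:R ^+ 2 else 1).
Proof.
move=> pp; have p2 : 2 <= p%:R :> R by rewrite ler_nat prime_gt1.
have x0 : 0 < (p%:R - 1)^-1 :> R by rewrite invr_gt0; lra.
have x1 : (p%:R - 1)^-1 <= 1 :> R by rewrite invf_le1; lra.
have pp4 : 4 <= p%:R ^+ 2 :> R by rewrite expr2; nra.
rewrite /v0 /v1; move: x0 x1 pp4; set x := (_)^-1; set P := _ ^+ 2 => x0 x1 P4.
have xx : x * x <= 1 by nra.
have xx0 : 0 <= x * x by nra.
case: ifP => _; case: ifP => _; rewrite ?mulrN1 ?mulN1r ?opprK ?mulr1 ?mul1r ?subrr ?normr0 ?addr0 ?normr1 //.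
- by rewrite !ger0_norm ?subr_ge0 //; nra.
- by rewrite -opprD normrN !gtr0_norm //; lra.
- by rewrite -opprD normrN !gtr0_norm //; lra.
Qed.

(** Up to sign, [T m n] is Ramanujan's sum [c_m(n)] divided by [totient m], and this is the
    orthogonality of these sums: at a prime dividing only one of [m], [m'] the local mean vanishes,
    because [- 1 / p + (1 - 1 / p) / (p - 1) = 0]. *)
Lemma sieve_main_factor m m' : M m -> M m' -> (0 < m <= D)%N -> (0 < m' <= D)%N ->
  \prod_(p <- ps) (v0 m m' p + (v1 m m' p - v0 m m' p) / p%:R) = if m == m' then h m else 0.
Proof.
move=> Mm Mm' mD m'D; case: ifP => [/eqP <-|ne].
  rewrite /h big_seq [RHS]big_seq; apply: eq_bigr => p; rewrite ps_mem => /andP[pp _].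
  have p2 : 2 <= p%:R :> R by rewrite ler_nat prime_gt1.
  rewrite /v0 /v1; case: ifP => _; last by rewrite !mulr1 subrr mul0r addr0.
  by field; rewrite !gt_eqF //; lra.
have [p pin hp] : exists2 p, p \in ps & (p %| m)%N != (p %| m')%N.
  apply/hasP; apply: contraFT ne => /hasPn hn.
  have e : primes m = primes m'.
    apply/eq_primes => p; rewrite !mem_primes; move: mD m'D => /andP[m0 mD] /andP[m'0 m'D].
    rewrite m0 m'0 /=; case pp: (prime p) => //=.
    case c: (coprime p q); last first.
      have := coprime_dvdl (m := p) (n := m) (p := q).
      case: (p %| m)%N => [/(_ isT)|_].
        by move: Mm => /andP[_ ->] /(_ isT); rewrite c.
      have := coprime_dvdl (m := p) (n := m') (p := q).
      case: (p %| m')%N => [/(_ isT)|//].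
      by move: Mm' => /andP[_ ->] /(_ isT); rewrite c.
    case: (leqP p D) => pD.
      by have := hn p; rewrite ps_mem pp c pD negbK => /(_ isT)/eqP.
    by apply/idP/idP => /dvdn_leq; [move/(_ m0)|move/(_ m'0)] => ?; lia.
  by move: Mm Mm' => /andP[/eqP -> _] /andP[/eqP -> _]; rewrite e.
rewrite (big_rem p) //=; have -> : v0 m m' p + (v1 m m' p - v0 m m' p) / p%:R = 0.
  have p2 : 2 <= p%:R :> R by move: pin; rewrite ps_mem ler_nat => /andP[/prime_gt1].
  rewrite /v0 /v1; move: hp; case: (p %| m)%N; case: (p %| m')%N => // _; rewrite ?mulr1 ?mul1r;
  by field; rewrite !gt_eqF //; lra.
by rewrite mul0r.
Qed.

(** For rough [n] each [T m n] is [h m], so the majorant equals 1. Orthogonality leaves the diagonal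
    [G] in the main term, to be divided by [G ^ 2]; each of the at most [D ^ 2] pairs [m], [m'] has
    error [6 * D ^ 4]. *)
Lemma selberg_sieve (g : {unit 'Z_q}) a b : (0 < D)%N -> (a <= b)%N ->
  \sum_(a.+1 <= n < b.+1 | (n%:R == val g) && (lep D)^'.-nat n) 1 <=
  (b%:R - a%:R) / q%:R / hsum R (fun n => coprime n q) D + 6 * D%:R ^+ 6.
Proof.
move=> D0 ab.
have S1 : 1 <= hsum R (fun n => coprime n q) D by rewrite hsum_ge1 // coprime1n.
have G1 : 1 <= G by apply: le_trans S1 sieve_weight_ge.
have G0 : 0 < G by lra.
have ba : 0 <= (b%:R - a%:R) / q%:R :> R by rewrite divr_ge0 // subr_ge0 ler_nat.
apply: le_trans (_ : (b%:R - a%:R) / q%:R / G + 6 * D%:R ^+ 6 <= _); last first.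
  by rewrite lerD2r ler_wpM2l // lef_pV2 ?posrE ?sieve_weight_ge //; lra.
have hr n : (lep D)^'.-nat n -> \sum_(1 <= m < D.+1 | M m) T m n = G.
  move=> /andP[n0 /allP hn]; apply: eq_bigr => m _; rewrite /T /h big_seq [RHS]big_seq.
  apply: eq_bigr => p; rewrite ps_mem => /and3P[pp _ pD]; case: ifP => // _.
  case: ifP => // pn; have := hn p; rewrite mem_primes pp n0 pn => /(_ isT).
  by rewrite !inE pD.
apply: le_trans (_ : \sum_(a.+1 <= n < b.+1 | (n%:R == val g)) (\sum_(1 <= m < D.+1 | M m) T m n) ^+ 2 / G ^+ 2 <= _).
  rewrite big_mkcondr; apply: ler_sum => n _; case: ifP => hn.
    by rewrite hr // divff // expf_neq0 // gt_eqF.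
  by rewrite divr_ge0 ?sqr_ge0.
rewrite -mulr_suml ler_pdivrMr ?exprn_gt0 //.
have -> : \sum_(a.+1 <= n < b.+1 | (n%:R == val g)) (\sum_(1 <= m < D.+1 | M m) T m n) ^+ 2 =
   \sum_(1 <= m < D.+1 | M m) \sum_(1 <= m' < D.+1 | M m')
     \sum_(a.+1 <= n < b.+1 | (n%:R == val g)) T m n * T m' n.
  under [RHS]eq_bigr do rewrite exchange_big_nat.
  rewrite exchange_big_nat /=; apply: eq_bigr => n _.
  by rewrite expr2 mulr_suml; apply: eq_bigr => m _; rewrite mulr_sumr.
apply: le_trans (_ : \sum_(1 <= m < D.+1 | M m) \sum_(1 <= m' < D.+1 | M m')
    ((b%:R - a%:R) / q%:R * (if m == m' then h m else 0) + 6 * D%:R ^+ 4) <= _).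
  rewrite [leLHS]big_nat_cond [leRHS]big_nat_cond; apply: ler_sum => m /andP[hm Mm].
  rewrite [leLHS]big_nat_cond [leRHS]big_nat_cond; apply: ler_sum => m' /andP[hm' Mm'].
  rewrite ltnS in hm; rewrite ltnS in hm'.
  have := @sieve_product ps (v0 m m') (v1 m m') a b g 1 ab ps_uniq ps_prime _ _ (coprime1n _) isT.
  rewrite sieve_main_factor // mul1n => H.
  have {}H := H (fun p => _) (fun p _ => coprimen1 p).
  have {}H : `|\sum_(a.+1 <= n < b.+1 | (1 %| n)%N && (n%:R == val g))
       \prod_(p <- ps) (if (p %| n)%N then v1 m m' p else v0 m m' p)
      - (b%:R - a%:R) / q%:R * (if m == m' then h m else 0)|
      <= 6 * \prod_(p <- ps) (`|v0 m m' p| + `|v1 m m' p - v0 m m' p|).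
    by apply: H => p; rewrite ps_mem => /and3P[].
  have e : \sum_(a.+1 <= n < b.+1 | (1 %| n)%N && (n%:R == val g))
       \prod_(p <- ps) (if (p %| n)%N then v1 m m' p else v0 m m' p) =
      \sum_(a.+1 <= n < b.+1 | n%:R == val g) T m n * T m' n.
    apply: eq_big => n; first by rewrite dvd1n.
    move=> _; rewrite /T -big_split /=; apply: eq_bigr => p _; rewrite /v0 /v1.
    by case: (p %| n)%N; case: (p %| m)%N; case: (p %| m')%N.
  rewrite e in H.
  have : \prod_(p <- ps) (`|v0 m m' p| + `|v1 m m' p - v0 m m' p|) <= D%:R ^+ 4.
    apply: le_trans (_ : \prod_(p <- ps) ((if (p %| m)%N then p%:R ^+ 2 else 1) * (if (p %| m')%N then p%:R ^+ 2 else 1)) <= _).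
      rewrite big_seq [leRHS]big_seq; apply: ler_prod => p; rewrite ps_mem => /andP[pp _].
      by rewrite sieve_error_factor // andbT addr_ge0.
    have K m0 : M m0 -> (0 < m0 <= D)%N -> \prod_(p <- ps) (if (p %| m0)%N then p%:R ^+ 2 else 1) <= D%:R ^+ 2 :> R.
      move=> Mm0 h0; rewrite (big_ps_dvd (fun p => p%:R ^+ 2)) // prodrXl -natr_prod.
      move: Mm0 => /andP[/eqP <- _]; rewrite -!natrX ler_nat leq_exp2r //; by case/andP: h0.
    rewrite big_split /= (exprD _ 2 2); apply: ler_pM; rewrite ?K //;
    by apply: prodr_ge0 => p _; case: ifP => _ //; rewrite exprn_ge0.
  move: H; rewrite ler_norml => /andP[_ H] H2.
  by rewrite -lerBlDl; apply: le_trans H _; rewrite ler_wpM2l.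
under eq_bigr do rewrite big_split /= -mulr_sumr.
rewrite big_split /= [leRHS]mulrDl; apply: lerD.
  rewrite -mulr_sumr -!mulrA ler_wpM2l //; first by rewrite subr_ge0 ler_nat.
  rewrite ler_wpM2l ?invr_ge0 // expr2 mulKf ?gt_eqF // /G.
  rewrite [leLHS]big_nat_cond [leRHS]big_nat_cond; apply: ler_sum => m /andP[hm Mm].
  rewrite -big_mkcondr (eq_bigl (fun i => (i == m) && M i)); last by move=> i; rewrite andbC eq_sym.
  by rewrite big_mkcondr big_nat1_eq hm Mm.
have c1 (c : R) : 0 <= c -> \sum_(1 <= m < D.+1 | M m) c <= D%:R * c.
  move=> c0; rewrite -sum_nat1 mulr_suml [leLHS]big_mkcond; apply: ler_sum => m _.
  by rewrite mul1r; case: ifP.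
have d4 : 0 <= 6 * D%:R ^+ 4 :> R by rewrite mulr_ge0 // exprn_ge0.
apply: le_trans (_ : \sum_(1 <= m < D.+1 | M m) (D%:R * (6 * D%:R ^+ 4)) <= _).
  by apply: ler_sum => m _; apply: c1.
apply: le_trans (c1 _ _) _; first by rewrite mulr_ge0.
have -> : D%:R * (D%:R * (6 * D%:R ^+ 4)) = 6 * D%:R ^+ 6 :> R by ring.
by rewrite ler_peMr ?mulr_ge0 ?exprn_ge0 // exprn_ege1.
Qed.
End Selberg.
End Counting.

(** * The walk identity for smooth numbers *)

Section Walk.
Variable R : realType.
Variables (Y q : nat).
Hypothesis q1 : (1 < q)%N.
Notation lnn := (lnn R).
Notation cls := (cls q).
Notation gT := {unit 'Z_q}.

Definition Sm n := (lep Y).-nat n && coprime n q.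
Definition pr p := prime p && coprime p q.
Definition F (g : gT) t : R := \sum_(1 <= n < t.+1 | Sm n && (cls n == g)) 1.
Definition N t : R := \sum_(1 <= n < t.+1 | Sm n) 1.

(* For counting functions this is Abel summation of the weight [ln n], expanded
   as the sum of [ln p] over the prime powers [p ^ j] dividing [n]. *)
Definition walk (D : gT -> nat -> R) := forall g t, (0 < t)%N ->
  D g t * lnn t = \sum_(1 <= s < t) D g s * (lnn s.+1 - lnn s) +
  \sum_(1 <= p < Y.+1 | pr p) \sum_(1 <= j < t.+1)
     lnn p * D (g * (cls p ^- j))%g (t %/ p ^ j)%N.

Lemma abel_lnn (f : nat -> R) t : (0 < t)%N ->
  (\sum_(1 <= n < t.+1) f n) * lnn t = \sum_(1 <= n < t.+1) lnn n * f n +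
  \sum_(1 <= s < t) (\sum_(1 <= n < s.+1) f n) * (lnn s.+1 - lnn s).
Proof.
elim: t => // t IH _; case: t IH => [_|t IH].
  by rewrite !big_nat1 big_geq // addr0 mulrC.
rewrite big_nat_recr //= mulrDl [X in _ = X + _]big_nat_recr //= [X in _ = _ + X]big_nat_recr //=.
have {}IH := IH isT; move: IH.
set A := \sum_(1 <= n < t.+2) f n; set B := \sum_(1 <= n < t.+2) _; set C := \sum_(1 <= s < t.+1) _.
move=> IH; rewrite mulrBr IH; ring.
Qed.

(** Common to class counts and totals: a prime power is divided out at the price of a shift of the
    class. *)
Lemma walk_of (P : gT -> pred nat) :
  (forall g n, P g n -> Sm n) ->
  (forall g p j n, pr p -> (p <= Y)%N -> (0 < n)%N ->
      P g (p ^ j * n)%N = P (g * (cls p ^- j))%g n) ->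
  walk (fun g t => \sum_(1 <= n < t.+1 | P g n) 1).
Proof.
move=> PS PM g t t0.
have e u : \sum_(1 <= n < u.+1 | P g n) 1 = \sum_(1 <= n < u.+1) (P g n)%:R :> R.
  by rewrite big_mkcond; apply: eq_bigr => n _; case: ifP.
rewrite e abel_lnn // addrC; congr (_ + _).
  by apply: eq_bigr => s _; rewrite e.
have -> : \sum_(1 <= n < t.+1) lnn n * (P g n)%:R = \sum_(1 <= n < t.+1 | P g n) lnn n * 1.
  by rewrite [RHS]big_mkcond; apply: eq_bigr => n _; case: ifP; rewrite ?mulr0.
rewrite (sum_lnn_expand (Z := Y)); last by move=> n _ /PS /andP[].
rewrite (bigID (fun p => coprime p q)) /= [X in _ + X]big1 ?addr0; last first.
  move=> p /andP[pp np]; rewrite big_nat_cond big1 // => j /andP[/andP[j0 _] _].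
  rewrite big1 ?mulr0 // => n /andP[/PS /andP[_ cn] pn].
  move: np; rewrite (coprime_dvdl _ cn) //; apply: dvdn_trans pn.
  by rewrite -{1}(expn1 p) dvdn_exp2l.
rewrite big_nat_cond [RHS]big_nat_cond; apply: eq_bigr => p /andP[/andP[p0 pY] prp].
apply: eq_bigr => j _; congr (_ * _).
have pj0 : (0 < p ^ j)%N by rewrite expn_gt0 p0.
rewrite (eq_bigl (fun n => (p ^ j %| n)%N && P g n)); last by move=> n; rewrite andbC.
rewrite big_mkcondr sum_multiples // [RHS]big_mkcond; apply: eq_big_nat => n /andP[n0 _].
by rewrite PM.
Qed.

Lemma SmM m n : (0 < m)%N -> (0 < n)%N -> Sm (m * n) = Sm m && Sm n.
Proof. by move=> m0 n0; rewrite /Sm pnatM coprimeMl andbACA. Qed.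

Lemma Sm_prime p : pr p -> (p <= Y)%N -> Sm p.
Proof. by move=> /andP[pp cp] pY; rewrite /Sm cp andbT lep_nat_leq // prime_gt0. Qed.

Lemma Sm_primeX p j : pr p -> (p <= Y)%N -> Sm (p ^ j).
Proof. by move=> hp pY; have /andP[h1 h2] := Sm_prime hp pY; rewrite /Sm coprimeXl // andbT pnatX h1. Qed.

Lemma Sm1 : Sm 1. Proof. by rewrite /Sm coprime1n andbT. Qed.

Lemma F_walk : walk F.
Proof.
apply: walk_of => [g n /andP[]//|g p j n hp pY n0].
have p0 : (0 < p ^ j)%N by rewrite expn_gt0 prime_gt0 //; case/andP: hp.
rewrite SmM // Sm_primeX //=; case Sn: (Sm n) => //=.
move: hp Sn => /andP[_ cp] /andP[_ cn].
rewrite clsM ?coprimeXl // clsX // -(inj_eq (mulgI (cls p ^- j)%g)) mulKg.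
by rewrite unit_mulC.
Qed.

Lemma N_walk : walk (fun=> N).
Proof.
apply: (walk_of (P := fun=> Sm)) => // g p j n hp pY n0.
have p0 : (0 < p ^ j)%N by rewrite expn_gt0 prime_gt0 //; case/andP: hp.
by rewrite SmM // Sm_primeX.
Qed.

Lemma walkB D1 D2 : walk D1 -> walk D2 -> walk (fun g t => D1 g t - D2 g t).
Proof.
move=> h1 h2 g t t0; rewrite mulrBl h1 // h2 // opprD addrACA; congr (_ + _).
  by rewrite -sumrB; apply: eq_bigr => s _; rewrite mulrBl.
rewrite -sumrB; apply: eq_bigr => p _; rewrite -sumrB; apply: eq_bigr => j _.
by rewrite mulrBr.
Qed.

Lemma walk_shift D h : walk D -> walk (fun g => D (g * h)%g).
Proof.
move=> hD g t t0; rewrite hD //; congr (_ + _).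
apply: eq_bigr => p _; apply: eq_bigr => j _; congr (_ * D _ _).
by rewrite -!mulgA; congr (_ * _)%g; apply: unit_mulC.
Qed.

Lemma N_sum_F t : N t = \sum_(g : gT) F g t.
Proof.
rewrite /F; under eq_bigr do rewrite big_mkcondr.
rewrite exchange_big /=; apply: eq_bigr => n _.
by rewrite -big_mkcond (big_pred1 (cls n)) // => g; rewrite eq_sym.
Qed.

Lemma F_ge0 g t : 0 <= F g t. Proof. exact: sumr_ge0. Qed.
Lemma N_ge0 t : 0 <= N t. Proof. exact: sumr_ge0. Qed.
Lemma F0 g : F g 0 = 0. Proof. by rewrite /F big_geq. Qed.
Lemma N0 : N 0 = 0. Proof. by rewrite /N big_geq. Qed.

Lemma F_le g s t : (s <= t)%N -> F g s <= F g t.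
Proof. by move=> st; rewrite /F [leRHS](big_cat_nat (n := s.+1)) //= lerDl sumr_ge0. Qed.

Lemma N_le s t : (s <= t)%N -> N s <= N t.
Proof. by move=> st; rewrite /N [leRHS](big_cat_nat (n := s.+1)) //= lerDl sumr_ge0. Qed.

Lemma N_le_nat t : N t <= t%:R.
Proof. by rewrite -[leRHS]sum_nat1 /N big_mkcond; apply: ler_sum => n _; case: ifP. Qed.

(** All terms of the walk identity for [N] are nonnegative, so any selection of primes with [j = 1]
    is a lower bound. *)
Lemma N_ln_ge t (P : pred nat) : (0 < t)%N ->
  \sum_(1 <= p < Y.+1 | pr p && P p) lnn p * N (t %/ p) <= N t * lnn t.
Proof.
move=> t0; rewrite (N_walk 1%g t0); apply: ler_wpDl.
  by apply: sumr_ge0 => s _; rewrite mulr_ge0 ?N_ge0 ?lnnS_sub_ge0.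
rewrite big_mkcondr; apply: ler_sum => p _.
rewrite big_ltn //= expn1; case: ifP => _.
  by rewrite lerDl; apply: sumr_ge0 => j _; rewrite mulr_ge0 ?lnn_ge0 ?N_ge0.
rewrite addr_ge0 ?mulr_ge0 ?lnn_ge0 ?N_ge0 //.
by apply: sumr_ge0 => j _; rewrite mulr_ge0 ?lnn_ge0 ?N_ge0.
Qed.

Lemma sum_trunc_range p t T : (1 < p)%N -> (0 < T <= t)%N ->
  \sum_(1 <= j < t.+1 | (p ^ j <= t)%N && (t < p ^ j * T)%N) lnn p <= lnn T + lnn p.
Proof.
move=> p1 /andP[T0 Tt]; have t0 := leq_trans T0 Tt.
have h1 := sum_trunc_log (lnn p) p1 (leqnn t).
have h2 := sum_trunc_log (lnn p) p1 (leq_div t T).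
have h3 := trunc_log_lnn_le R t p1.
have h4 := trunc_log_ltn (t %/ T) p1.
rewrite ltn_divLR // in h4.
have h5 : lnn t <= ((trunc_log p (t %/ T)).+1)%:R * lnn p + lnn T.
  apply: le_trans (lnn_le R (ltnW h4)) _.
  by rewrite lnnM ?expn_gt0 ?(ltnW p1) // lnnX ?(ltnW p1).
rewrite -natr1 mulrDl mul1r -h2 in h5; rewrite -h1 in h3.
move: h3; rewrite (bigID (fun j => (t < p ^ j * T)%N)) /=.
rewrite [X in _ + X](eq_bigl (fun j => (p ^ j <= t %/ T)%N)); first by lra.
move=> j /=; rewrite -leqNgt leq_divRL //; apply: andb_idl => h.
by apply: leq_trans h; apply: leq_pmulr.
Qed.

(** The weights [w] may be smaller than [lnn p], so that a share of some primes can be taken out.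
    Arguments below [T], where only the crude bound [K] is known, are reached from each [p] with
    total weight at most [lnn T + lnn p]. *)
Lemma walk_bound (D : gT -> nat -> R) (G : nat -> R) T t (K : R) (w : nat -> nat -> R) g :
  (forall g, D g 0%N = 0) -> (0 < T <= t)%N -> 0 <= K ->
  (forall p j, pr p -> 0 <= w p j <= lnn p) ->
  (forall g s, (T <= s < t)%N -> `|D g s| <= G s) ->
  (forall g s, (s < T)%N -> `|D g s| <= K) ->
  `|\sum_(1 <= s < t) D g s * (lnn s.+1 - lnn s) +
    \sum_(1 <= p < Y.+1 | pr p) \sum_(1 <= j < t.+1)
       w p j * D (g * (cls p ^- j))%g (t %/ p ^ j)%N| <=
  \sum_(T <= s < t) G s * (lnn s.+1 - lnn s) +
  \sum_(1 <= p < Y.+1 | pr p) \sum_(1 <= j < t.+1 | (p ^ j * T <= t)%N)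
       w p j * G (t %/ p ^ j)%N
  + K * (lnn T + \sum_(1 <= p < Y.+1 | pr p) (lnn T + lnn p)).
Proof.
move=> D0 /andP[T0 Tt] K0 w0 HG HK; have t0 := leq_trans T0 Tt.
apply: le_trans (ler_normD _ _) _.
rewrite mulrDr addrACA; apply: lerD.
  apply: le_trans (ler_norm_sum _ _ _) _.
  rewrite (big_cat_nat (n := T)) //= addrC; apply: lerD.
    apply: ler_sum_nat => s hs; rewrite normrM [X in _ * X <= _]ger0_norm ?lnnS_sub_ge0 //.
    by rewrite ler_wpM2r ?lnnS_sub_ge0 ?HG.
  apply: le_trans (_ : \sum_(1 <= s < T) K * (lnn s.+1 - lnn s) <= _).
    apply: ler_sum_nat => s /andP[_ hs]; rewrite normrM [X in _ * X <= _]ger0_norm ?lnnS_sub_ge0 //.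
    by rewrite ler_wpM2r ?lnnS_sub_ge0 ?HK.
  by rewrite -mulr_sumr sum_lnnS // lnn1 subr0.
rewrite mulr_sumr -big_split /=.
apply: le_trans (ler_norm_sum _ _ _) _; apply: ler_sum => p prp.
have p1 : (1 < p)%N by apply: prime_gt1; case/andP: prp.
have pj0 j : (0 < p ^ j)%N by rewrite expn_gt0 (ltnW p1).
apply: le_trans (ler_norm_sum _ _ _) _.
rewrite (bigID (fun j => (p ^ j * T <= t)%N)) /=; apply: lerD.
  rewrite [leLHS]big_nat_cond [leRHS]big_nat_cond; apply: ler_sum => j /andP[/andP[j0 _] hj].
  have /andP[wa wb] := w0 p j prp.
  rewrite normrM [X in X * _ <= _]ger0_norm // ler_wpM2l // HG //.
  by rewrite leq_divRL // mulnC hj ltn_Pdiv // -(exp1n j) ltn_exp2r.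
apply: le_trans (ler_wpM2l K0 (@sum_trunc_range p t T p1 _)); last by rewrite T0.
rewrite mulr_sumr [leRHS](eq_bigl (fun j => ~~ (p ^ j * T <= t)%N && (p ^ j <= t)%N)); last first.
  by move=> j; rewrite -ltnNge andbC.
rewrite [leRHS]big_mkcondr; apply: ler_sum => j; rewrite -ltnNge => hj.
have /andP[wa wb] := w0 p j prp.
case: ifP => hj2; last first.
  by rewrite divn_small ?D0 ?mulr0 ?normr0 // ltnNge hj2.
rewrite normrM [X in X * _ <= _]ger0_norm // mulrC; apply: ler_pM => //.
by apply: HK; rewrite ltn_divLR // mulnC.
Qed.

(* [2 * beta * N - beta * N T] is a supersolution of the walk identity beyond
   [T ^ B]: the loss at the prime powers close to [t] is paid by the constant. *)
Lemma walk_tail (D : gT -> nat -> R) (beta K : R) T B :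
  walk D -> (forall g, D g 0%N = 0) -> (exists2 p, pr p & (p <= Y)%N) ->
  (1 < T)%N -> (Y <= T)%N -> 0 < beta -> 0 <= K -> (0 < B)%N ->
  3 * K <= beta * (B%:R - 3) ->
  (forall g s, (T <= s <= T ^ B)%N -> `|D g s| <= beta * N s) ->
  (forall g s, (s < T)%N -> `|D g s| <= K * N T) ->
  forall g s, (T <= s)%N -> `|D g s| <= 2 * beta * N s.
Proof.
move=> wD D0 [p0 prp0 p0Y] T1 YT b0 K0 B0 BK H1 H2.
have T0 := ltnW T1.
set c := beta * N T.
have c0 : 0 <= c by rewrite mulr_ge0 ?N_ge0 // ltW.
suff H : forall s g, (T <= s)%N -> `|D g s| <= 2 * beta * N s - c.
  by move=> g s hs; apply: le_trans (H s g hs) _; rewrite gerBl.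
move=> s; have [k] := ubnP s; elim: k s => // k IH t tk g Tt.
have t0 := leq_trans T0 Tt.
case: (leqP t (T ^ B)) => hT.
  apply: le_trans (H1 g t _) _; first by rewrite Tt.
  have : beta * N T <= beta * N t by rewrite ler_pM2l // N_le.
  by rewrite /c -mulrA; lra.
have lt0 : 0 < lnn t by apply: lnn_gt0; apply: leq_trans Tt.
rewrite -(ler_pM2r lt0) -[X in _ * X](ger0_norm (ltW lt0)) -normrM wD //.
have := @walk_bound D (fun s => 2 * beta * N s - c) T t (K * N T) (fun p _ => lnn p) g D0.
rewrite T0 Tt => /(_ isT); rewrite mulr_ge0 ?N_ge0 // => /(_ isT) H.
apply: le_trans (H _ _ _) _ => {H}.
- by move=> p j _; rewrite lnn_ge0 /=.
- by move=> g' s' /andP[h1 h2]; apply: IH => //; lia.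
- exact: H2.
have NW : N t * lnn t = _ := N_walk g t0.
have -> : (2 * beta * N t - c) * lnn t = 2 * beta * (N t * lnn t) - c * lnn t by ring.
rewrite NW {NW}.
set L := lnn T; have L0 : 0 < L by apply: lnn_gt0.
set pi := \sum_(1 <= p < Y.+1 | pr p) 1 : R.
have pi1 : 1 <= pi.
  rewrite /pi big_mkcond (bigD1_seq p0) ?iota_uniq //=; last first.
    by rewrite mem_index_iota ltnS p0Y prime_gt0 //; case/andP: prp0.
  by rewrite prp0 lerDl; apply: sumr_ge0 => p _; case: ifP.
have e1 : \sum_(T <= s < t) (2 * beta * N s - c) * (lnn s.+1 - lnn s) =
  2 * beta * (\sum_(T <= s < t) N s * (lnn s.+1 - lnn s)) - c * (lnn t - L).
  rewrite -sum_lnnS // !mulr_sumr -sumrB; apply: eq_bigr => s _; ring.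
have e2 : \sum_(1 <= p < Y.+1 | pr p) \sum_(1 <= j < t.+1 | (p ^ j * T <= t)%N)
       lnn p * (2 * beta * N (t %/ p ^ j)%N - c) =
  2 * beta * (\sum_(1 <= p < Y.+1 | pr p) \sum_(1 <= j < t.+1 | (p ^ j * T <= t)%N)
       lnn p * N (t %/ p ^ j)%N) -
  c * (\sum_(1 <= p < Y.+1 | pr p) \sum_(1 <= j < t.+1 | (p ^ j * T <= t)%N) lnn p).
  rewrite !mulr_sumr -sumrB; apply: eq_bigr => p _.
  rewrite !mulr_sumr -sumrB; apply: eq_bigr => j _; ring.
rewrite e1 e2.
have i1 : \sum_(T <= s < t) N s * (lnn s.+1 - lnn s) <= \sum_(1 <= s < t) N s * (lnn s.+1 - lnn s).
  rewrite [leRHS](big_cat_nat (n := T)) //= lerDr.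
  by apply: sumr_ge0 => s _; rewrite mulr_ge0 ?N_ge0 ?lnnS_sub_ge0.
have i2 : \sum_(1 <= p < Y.+1 | pr p) \sum_(1 <= j < t.+1 | (p ^ j * T <= t)%N)
       lnn p * N (t %/ p ^ j)%N <=
   \sum_(1 <= p < Y.+1 | pr p) \sum_(1 <= j < t.+1) lnn p * N (t %/ p ^ j)%N.
  apply: ler_sum => p _; rewrite [leLHS]big_mkcond; apply: ler_sum => j _.
  by case: ifP => // _; rewrite mulr_ge0 ?N_ge0 ?lnn_ge0.
have ltB : B%:R * L <= lnn t.
  by rewrite /L -lnnX // lnn_le // ltnW.
(* Each prime has about [(lnn t - lnn T) / lnn p] powers up to [t / T], and [lnn t >= B * lnn T].
   The constant [c] is gained with this weight and pays the crude terms. *)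
have i3 : pi * ((B%:R - 2) * L) <= \sum_(1 <= p < Y.+1 | pr p) \sum_(1 <= j < t.+1 | (p ^ j * T <= t)%N) lnn p.
  rewrite /pi mulr_suml [leLHS]big_nat_cond [leRHS]big_nat_cond.
  apply: ler_sum => p /andP[/andP[_ pY] prp]; rewrite mul1r.
  have p1 : (1 < p)%N by apply: prime_gt1; case/andP: prp.
  rewrite (eq_bigl (fun j => (p ^ j <= t %/ T)%N)); last by move=> j; rewrite leq_divRL.
  rewrite sum_trunc_log // ?leq_div //.
  have h4 := trunc_log_ltn (t %/ T) p1; rewrite ltn_divLR // in h4.
  have h5 : lnn t <= ((trunc_log p (t %/ T)).+1)%:R * lnn p + L.
    apply: le_trans (lnn_le R (ltnW h4)) _.
    by rewrite lnnM ?expn_gt0 ?(ltnW p1) // lnnX ?(ltnW p1).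
  rewrite -natr1 mulrDl mul1r in h5.
  have h6 : lnn p <= L by apply: lnn_le; apply: leq_trans YT.
  by rewrite mulrBl; lra.
have i4 : \sum_(1 <= p < Y.+1 | pr p) (L + lnn p) <= pi * (2 * L).
  rewrite /pi mulr_suml [leLHS]big_nat_cond [leRHS]big_nat_cond.
  apply: ler_sum => p /andP[/andP[_ pY] prp]; rewrite mul1r.
  have h6 : lnn p <= L by apply: lnn_le; apply: leq_trans YT.
  by lra.
move: i1 i2 i3 i4.
set A1 := \sum_(T <= s < t) _; set A2 := \sum_(1 <= s < t) _.
set B1 := \sum_(1 <= p < Y.+1 | pr p) _; set B2 := \sum_(1 <= p < Y.+1 | pr p) _.
set C1 := \sum_(1 <= p < Y.+1 | pr p) _; set E1 := \sum_(1 <= p < Y.+1 | pr p) _.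
move=> i1 i2 i3 i4.
have bb : 0 <= 2 * beta by lra.
have j1 : 2 * beta * A1 <= 2 * beta * A2 by rewrite ler_wpM2l.
have j2 : 2 * beta * B1 <= 2 * beta * B2 by rewrite ler_wpM2l.
have j3 : c * (pi * ((B%:R - 2) * L)) <= c * C1 by rewrite ler_wpM2l.
have KN : 0 <= K * N T by rewrite mulr_ge0 ?N_ge0.
have j4 : K * N T * (L + E1) <= K * N T * (3 * pi * L).
  rewrite ler_wpM2l //; have : L <= pi * L by rewrite ler_peMl // ltW.
  lra.
have j5 : K * N T * (3 * pi * L) <= c * (pi * (B%:R - 3) * L).
  have -> : K * N T * (3 * pi * L) = (3 * K) * (N T * pi * L) by ring.
  have -> : c * (pi * (B%:R - 3) * L) = (beta * (B%:R - 3)) * (N T * pi * L) by rewrite /c; ring.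
  by rewrite ler_wpM2r // !mulr_ge0 ?N_ge0 //; lra.
have j6 : c * L <= c * (pi * L) by rewrite ler_wpM2l // ler_peMl // ltW.
rewrite [2 * beta * (A2 + B2)]mulrDr.
have -> : c * (lnn t - L) = c * lnn t - c * L by ring.
move: j3 j5; have -> : c * (pi * ((B%:R - 2) * L)) = c * (pi * (B%:R - 3) * L) + c * (pi * L) by ring.
lra.
Qed.
End Walk.

(** * Growth of product sets *)

Section GroupGrowth.
Variables (gT : finGroupType) (Q : {set gT}) (r : nat).
Local Open Scope group_scope.
Hypothesis Q1 : 1 \in Q.
Hypothesis QV : forall x, (x^-1 \in Q) = (x \in Q).
Hypothesis Qr : (#|[set: gT]| < r.+1 * #|Q|)%N.

Lemma expgs_sub i j : (i <= j)%N -> Q ^+ i \subset Q ^+ j.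
Proof.
move/subnK <-; elim: (j - i)%N => // m IH; apply: subset_trans IH _.
rewrite addSn expgS; apply/subsetP => x hx.
by rewrite -(mul1g x) mem_mulg.
Qed.

Lemma expgs_one i : 1 \in Q ^+ i.
Proof. by apply: (subsetP (expgs_sub (leq0n i))); rewrite expg0 inE. Qed.

Lemma expgs_fix i : Q ^+ i = Q ^+ i.+1 -> forall j, (i <= j)%N -> Q ^+ j = Q ^+ i.
Proof.
move=> h j /subnK <-; elim: (j - i)%N => // m IH.
by rewrite addSn expgS IH -expgS -h.
Qed.

(* If the powers kept growing, the translates x_i Q with x_i in Q^(3i) but not
   in Q^(3i-1) would be disjoint. *)
Lemma expgs_stab : exists2 i, (i <= 3 * r)%N & Q ^+ i = Q ^+ i.+1.
Proof.
apply: contrapT => hn.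
have grow i : (i <= 3 * r)%N -> exists x, (x \in Q ^+ i.+1) && (x \notin Q ^+ i).
  move=> hi; apply: contrapT => hx; apply: hn; exists i => //.
  apply/eqP; rewrite eqEsubset expgs_sub //=; apply/subsetP => x hx1.
  by apply: contraT => hx2; case: hx; exists x; rewrite hx1.
(* The spacing 3 leaves room for two factors from [Q]: if the translates by [f i] and [f j] met,
   [f j] would lie in [Q ^+ (3 * i + 2)], hence in [Q ^+ (3 * j - 1)]. *)
pose P (i : nat) x := (i == 0%N) && (x == 1) || (x \in Q ^+ (3 * i)) && (x \notin Q ^+ (3 * i).-1).
have ex i : (i <= r)%N -> exists x, P i x.
  case: i => [_|i hi]; first by exists 1; rewrite /P !eqxx.
  have [|x hx] := grow (3 * i.+1).-1; first by lia.
  by exists x; rewrite /P /=; move: hx; rewrite prednK ?muln_gt0.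
have [f hf] : exists f : nat -> gT, forall i, (i <= r)%N -> P i (f i).
  have /choice[f hf] : forall i, exists x, (i <= r)%N -> P i x.
    move=> i; case: (leqP i r) => hi; last by exists 1.
    by have [x hx] := ex i hi; exists x.
  by exists f.
have disj i j : (i < j <= r)%N -> [disjoint f i *: Q & f j *: Q].
  move=> /andP[ij jr]; rewrite -setI_eq0; apply/eqP/setP => x; rewrite !inE.
  apply/negP => /andP[/lcosetP[a aQ xa] /lcosetP[b bQ xb]].
  have hfj := hf j jr; have hfi := hf i (leq_trans (ltnW ij) jr).
  move: hfj; rewrite /P; have -> : (j == 0%N) = false by lia.
  rewrite /= => /andP[_ /negP]; apply.
  have -> : f j = f i * (a * b^-1) by rewrite mulgA -xa xb mulgK.
  have fi : f i \in Q ^+ (3 * i).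
    by move: hfi; rewrite /P => /orP[/andP[_ /eqP ->]|/andP[]//]; apply: expgs_one.
  apply: (subsetP (expgs_sub (_ : 3 * i + 2 <= _)%N)); first by lia.
  by rewrite expgD mem_mulg // expgS expg1 mem_mulg // QV.
have : (\sum_(i < r.+1) #|f i *: Q| <= #|[set: gT]|)%N.
  suff -> : forall m, (m <= r.+1)%N -> (\sum_(i < m) #|f i *: Q| = #|\bigcup_(i < m) f i *: Q|)%N => //.
    by rewrite subset_leq_card // subsetT.
  elim=> [_|m IH hm]; first by rewrite !big_ord0 cards0.
  rewrite !big_ord_recr /= IH ?(ltnW hm) // cardsU.
  suff -> : (\bigcup_(i < m) f i *: Q) :&: (f m *: Q) = set0 by rewrite cards0 subn0.
  apply/eqP; rewrite setI_eq0 disjoint_sym; apply/bigcup_disjointP => i _.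
  by rewrite disjoint_sym; apply: disj; rewrite ltn_ord -ltnS.
under eq_bigr do rewrite card_lcoset.
by rewrite sum_nat_const card_ord leqNgt Qr.
Qed.

(** A power of [Q] that equals the next one equals all later ones, so it is closed under
    products. *)
Lemma gen_expgs : <<Q>> = Q ^+ (3 * r).
Proof.
have [i hi h] := expgs_stab.
have e j : (i <= j)%N -> Q ^+ j = Q ^+ i by apply: expgs_fix.
rewrite (e _ hi).
have gS : group_set (Q ^+ i).
  apply/group_setP; split; first exact: expgs_one.
  move=> x y hx hy; rewrite -(e (i + i)%N) ?leq_addr // expgD; exact: mem_mulg.
apply/eqP; rewrite eqEsubset; apply/andP; split.
  suff : Q \subset Group gS by rewrite -gen_subG.
  by rewrite /= -(e i.+1) // -{1}(expg1 Q) expgs_sub.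
elim: (i) => [|m IH]; first by rewrite expg0 sub1set group1.
by rewrite expgS mul_subG // subset_gen.
Qed.

Lemma gen_index : (#|[set: gT] : <<Q>>| <= r)%N.
Proof.
have h := Lagrange (subsetT <<Q>>%G).
have hQ : (#|Q| <= #|<<Q>>|)%N by rewrite subset_leq_card // subset_gen.
have Q0 : (0 < #|Q|)%N by apply/card_gt0P; exists 1.
rewrite -ltnS -(ltn_pmul2r Q0); apply: leq_ltn_trans Qr.
by rewrite -h mulnC leq_mul2r hQ orbT.
Qed.
End GroupGrowth.

(** * Regularity of the smooth counting function *)

(* The largest [r] with [r ^ e.+1 <= Y]: the exponent is shifted by one. *)
Definition rootn e Y := xchoose (@nat_root e.+1 Y isT).

Lemma rootnP e Y : (rootn e Y ^ e.+1 <= Y < (rootn e Y).+1 ^ e.+1)%N.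
Proof. exact: (xchooseP (@nat_root e.+1 Y isT)). Qed.

Lemma rootn_ge e Y r : (r ^ e.+1 <= Y)%N -> (r <= rootn e Y)%N.
Proof.
have /andP[_ h] := rootnP e Y; move=> h'.
by rewrite -ltnS -(ltn_exp2r _ _ (isT : 0 < e.+1)%N); apply: leq_ltn_trans h.
Qed.

Section Roots.
Variable R : realType.
Notation lnn := (lnn R).

Lemma lnnS_le s : lnn s.+1 <= s%:R.
Proof.
rewrite /lnn -natr1 addrC; apply: le_ln1Dx.
by apply: lt_le_trans (_ : 0 <= _); rewrite ?ltrN10.
Qed.

(** With [r] the integer [k]-th root of [Y], [lnn Y <= k * r] while [r ^ m.+1 <= rootn e Y]: one
    spare power of [r] absorbs the constants. *)
Lemma ln_pow_le_root (C : R) m e : exists Y1, forall Y, (Y1 <= Y)%N ->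
  C * lnn Y ^+ m <= (rootn e Y)%:R.
Proof.
pose k := (e.+1 * m.+1)%N.
have [K hK] : exists K : nat, `|C| * k%:R ^+ m <= K%:R.
  by exists (Num.truncn (`|C| * k%:R ^+ m)).+1; apply/ltW/truncnS_gt.
exists (K ^ k)%N => Y hY.
have k0 : (0 < k)%N by [].
have [r /andP[r1 r2]] := @nat_root k Y k0.
have Kr : (K <= r)%N.
  by rewrite -ltnS -(ltn_exp2r _ _ k0); apply: leq_ltn_trans r2.
have rD : (r ^ m.+1 <= rootn e Y)%N by apply: rootn_ge; rewrite -expnM mulnC.
have l1 : lnn Y <= k%:R * r%:R.
  apply: le_trans (_ : lnn (r.+1 ^ k) <= _); first by rewrite lnn_le // ltnW.
  by rewrite lnnX // ler_wpM2l // lnnS_le.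
have l0 := lnn_ge0 R Y.
apply: le_trans (_ : `|C| * lnn Y ^+ m <= _).
  by rewrite ler_wpM2r ?exprn_ge0 // ler_norm.
apply: le_trans (_ : `|C| * (k%:R * r%:R) ^+ m <= _).
  by rewrite ler_wpM2l // lerXn2r // nnegrE // mulr_ge0.
rewrite exprMn mulrA; apply: le_trans (_ : K%:R * r%:R ^+ m <= _).
  by rewrite ler_wpM2r // exprn_ge0.
by rewrite -natrX -natrM ler_nat; apply: leq_trans rD; rewrite expnS leq_mul2r Kr orbT.
Qed.

Lemma ln_unbounded (C : R) : exists Y1, forall Y, (Y1 <= Y)%N -> C <= lnn Y.
Proof.
exists (2 ^ (2 * (Num.truncn C).+1))%N => Y hY.
apply: le_trans (lnn_le R hY); rewrite lnnX // natrM.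
have h := lnn2_ge R; have h1 := truncnS_gt C.
set n := (Num.truncn C).+1%:R in h1 *; have n0 : 0 <= n by [].
nra.
Qed.
End Roots.

Section Regularity.
Variable R : realType.
Variables (Y q B : nat) (K : R).
Notation lnn := (lnn R).
(** About [Y ^ (1/8)], the sieve level: [D ^ 8 <= Y] absorbs the sieve error of order
    [D ^ 6 * lnn D], and [Y < D ^ 9] keeps [lnn D] comparable to [L]. *)
Notation D := (rootn 7 Y).
Notation L := (lnn Y).
Notation copr := (fun n => coprime n q).
Notation S := (hsum R copr D).
Notation N := (N R Y q).
Hypothesis q1 : (1 < q)%N.
Hypothesis qY : (q <= Y ^ B)%N.
(** [K] is a large constant fixed before [Y]; [KL] and [KD] hold once [Y] is large in terms of
    it. *)
Hypothesis K0 : 2 ^+ 20 * (B%:R + 1) <= K.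
Hypothesis KL : K <= L.
Hypothesis KD : K * L <= D%:R.

Lemma K_ge : 2 ^+ 20 <= K.
Proof. by apply: le_trans K0; rewrite ler_peMr ?exprn_ge0 // lerDr. Qed.
Lemma L_ge : 2 ^+ 20 <= L. Proof. exact: le_trans K_ge KL. Qed.
Lemma L_ge1000 : 1000 <= L.
Proof.
apply: le_trans L_ge; apply: le_trans (_ : 2 ^+ 10 <= _); last by rewrite ler_eXn2l // ltr1n.
lra.
Qed.
Lemma K_D : K <= D%:R.
Proof.
apply: le_trans KD; rewrite ler_peMr //; first by apply: le_trans K_ge; rewrite exprn_ge0.
by apply: le_trans L_ge; rewrite -natrX ler1n.
Qed.
Lemma D_ge : (2 ^ 20 <= D)%N.
Proof. by rewrite -(ler_nat R) natrX; apply: le_trans K_ge K_D. Qed.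
Lemma Y_gt1 : (1 < Y)%N.
Proof.
rewrite ltnNge; apply/negP => h; have := lnn_le R h; rewrite lnn1.
have := L_ge; lra.
Qed.
Lemma D8 : (D ^ 8 <= Y)%N. Proof. by have /andP[] := rootnP 7 Y. Qed.
Lemma lnD_ge : 10 <= lnn D.
Proof.
apply: le_trans (lnn_le R D_ge); rewrite lnnX //; have := lnn2_ge R; lra.
Qed.
Lemma lnD_le : 8 * lnn D <= L.
Proof. by rewrite -lnnX ?lnn_le ?D8 //; apply: leq_trans D_ge. Qed.
Lemma Y_lt : (Y < D ^ 9)%N.
Proof.
have /andP[_ h] := rootnP 7 Y; apply: leq_trans h _.
have h2 := D_ge.
have e : (D.+1 ^ 8 <= (2 * D) ^ 8)%N by rewrite leq_exp2r //; lia.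
apply: leq_trans e _; rewrite expnMn expnS leq_mul2r; apply/orP; right.
by apply: leq_trans h2.
Qed.
Lemma L_le : L <= 9 * lnn D.
Proof. by rewrite -lnnX ?lnn_le 1?ltnW ?Y_lt //; apply: leq_trans D_ge. Qed.
Lemma lnq_le : lnn q <= B%:R * L.
Proof. by rewrite -lnnX ?lnn_le // ltnW // Y_gt1. Qed.
Lemma S_ge1 : 1 <= S.
Proof. by apply: hsum_ge1; rewrite ?coprime1n //; apply: leq_trans D_ge. Qed.

(** * The order of magnitude of [N] *)

Lemma lnn_le_add_div X n : (0 < n)%N -> lnn X <= lnn n + X%:R / n%:R.
Proof.
move=> n0; have n0' : 0 < n%:R :> R by rewrite ltr0n.
case: (posnP X) => [->|X0]; first by rewrite lnn0 mul0r addr0 lnn_ge0.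
have X0' : 0 < X%:R :> R by rewrite ltr0n.
rewrite -lerBlDl /lnn -ln_div ?posrE //; apply/ltW/ln_sublinear.
by rewrite divr_gt0.
Qed.

(** The weight [lnn X] is at most [lnn n + X / n]. Expanding [lnn n] over prime powers [p ^ j],
    those with a given cofactor [m] contribute at most [6 X / m] by [psi_le]. *)
Lemma N_le_hsum X : N X * lnn X <= 7 * X%:R * hsum R copr X.
Proof.
have h1 : N X * lnn X <= \sum_(1 <= n < X.+1 | Sm Y q n) lnn n * 1 + X%:R * hsum R copr X.
  apply: le_trans (_ : _ <= \sum_(1 <= n < X.+1 | Sm Y q n) lnn n * 1 + X%:R * hsum R (Sm Y q) X) _; last first.
    by rewrite lerD2l ler_wpM2l //; apply: hsum_sub => n _ /andP[].
  rewrite /N /hsum mulr_suml mulr_sumr -big_split /= [leLHS]big_nat_cond [leRHS]big_nat_cond.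
  apply: ler_sum => n /andP[/andP[n0 _] _]; rewrite mulr1 mul1r; exact: lnn_le_add_div.
have h2 : \sum_(1 <= n < X.+1 | Sm Y q n) lnn n * 1 <= 6 * X%:R * hsum R copr X.
  rewrite (sum_lnn_expand (Z := Y)); last by move=> n _ /andP[].
  apply: le_trans (_ : \sum_(1 <= p < Y.+1 | prime p) \sum_(1 <= j < X.+1)
      \sum_(1 <= m < X.+1) (if coprime m q && (p ^ j <= X %/ m)%N then lnn p else 0) <= _).
    apply: ler_sum => p pp; apply: ler_sum => j _.
    have pj0 : (0 < p ^ j)%N by rewrite expn_gt0 prime_gt0.
    rewrite (eq_bigl (fun n => (p ^ j %| n)%N && Sm Y q n)); last by move=> n; rewrite andbC.
    rewrite big_mkcondr sum_multiples // mulr_sumr.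
    rewrite [leRHS](big_cat_nat (n := (X %/ p ^ j).+1)) //=; last by rewrite ltnS leq_div.
    apply: ler_wpDr; first by apply: sumr_ge0 => m _; case: ifP => // _; rewrite lnn_ge0.
    apply: ler_sum_nat => m /andP[m0 mX]; case: ifP => h; last first.
      by rewrite mulr0; case: ifP => // _; rewrite lnn_ge0.
    have -> : coprime m q by move: h => /andP[_]; rewrite coprimeMl => /andP[].
    have -> : (p ^ j <= X %/ m)%N by rewrite leq_divRL // mulnC -leq_divRL.
    by rewrite mulr1.
  under eq_bigr do rewrite exchange_big_nat.
  rewrite exchange_big_nat /= /hsum mulr_sumr [leRHS]big_mkcond; apply: ler_sum_nat => m /andP[m0 _].
  case: ifP => cm; last by rewrite big1 // => p _; rewrite big1.
  have -> : \sum_(1 <= p < Y.+1 | prime p) \sum_(1 <= j < X.+1) (if (p ^ j <= X %/ m)%N then lnn p else 0)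
    = \sum_(1 <= p < Y.+1 | prime p) \sum_(1 <= j < X.+1 | (p ^ j <= X %/ m)%N) lnn p.
    by apply: eq_bigr => p _; rewrite [RHS]big_mkcond.
  apply: le_trans (psi_le R Y (leq_div X m)) _.
  rewrite -mulrA ler_wpM2l // ler_pdivlMr ?ltr0n // -natrM ler_nat; exact: leq_trunc_div.
lra.
Qed.

(** With [Z] about [D ^ (1/3)], [hsum_coprime_growth] bounds the harmonic sum up to [X] by
    [6 * S * lnn X / lnn Z], and [lnn X] cancels. Since [L <= 36 * lnn Z], the constant is
    [42 * 36 <= 2000]. *)
Lemma N_upper X : (D <= X)%N -> N X * L <= 2000 * S * X%:R.
Proof.
move=> DX; have X0 : (0 < X)%N by apply: leq_trans DX; apply: leq_trans D_ge.
pose Z := rootn 2 D; have /andP[Z1 Z2] := rootnP 2 D.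
have Zb : (2 ^ 6 <= Z)%N by apply: rootn_ge; rewrite -expnM; apply: leq_trans D_ge; rewrite leq_exp2l.
have Z0 : (0 < Z)%N by apply: leq_trans Zb.
have Zl : (D <= Z ^ 4)%N.
  apply: leq_trans (ltnW Z2) _; apply: leq_trans (_ : _ <= (2 * Z) ^ 3)%N _.
    by rewrite leq_exp2r //; rewrite -/Z; lia.
  by rewrite expnMn [(Z ^ 4)%N]expnS leq_mul2r; apply/orP; right; apply: leq_trans Zb.
have ZD : 3 * lnn Z <= lnn D by rewrite -lnnX ?lnn_le.
have DZ : lnn D <= 4 * lnn Z by rewrite -lnnX ?lnn_le.
have h0 := lnD_ge.
have h1 := L_le.
have hL := L_ge.
have Z12 : 12 <= lnn Z by have := L_ge1000; lra.
have h2 := hsum_coprime_growth q X Z12.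
rewrite lnnM // in h2.
have h3 := N_le_hsum X.
have DXl : lnn D <= lnn X by rewrite lnn_le.
have lX0 : 0 < lnn X by lra.
have lZ0 : 0 < lnn Z by lra.
have SS : hsum R copr (Z ^ 3) <= S by apply: hsum_le.
have HX0 := hsum_ge0 R copr X; have S1 := S_ge1.
have NX0 := N_ge0 R Y q X.
have h4 : hsum R copr X * lnn Z <= 2 * S * (3 * lnn X).
  apply: le_trans h2 _; apply: le_trans (_ : 2 * S * (1 + (lnn Z + lnn X)) <= _).
    by rewrite ler_wpM2r ?ler_wpM2l //; lra.
  by rewrite ler_wpM2l //; lra.
have h5 : N X * lnn X * lnn Z <= 7 * X%:R * (2 * S * (3 * lnn X)).
  by apply: le_trans (ler_wpM2r (ltW lZ0) h3) _; rewrite -[leLHS]mulrA ler_wpM2l // mulr_ge0.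
have h6 : N X * lnn Z <= 42 * S * X%:R.
  rewrite -(ler_pM2r lX0); lra.
have : N X * L <= 36 * (N X * lnn Z).
  have -> : 36 * (N X * lnn Z) = N X * (36 * lnn Z) by ring.
  by rewrite ler_wpM2l //; lra.
have : 0 <= S * X%:R by rewrite mulr_ge0 //; lra.
lra.
Qed.

Lemma trunc_div_ge a b : (0 < b)%N -> a%:R / b%:R - 1 <= (a %/ b)%:R :> R.
Proof.
move=> b0; have b0' : 0 < b%:R :> R by rewrite ltr0n.
by rewrite lerBlDr natr1 ler_pdivrMr // -natrM ler_nat ltnW // -ltn_divLR.
Qed.

Lemma trunc_div_le a b : (0 < b)%N -> (a %/ b)%:R <= a%:R / b%:R :> R.
Proof.
move=> b0; have b0' : 0 < b%:R :> R by rewrite ltr0n.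
by rewrite ler_pdivlMr // -natrM ler_nat leq_trunc_div.
Qed.

Lemma trunc_div_ge_half a b : (0 < b <= a)%N -> a%:R / (2 * b%:R) <= (a %/ b)%:R :> R.
Proof.
move=> /andP[b0 ba]; have b0' : 0 < b%:R :> R by rewrite ltr0n.
have h := trunc_div_ge a b0; have h1 : 1 <= (a %/ b)%:R :> R by rewrite ler1n divn_gt0.
have -> : a%:R / (2 * b%:R) = (a%:R / b%:R) / 2 :> R by field; rewrite gt_eqF.
lra.
Qed.

Lemma lnq_small : 2 ^+ 20 * (lnn q + 1) <= D%:R.
Proof.
have h := lnq_le; have hL := L_ge1000.
apply: le_trans KD; apply: le_trans (_ : 2 ^+ 20 * (B%:R + 1) * L <= _); last first.
  by rewrite ler_wpM2r //; lra.
rewrite -mulrA ler_wpM2l ?exprn_ge0 //; lra.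
Qed.

Lemma ler_sum_nat_sub (f : nat -> R) (P Q : pred nat) a b a' b' :
  (forall n, 0 <= f n) ->
  (forall n, (a <= n < b)%N -> P n -> (a' <= n < b')%N && Q n) ->
  \sum_(a <= n < b | P n) f n <= \sum_(a' <= n < b' | Q n) f n.
Proof.
move=> f0 h; pose c := minn a a'; pose d := maxn b b'.
have E x y (T : pred nat) : (c <= x)%N -> (y <= d)%N ->
   \sum_(x <= n < y | T n) f n = \sum_(c <= n < d) (if (x <= n < y)%N && T n then f n else 0).
  move=> cx yd; rewrite (@big_nat_widenl _ _ _ x c) // (@big_nat_widen _ _ _ _ y d) //.
  by rewrite [LHS]big_mkcond; apply: eq_bigr => n _; rewrite -andbA andbC.
rewrite (E a b) ?geq_minl ?leq_maxl // (E a' b') ?geq_minr ?leq_maxr //.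
apply: ler_sum => n _; case: ifP => [/andP[h1 h2]|_]; last by case: ifP.
by rewrite h.
Qed.

(** Counts products [m * p] with [m <= D] coprime to [q] and [p <= t / m] prime, which are smooth
    because [t <= Y]. The weights [lnn p] of the walk identity account for repeated products, and
    Chebyshev's lower bound handles each [m]. *)
Lemma N_lower_base t : (D ^ 2 <= t <= Y)%N -> t%:R * S <= 2 ^+ 17 * (N t * L).
Proof.
move=> /andP[Dt tY]; have t0 : (0 < t)%N.
  by apply: leq_trans Dt; rewrite expn_gt0 (leq_trans _ D_ge).
have D0 : (0 < D)%N by apply: leq_trans D_ge.
have Dt1 : (D <= t)%N by apply: leq_trans Dt; rewrite leq_pmulr.
have h1 := @N_ln_ge R Y q t predT t0.
have h2 : N t * lnn t <= N t * L by rewrite ler_wpM2l ?N_ge0 // lnn_le.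
apply: le_trans (_ : 2 ^+ 17 * (\sum_(1 <= p < Y.+1 | pr q p && true) lnn p * N (t %/ p)) <= _); last first.
  by rewrite ler_wpM2l ?exprn_ge0 //; apply: le_trans h1 h2.
have h3 : \sum_(1 <= m < D.+1 | copr m) \sum_(1 <= p < (t %/ m).+1 | prime p && coprime p q) lnn p <=
   \sum_(1 <= p < Y.+1 | pr q p && true) lnn p * N (t %/ p).
  apply: le_trans (_ : \sum_(1 <= m < D.+1 | copr m) \sum_(1 <= p < Y.+1 | pr q p && true)
     (if (p <= t %/ m)%N then lnn p else 0) <= _).
    apply: ler_sum => m _; rewrite -big_mkcondr; apply: ler_sum_nat_sub => [p|p /andP[p0 pt] hp].
      exact: lnn_ge0.
    rewrite p0 andbT /= /pr hp ltnS; rewrite ltnS in pt; rewrite pt andbT.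
    by rewrite andbT (leq_trans pt (leq_trans (leq_div _ _) tY)).
  rewrite exchange_big_nat /= [leLHS]big_nat_cond [leRHS]big_nat_cond.
  apply: ler_sum => p /andP[/andP[p0 pY] _].
  rewrite -big_mkcondr /N mulr_sumr (eq_bigr (fun=> lnn p * 1)); last by move=> m _; rewrite mulr1.
  apply: ler_sum_nat_sub => [m|m /andP[m0 mD] /andP[cm hm]]; first by rewrite mulr1 lnn_ge0.
  rewrite m0 /Sm cm andbT ltnS leq_divRL // mulnC -leq_divRL // hm /=.
  by apply: lep_nat_leq; rewrite m0 (leq_trans _ (leq_trans Dt1 tY)).
apply: le_trans (ler_wpM2l _ h3); last by rewrite exprn_ge0.
rewrite /hsum !mulr_sumr [leLHS]big_nat_cond [leRHS]big_nat_cond.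
apply: ler_sum => m /andP[/andP[m0 mD] _].
have q0 := ltnW q1.
apply: le_trans (ler_wpM2l _ (theta_coprime_ge R (t %/ m) q0)); last by rewrite exprn_ge0.
have p16 : (0 < 2 ^ 16)%N by rewrite expn_gt0.
have a1 := trunc_div_ge (t %/ m) p16; rewrite natrX in a1.
have a2 := trunc_div_ge t m0.
have a3 : D%:R <= t%:R / m%:R :> R.
  by rewrite ler_pdivlMr ?ltr0n // -natrM ler_nat; apply: leq_trans Dt; rewrite leq_mul2l -ltnS mD orbT.
have a4 := lnq_small; have lq0 := lnn_ge0 R q.
move: a1 a2 a3; set x := (t %/ m)%:R; set y := t%:R / m%:R; set z := (_ %/ 2 ^ 16)%:R.
move=> a1 a2 a3.
have -> : 2 ^+ 17 = 2 * 2 ^+ 16 :> R by rewrite exprS.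
rewrite [2 ^+ 20](_ : _ = 16 * 2 ^+ 16) in a4; last by ring.
have e16 : 1 <= 2 ^+ 16 :> R by rewrite exprn_ege1 // ler1n.
move: e16 a1 a4; set e := 2 ^+ 16 => e16 a1 a4.
have a5 : x - e <= e * z.
  have e0 : 0 < e by lra.
  have : e * (x / e - 1) <= e * z by rewrite ler_pM2l.
  by rewrite mulrBr mulr1 mulrCA divff ?gt_eqF // mulr1.
have a6 : e * lnn q <= D%:R / 16 - e by lra.
have elq : 0 <= e * lnn q by rewrite mulr_ge0 //; lra.
have -> : 2 * e * (z - lnn q) = 2 * (e * z) - 2 * (e * lnn q) by ring.
clear -a2 a3 a5 a6 e16 elq; lra.
Qed.

(** Beyond [D] the primes dividing [q] weigh at most 1, whence 8 in place of 7. *)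
Lemma prime_window_ge a b : (D <= a <= b)%N ->
  lnn b - lnn a - 8 <= \sum_(a.+1 <= p < b.+1 | pr q p) lnn p / p%:R.
Proof.
move=> /andP[Da ab].
have a0 : (0 < a)%N by apply: leq_trans Da; apply: leq_trans D_ge.
apply: le_trans (mertens_window R a0 ab (ltnW q1)).
have a0' : 0 < a%:R :> R by rewrite ltr0n.
suff : lnn q / a%:R <= 1 by lra.
rewrite ler_pdivrMr // mul1r; apply: le_trans (_ : D%:R <= _); last by rewrite ler_nat.
apply: le_trans lnq_small; have lq0 := lnn_ge0 R q.
have e20 : 1 <= 2 ^+ 20 :> R by rewrite exprn_ege1 // ler1n.
nra.
Qed.

(** Division by a prime of []D, D ^ 2]] brings [t] back to the previous range. These primes have sum
    of [lnn p / p] at least [L / 18], while [lnn t <= U * L], so each extension of the range loses a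
    factor of order [U]. *)
Lemma N_lower_step U i (c : R) : 0 <= c -> (0 < U)%N ->
  (forall t, (D ^ 2 <= t <= Y * D ^ i)%N -> (t <= Y ^ U)%N -> c * (t%:R * S) <= N t * L) ->
  forall t, (D ^ 2 <= t <= Y * D ^ i.+1)%N -> (t <= Y ^ U)%N ->
   c / (100 * U%:R) * (t%:R * S) <= N t * L.
Proof.
move=> c0 U0 IH t /andP[Dt tY] tU.
have D0 : (0 < D)%N by apply: leq_trans D_ge.
have S1 := S_ge1; have L1 := L_ge1000.
have U1 : 1 <= U%:R :> R by rewrite ler1n.
have tS : 0 <= t%:R * S by rewrite mulr_ge0 //; lra.
case: (leqP t (Y * D ^ i)) => hti.
  apply: le_trans (IH t _ tU); last by rewrite Dt.
  rewrite ler_wpM2r // ler_pdivrMr; last by lra.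
  by rewrite ler_peMr //; lra.
have YD : (Y <= t)%N.
  by apply: leq_trans (ltnW hti); rewrite leq_pmulr // expn_gt0 D0.
have t0 : (0 < t)%N by apply: leq_trans YD; apply: ltnW; apply: Y_gt1.
have tl : lnn t <= U%:R * L by rewrite -lnnX ?lnn_le // ltnW // Y_gt1.
have D2Y : (D ^ 2 <= Y)%N by apply: leq_trans D8; rewrite leq_exp2l // (leq_trans _ D_ge).
have h1 := @N_ln_ge R Y q t (fun p => (D < p <= D ^ 2)%N) t0.
have h2 : c * S / L * (t%:R / 2) * \sum_(D.+1 <= p < (D ^ 2).+1 | pr q p) lnn p / p%:R
    <= N t * lnn t.
  apply: le_trans h1; rewrite mulr_sumr.
  apply: le_trans (_ : \sum_(D.+1 <= p < (D ^ 2).+1 | pr q p) lnn p * N (t %/ p) <= _); last first.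
    apply: ler_sum_nat_sub => [p|p /andP[p1 p2] hp]; first by rewrite mulr_ge0 ?lnn_ge0 ?N_ge0.
    by rewrite hp p1 !ltnS in p2 *; rewrite p2 (leq_trans p2 D2Y) !andbT (leq_trans _ p1).
  rewrite [leLHS]big_nat_cond [leRHS]big_nat_cond; apply: ler_sum => p /andP[/andP[p1 p2] _].
  rewrite ltnS in p2.
  have p0 : (0 < p)%N by apply: leq_trans p1.
  have pt : (p <= t)%N by apply: leq_trans p2 Dt.
  have hp : c * ((t %/ p)%:R * S) <= N (t %/ p) * L.
    apply: IH; last by apply: leq_trans (leq_div _ _) tU.
    apply/andP; split.
      rewrite leq_divRL //; apply: leq_trans (_ : _ <= D ^ 2 * D ^ 2)%N _; first by rewrite leq_mul2l p2 orbT.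
      apply: leq_trans YD; rewrite -expnD; apply: leq_trans D8; rewrite leq_exp2l //.
      by apply: leq_trans D_ge.
    apply: leq_trans (leq_div2l t _ (ltnW p1)) _ => //.
    by apply: leq_trans (leq_div2r D tY) _; rewrite expnSr mulnA mulnK.
  have L0 : 0 < L by lra.
  have -> : c * S / L * (t%:R / 2) * (lnn p / p%:R) = lnn p * ((c * (t%:R / (2 * p%:R) * S)) / L).
    by field; rewrite !gt_eqF // ltr0n.
  rewrite ler_wpM2l ?lnn_ge0 // ler_pdivrMr //; apply: le_trans hp.
  rewrite ler_wpM2l // ler_wpM2r //; first by lra.
  by apply: trunc_div_ge_half; rewrite p0.
have h3 : lnn D / 2 <= \sum_(D.+1 <= p < (D ^ 2).+1 | pr q p) lnn p / p%:R.
  apply: le_trans (@prime_window_ge D (D ^ 2) _); last by rewrite leqnn leq_pmulr.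
  rewrite lnnX //; have := L_le; lra.
have h4 := L_le.
have h5 : c * S / L * (t%:R / 2) * (L / 18) <= N t * (U%:R * L).
  apply: le_trans (_ : N t * lnn t <= _); last by rewrite ler_wpM2l ?N_ge0.
  apply: le_trans h2; rewrite ler_wpM2l //; last by lra.
  by rewrite mulr_ge0 // divr_ge0 ?mulr_ge0 //; lra.
have -> : c / (100 * U%:R) * (t%:R * S) = (c * S * t%:R / 100) / U%:R by field; rewrite gt_eqF //; lra.
rewrite ler_pdivrMr; last by lra.
have e : c * S / L * (t%:R / 2) * (L / 18) = c * S * t%:R / 36 by field; rewrite gt_eqF //; lra.
have e' : N t * L * U%:R = N t * (U%:R * L) by ring.
rewrite e in h5; rewrite e'; apply: le_trans h5.
have : 0 <= c * S * t%:R by rewrite !mulr_ge0 //; lra.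
lra.
Qed.

(** The factor [2 ^ -17] comes from the range up to [Y]; then [9 * U] extensions by a factor [D]
    reach [Y ^ U], since [Y < D ^ 9]. *)
Definition lowc (U : nat) : R := 2^-1 ^+ 17 * (100 * U%:R)^-1 ^+ (9 * U).

Lemma lowc_gt0 U : (0 < U)%N -> 0 < lowc U.
Proof.
move=> U0; rewrite /lowc mulr_gt0 // exprn_gt0 // invr_gt0 // mulr_gt0 //.
by rewrite ltr0n.
Qed.

Lemma lowc_le1 U : (0 < U)%N -> lowc U <= 1.
Proof.
move=> U0; have U1 : 1 <= U%:R :> R by rewrite ler1n.
rewrite /lowc; apply: mulr_ile1; rewrite ?exprn_ge0 ?invr_ge0 ?mulr_ge0 //.
  by apply: exprn_ile1; lra.
apply: exprn_ile1; first by rewrite invr_ge0; lra.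
by rewrite invf_le1; lra.
Qed.

Lemma N_lower U t : (0 < U)%N -> (D ^ 2 <= t <= Y ^ U)%N ->
  lowc U * (t%:R * S) <= N t * L.
Proof.
move=> U0.
have D0 : (0 < D)%N by apply: leq_trans D_ge.
have U1 : 1 <= U%:R :> R by rewrite ler1n.
have H i : forall t, (D ^ 2 <= t <= Y * D ^ i)%N -> (t <= Y ^ U)%N ->
   2^-1 ^+ 17 * (100 * U%:R)^-1 ^+ i * (t%:R * S) <= N t * L.
  elim: i => [|i IH] s hs hsU.
    rewrite expr0 mulr1 exprVn ler_pdivrMl ?exprn_gt0 //.
    by apply: N_lower_base; rewrite expn0 muln1 in hs.
  have -> : 2^-1 ^+ 17 * (100 * U%:R)^-1 ^+ i.+1 = 2^-1 ^+ 17 * (100 * U%:R)^-1 ^+ i / (100 * U%:R) :> R.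
    by rewrite (exprSr _ i) mulrA.
  apply: (@N_lower_step U i) => //.
  by rewrite mulr_ge0 ?exprn_ge0 ?invr_ge0 ?mulr_ge0.
move=> /andP[h1 h2]; apply: H => //; rewrite h1; apply: leq_trans h2 _.
have Y0 : (0 < Y)%N by apply: ltnW; apply: Y_gt1.
case: U U0 {U1} => // U _; rewrite expnS leq_mul2l; apply/orP; right.
rewrite mulnS expnD expnM; apply: leq_trans (_ : _ <= (D ^ 9) ^ U)%N _.
  by case: U => // U; rewrite leq_exp2r // ltnW // Y_lt.
by rewrite leq_pmull // expn_gt0 D0.
Qed.

(** * Growth of [N] with a constant independent of the range *)

Fact C1_key : unit. Proof. by []. Qed.
(** Built from [lowc 6] alone: the contraction rate depends on it and is fixed before the range [U].
    Locked, so that it remains an atom for arithmetic tactics. *)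
Definition C1 : R := locked_with C1_key (2000 / lowc 6).
Lemma C1E : C1 = 2000 / lowc 6. Proof. by rewrite /C1 unlock. Qed.

Lemma C1_ge1 : 1 <= C1.
Proof.
have h := lowc_gt0 (isT : 0 < 6)%N; have h' := lowc_le1 (isT : 0 < 6)%N.
by rewrite C1E ler_pdivlMr // mul1r; lra.
Qed.

Lemma N_mul_base b lam : (D ^ 2 <= b <= Y ^ 6)%N -> (0 < lam)%N ->
  N (lam * b) <= C1 * lam%:R * N b.
Proof.
move=> hb l0; have L0 : 0 < L by have := L_ge1000; lra.
have D0 : (0 < D)%N by apply: leq_trans D_ge.
have h1 : (D <= lam * b)%N.
  by move: hb => /andP[h _]; apply: leq_trans (leq_trans h (leq_pmull _ l0)); rewrite leq_pmulr.
have h2 := N_upper h1; have h3 := N_lower (isT : 0 < 6)%N hb.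
have c0 := lowc_gt0 (isT : 0 < 6)%N.
rewrite -(ler_pM2r L0); apply: le_trans h2 _; rewrite natrM.
rewrite -ler_pdivlMl // in h3.
have -> : C1 * lam%:R * N b * L = 2000 * lam%:R * ((lowc 6)^-1 * (N b * L)) by rewrite C1E; ring.
have -> : 2000 * S * (lam%:R * b%:R) = 2000 * lam%:R * (b%:R * S) by ring.
by rewrite ler_wpM2l // mulr_ge0.
Qed.

Lemma N_S m : N m.+1 <= N m + 1.
Proof.
rewrite /N big_mkcond big_nat_recr //= -big_mkcond /= lerD2l; by case: ifP.
Qed.

Lemma L_le_Y : L <= Y%:R. Proof. exact: lnn_le_nat. Qed.

(** From [Y ^ 6] on, [N b] dominates the boundary terms of the induction in [N_mul]. *)
Lemma N_large U b : (0 < U)%N -> 9 * U%:R / lowc 6 <= K -> (Y ^ 6 <= b)%N ->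
  9 * Y%:R ^+ 2 * U%:R * L <= N b.
Proof.
move=> U0 KU hb; have c0 := lowc_gt0 (isT : 0 < 6)%N.
have L0 : 0 < L by have := L_ge1000; lra.
have Y0 : (0 < Y)%N by apply: ltnW; apply: Y_gt1.
have S1 := S_ge1.
apply: le_trans (@N_le R Y q _ _ hb).
have h : lowc 6 * ((Y ^ 6)%:R * S) <= N (Y ^ 6) * L.
  apply: N_lower => //; rewrite leqnn andbT; apply: leq_trans (leq_trans _ D8) _.
    by rewrite leq_exp2l // (leq_trans _ D_ge).
  by rewrite -{1}(expn1 Y) leq_exp2l ?Y_gt1.
rewrite -(ler_pM2r L0); apply: le_trans h.
apply: le_trans (_ : lowc 6 * ((Y ^ 6)%:R * 1) <= _); last by rewrite ler_wpM2l ?ler_wpM2l // ltW.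
rewrite mulr1 natrX; have hY := L_le_Y.
have h2 : 9 * U%:R <= Y%:R * lowc 6.
  by rewrite -ler_pdivrMr //; apply: le_trans KU (le_trans KL hY).
have U0' : 0 <= U%:R :> R by [].
have y1 : 1 <= Y%:R :> R by rewrite ler1n.
have -> : lowc 6 * Y%:R ^+ 6 = Y%:R ^+ 5 * (Y%:R * lowc 6) by ring.
apply: le_trans (_ : Y%:R ^+ 5 * (9 * U%:R) <= _); last by rewrite ler_wpM2l ?exprn_ge0.
have -> : 9 * Y%:R ^+ 2 * U%:R * L * L = Y%:R ^+ 2 * (9 * U%:R) * (L * L) by ring.
have -> : Y%:R ^+ 5 * (9 * U%:R) = Y%:R ^+ 2 * (9 * U%:R) * Y%:R ^+ 3 :> R by ring.
rewrite ler_wpM2l ?mulr_ge0 ?exprn_ge0 //.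
rewrite 2!exprS expr1; nra.
Qed.

Lemma sum_blocks (f : nat -> R) lam a b : (a <= b)%N ->
  \sum_(lam * a <= s < lam * b) f s = \sum_(a <= m < b) \sum_(lam * m <= s < lam * m.+1) f s.
Proof.
elim: b => [|b IH]; first by rewrite leqn0 => /eqP ->; rewrite !big_geq.
rewrite leq_eqVlt => /orP[/eqP ->|]; first by rewrite !big_geq.
rewrite ltnS => ab; rewrite big_nat_recr //= -IH //.
by rewrite (big_cat_nat (n := (lam * b)%N)) //= leq_mul2l ?ab ?leqnSn ?orbT.
Qed.

(** The upper and lower bounds for [N] alone would give a constant depending on [U]. Instead the
    walk identities at [lam * b] and at [b] are compared term by term, by induction on [b]. As
    [lnn (lam * b) = lnn lam + lnn b], a surplus [C1 * lam * N b * lnn lam] is left, and it pays the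
    boundary terms beyond [Y ^ 6]. *)
Lemma N_mul U b lam : 9 * U%:R / lowc 6 <= K -> (0 < U)%N ->
  (D ^ 2 <= b <= Y ^ U)%N -> (0 < lam)%N -> N (lam * b) <= C1 * lam%:R * N b.
Proof.
move=> KU U0 hb l0.
have C11 := C1_ge1.
have [->|l1] : lam = 1%N \/ (1 < lam)%N by clear -l0; lia.
  by rewrite mul1n mulr1 ler_peMl ?N_ge0.
have D0 : (0 < D)%N by apply: leq_trans D_ge.
have Y0 : (0 < Y)%N by apply: ltnW; apply: Y_gt1.
have D2Y : (D ^ 2 <= Y)%N by apply: leq_trans D8; rewrite leq_exp2l // (leq_trans _ D_ge).
move: hb; have [k] := ubnP b; elim: k b => // k IH b bk /andP[Db bU].
case: (leqP b (Y ^ 6)) => hb6; first by apply: N_mul_base => //; rewrite Db.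
have lb : lnn b <= U%:R * L by rewrite -lnnX ?lnn_le.
have Yb : (Y < b)%N.
  by apply: leq_ltn_trans hb6; rewrite -{1}(expn1 Y) leq_exp2l ?Y_gt1.
have b0 : (0 < b)%N by apply: leq_trans Yb.
have X0 : (0 < lam * b)%N by rewrite muln_gt0 l0.
(* The argument [m.+1] allows for rounding: [lam * b %/ p ^ j <= lam * (b %/ p ^ j).+1]. *)
have IH' m : (Y <= m)%N -> (m.+1 < b)%N -> N (lam * m.+1) <= C1 * lam%:R * (N m + 1).
  move=> Ym mb; apply: le_trans (IH m.+1 _ _) _; first by clear -mb bk; lia.
    by rewrite (leq_trans (leq_trans D2Y Ym)) //= (leq_trans (ltnW mb)).
  by rewrite ler_wpM2l ?N_S // mulr_ge0 //; lra.
have lam0 : 0 <= lam%:R :> R by [].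
have Cl0 : 0 <= C1 * lam%:R by rewrite mulr_ge0 //; lra.
set Ib := \sum_(1 <= s < b) N s * (lnn s.+1 - lnn s).
set IIb := \sum_(1 <= p < Y.+1 | pr q p) \sum_(1 <= j < b.+1) lnn p * N (b %/ p ^ j).
have Wb : N b * lnn b = Ib + IIb := N_walk R Y 1%g b0.
have WX : N (lam * b) * lnn (lam * b) = _ := N_walk R Y 1%g X0.
have hI : \sum_(1 <= s < lam * b) N s * (lnn s.+1 - lnn s) <=
   lam%:R * Y%:R + C1 * lam%:R * (Ib + lnn b) + 2 * lam%:R.
  have Yl : (1 <= lam * Y)%N by rewrite muln_gt0 l0.
  rewrite (big_cat_nat (n := (lam * Y)%N)) //=; last by rewrite leq_mul2l (ltnW Yb) orbT.
  rewrite -addrA; apply: lerD.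
    apply: le_trans (_ : \sum_(1 <= s < lam * Y) 1 <= _); last first.
      by rewrite big_const_nat iter_addr addr0 -natrM ler_nat leq_subr.
    apply: ler_sum_nat => s /andP[s0 _].
    have s0' : 0 < s%:R :> R by rewrite ltr0n.
    apply: le_trans (ler_pM _ _ (N_le_nat R Y q s) (lnnS_sub_le R s0)) _.
    - exact: N_ge0.
    - exact: lnnS_sub_ge0.
    by rewrite divff // gt_eqF.
  rewrite sum_blocks; last exact: ltnW.
  have E m : (0 < m)%N -> \sum_(lam * m <= s < lam * m.+1) N s * (lnn s.+1 - lnn s) <=
      N (lam * m.+1) * (lnn m.+1 - lnn m).
    move=> m0; apply: le_trans (_ : \sum_(lam * m <= s < lam * m.+1) N (lam * m.+1) * (lnn s.+1 - lnn s) <= _).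
      apply: ler_sum_nat => s /andP[_ hs]; rewrite ler_wpM2r ?lnnS_sub_ge0 //.
      by apply: N_le; apply: ltnW.
    rewrite -mulr_sumr sum_lnnS ?leq_mul2l ?leqnSn ?orbT // !lnnM //.
    by rewrite opprD addrACA subrr add0r.
  have [b' eb] : exists b', b = b'.+1 by exists b.-1; rewrite prednK.
  have Yb' : (Y <= b')%N by clear -eb Yb; lia.
  have b'0 : (0 < b')%N by clear -Yb' Y0; lia.
  rewrite eb big_nat_recr //= -eb; apply: lerD; last first.
    have := E b'; rewrite -eb => H; apply: le_trans (H _) _; first by [].
    apply: le_trans (ler_pM _ _ (N_le_nat R Y q _) (_ : _ <= b'%:R^-1)) _; rewrite ?N_ge0 ?eb ?lnnS_sub_ge0 //.
      exact: lnnS_sub_le.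
    have b'1 : 1 <= b'%:R :> R by rewrite ler1n.
    rewrite natrM -natr1 ler_pdivrMr; last by lra.
    have -> : 2 * lam%:R * b'%:R = lam%:R * (2 * b'%:R) :> R by ring.
    by rewrite ler_wpM2l //; lra.
  apply: le_trans (_ : \sum_(Y <= m < b') C1 * lam%:R * (N m + 1) * (lnn m.+1 - lnn m) <= _).
    apply: ler_sum_nat => m /andP[Ym mb]; apply: le_trans (E m _) _; first by clear -Ym Y0; lia.
    by rewrite ler_wpM2r ?lnnS_sub_ge0 // IH' //; clear -mb eb; lia.
  under eq_bigr do rewrite -mulrA mulrDl mul1r.
  rewrite -mulr_sumr ler_wpM2l // big_split /=; apply: lerD.
    rewrite /Ib; apply: ler_sum_nat_sub => [m|m /andP[h1 h2] _].
      by rewrite mulr_ge0 ?N_ge0 ?lnnS_sub_ge0.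
    by rewrite andbT; apply/andP; split; clear -h1 h2 eb Y0; lia.
  rewrite sum_lnnS //; have := lnn_ge0 R Y; have : lnn b' <= lnn b by rewrite eb lnn_le.
  lra.
have pi0 (c : R) : 0 <= c -> \sum_(1 <= p < Y.+1 | pr q p) c <= Y%:R * c.
  move=> c0; rewrite -(sum_nat1 R) mulr_suml [leLHS]big_mkcond; apply: ler_sum => p _.
  by rewrite mul1r; case: ifP.
have lbX : lnn b <= lnn (lam * b) by rewrite lnn_le // leq_pmull.
have lX0 := lnn_ge0 R (lam * b); have lb0 := lnn_ge0 R b.
have hII : \sum_(1 <= p < Y.+1 | pr q p) \sum_(1 <= j < (lam * b).+1) lnn p * N (lam * b %/ p ^ j)
   <= C1 * lam%:R * (IIb + Y%:R * lnn b) + lam%:R * Y%:R * (Y%:R * lnn (lam * b)).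
  apply: le_trans (_ : \sum_(1 <= p < Y.+1 | pr q p)
     (C1 * lam%:R * (\sum_(1 <= j < b.+1) lnn p * N (b %/ p ^ j) + lnn b) + lam%:R * Y%:R * lnn (lam * b)) <= _); last first.
    rewrite big_split /= -mulr_sumr big_split /= -/IIb; apply: lerD.
      by rewrite ler_wpM2l // lerD2l pi0.
    rewrite (mulrCA _ Y%:R); apply: pi0; by rewrite !mulr_ge0.
  apply: ler_sum => p prp; have p1 : (1 < p)%N by apply: prime_gt1; case/andP: prp.
  have pj0 j : (0 < p ^ j)%N by rewrite expn_gt0 ltnW.
  have lp := lnn_ge0 R p.
  apply: le_trans (_ : \sum_(1 <= j < (lam * b).+1 | (p ^ j * Y <= b)%N) C1 * lam%:R * (lnn p * N (b %/ p ^ j) + lnn p) +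
     \sum_(1 <= j < (lam * b).+1 | (p ^ j <= lam * b)%N) lam%:R * Y%:R * lnn p <= _).
    rewrite [X in _ <= X + _]big_mkcond [X in _ <= _ + X]big_mkcond -big_split /=.
    apply: ler_sum_nat => j /andP[j0 _].
    have t2 : 0 <= (if (p ^ j <= lam * b)%N then lam%:R * Y%:R * lnn p else 0).
      by case: ifP => // _; rewrite !mulr_ge0.
    case: ifP => hj.
      apply: ler_wpDr => //.
      have -> : C1 * lam%:R * (lnn p * N (b %/ p ^ j) + lnn p) =
         lnn p * (C1 * lam%:R * (N (b %/ p ^ j) + 1)) by ring.
      rewrite ler_wpM2l //.
      have hY : (Y <= b %/ p ^ j)%N by rewrite leq_divRL // mulnC.
      have pj2 : (2 <= p ^ j)%N by rewrite -(expn1 2); apply: leq_trans (_ : 2 ^ j <= _)%N; [rewrite leq_exp2l|case: j j0 {t2 hj hY} => // j _; rewrite leq_exp2r].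
      apply: le_trans (IH' _ hY _).
        apply: N_le; rewrite -ltnS ltn_divLR //.
        have h5 := ltn_ceil b (pj0 j).
        apply: leq_ltn_trans (_ : lam * ((b %/ p ^ j).+1 * p ^ j) < _)%N; first by rewrite leq_mul2l (ltnW h5) orbT.
        by rewrite mulnA ltn_mul2r pj0 /= ltnS.
      have : (b %/ p ^ j <= b %/ 2)%N by apply: leq_div2l.
      have : (2 <= Y)%N by apply: Y_gt1.
      clear -Yb; lia.
    rewrite add0r; case: ifP => hj2; last first.
      by rewrite divn_small ?N0 ?mulr0 // ltnNge hj2.
    rewrite [leRHS]mulrC ler_wpM2l // -natrM; apply: le_trans (N_le_nat R Y q _) _.
    rewrite ler_nat -ltnS ltn_divLR //; move/negbT: hj; rewrite -ltnNge => hj.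
    apply: leq_trans (_ : lam * (p ^ j * Y) <= _)%N; first by rewrite ltn_mul2l l0.
    by rewrite (mulnC (p ^ j)%N) mulnA leq_mul2r leqnSn orbT.
  apply: lerD.
    rewrite -mulr_sumr ler_wpM2l // big_split /=; apply: lerD.
      apply: ler_sum_nat_sub => [j|j /andP[j0 _] hj]; first by rewrite mulr_ge0 ?N_ge0.
      rewrite j0 andbT ltnS /=; apply: leq_trans (leq_trans _ hj); first exact: ltnW (ltn_expl j p1).
      by rewrite leq_pmulr.
    apply: le_trans (trunc_log_lnn_le R b p1); rewrite -(sum_trunc_log _ p1 (leqnn b)).
    apply: ler_sum_nat_sub => // j /andP[j0 _] hj.
    have pb : (p ^ j <= b)%N by apply: leq_trans hj; rewrite leq_pmulr.
    by rewrite j0 pb andbT ltnS /=; apply: leq_trans pb; exact: ltnW (ltn_expl j p1).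
  rewrite (sum_trunc_log _ p1) // mulrCA ler_wpM2l ?mulr_ge0 //; exact: trunc_log_lnn_le.
have NL := N_large U0 KU (ltnW hb6).
have ll : lnn (lam * b) = lnn lam + lnn b by rewrite lnnM.
have llam : 2^-1 <= lnn lam by apply: le_trans (lnn2_ge R) (lnn_le R l1).
have lX1 : 0 < lnn (lam * b) by rewrite ll; lra.
rewrite -(ler_pM2r lX1) WX.
apply: le_trans (lerD hI hII) _.
have key : Y%:R + 2 + lnn b + Y%:R * lnn b + Y%:R * (Y%:R * lnn (lam * b)) <= N b * lnn lam.
  rewrite ll.
  have y1 : 2 <= Y%:R :> R by rewrite ler_nat Y_gt1.
  have LL := L_ge1000.
  have UL : 1000 <= U%:R * L.
    have : 1 <= U%:R :> R by rewrite ler1n.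
    nra.
  move: NL lb UL y1 llam lb0; set v := U%:R * L.
  have -> : 9 * Y%:R ^+ 2 * U%:R * L = 9 * Y%:R ^+ 2 * v by rewrite /v; ring.
  set y := Y%:R; set l := lnn lam; set m := lnn b => NL lb UL y1 llam lb0.
  have s1 : 9 * y ^+ 2 * v * l <= N b * l by rewrite ler_wpM2r //; clear -NL lb UL y1 llam lb0 LL; lra.
  apply: le_trans s1.
  have e1 : y * m <= y ^+ 2 * v by rewrite expr2 -mulrA; apply: ler_pM => //; clear -y1 lb UL lb0; nra.
  have e2 : y * (y * m) <= y ^+ 2 * v by rewrite mulrA -expr2 ler_wpM2l // exprn_ge0.
  have e3 : y + 2 + m <= y ^+ 2 * v.
    apply: le_trans (_ : y * v <= _); last by rewrite expr2 -mulrA ler_peMl // ?mulr_ge0 //; clear -NL lb UL y1 llam lb0 LL; lra.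
    clear -y1 lb UL lb0; nra.
  have e4 : y * (y * l) <= y ^+ 2 * v * l.
    by rewrite mulrA -expr2 ler_wpM2r //; [(clear -NL lb UL y1 llam lb0 LL; lra)|rewrite ler_peMr ?exprn_ge0 //; (clear -NL lb UL y1 llam lb0; lra)].
  have e5 : 3 * (y ^+ 2 * v) <= 6 * (y ^+ 2 * v) * l.
    have yv : 0 <= y ^+ 2 * v by rewrite mulr_ge0 ?exprn_ge0 //; clear -NL lb UL y1 llam lb0 LL; lra.
    have -> : 6 * (y ^+ 2 * v) * l = 3 * (y ^+ 2 * v) * (2 * l) by ring.
    by rewrite ler_peMr //; clear -yv UL llam y1; lra.
  have e6 : 0 <= y ^+ 2 * v * l by rewrite !mulr_ge0 ?exprn_ge0 //; clear -NL lb UL y1 llam lb0 LL; lra.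
  have -> : y * (y * (l + m)) = y * (y * l) + y * (y * m) by ring.
  lra.
have key2 : C1 * lam%:R * (Y%:R + 2 + lnn b + Y%:R * lnn b + Y%:R * (Y%:R * lnn (lam * b))) <= C1 * lam%:R * (N b * lnn lam).
  by rewrite ler_wpM2l.
have key3 : lam%:R * (Y%:R + 2 + Y%:R * (Y%:R * lnn (lam * b))) <= C1 * lam%:R * (Y%:R + 2 + Y%:R * (Y%:R * lnn (lam * b))).
  rewrite ler_wpM2r ?ler_peMl //; first by rewrite !addr_ge0 ?mulr_ge0.
rewrite ll in key2 key3 *.
have -> : C1 * lam%:R * N b * (lnn lam + lnn b) = C1 * lam%:R * (N b * lnn lam) + C1 * lam%:R * (Ib + IIb).
  by rewrite -Wb; ring.
set c := C1 * lam%:R in key2 key3 *; lra.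
Qed.

(** * Comparison of [N t] with [N (t / M)] *)

Variable U : nat.
Hypothesis U0 : (0 < U)%N.
Notation C2 := (16 * C1).
Notation C3 := (2 * (8 * C1 + 1)).
Hypothesis KU : 9 * U%:R / lowc 6 <= K.
Hypothesis KU2 : 8 * C2 * U%:R <= K.

Lemma D_gt0 : (0 < D)%N. Proof. by apply: leq_trans D_ge. Qed.
Lemma Y_gt0 : (0 < Y)%N. Proof. by apply: ltnW; apply: Y_gt1. Qed.
Lemma L_gt0 : 0 < L. Proof. by have := L_ge1000; lra. Qed.
Lemma D2_leY : (D ^ 2 <= Y)%N.
Proof. by apply: leq_trans D8; rewrite leq_exp2l // (leq_trans _ D_ge). Qed.
Lemma YX_gt0 k : (0 < Y ^ k)%N. Proof. by rewrite expn_gt0 Y_gt0. Qed.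
Lemma YX_le k l : (k <= l)%N -> (Y ^ k <= Y ^ l)%N.
Proof. by move=> kl; rewrite leq_exp2l ?Y_gt1. Qed.
Lemma lnn_leX k t : (t <= Y ^ k)%N -> lnn t <= k%:R * L.
Proof. by move=> h; rewrite -lnnX ?lnn_le ?Y_gt0. Qed.
Lemma lnn_geX k t : (Y ^ k <= t)%N -> k%:R * L <= lnn t.
Proof. by move=> h; rewrite -lnnX ?lnn_le ?Y_gt0. Qed.
Lemma C1_gt0 : 0 < C1. Proof. by have := C1_ge1; lra. Qed.
Lemma C1_ge0 : 0 <= C1. Proof. exact: ltW C1_gt0. Qed.

Lemma div_geX k l t p : (Y ^ (k + l) <= t)%N -> (0 < p <= Y ^ k)%N -> (Y ^ l <= t %/ p)%N.
Proof.
move=> ht /andP[p0 pY]; rewrite leq_divRL //; apply: leq_trans ht.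
by rewrite addnC expnD leq_mul2l pY orbT.
Qed.

Lemma N_ratio a b : (D ^ 2 <= b)%N -> (b <= a)%N -> (b <= Y ^ U)%N ->
  b%:R * N a <= 2 * C1 * a%:R * N b.
Proof.
move=> Db ba bU; have b0 : (0 < b)%N by apply: leq_trans Db; rewrite expn_gt0 D_gt0.
have b0' : 0 < b%:R :> R by rewrite ltr0n.
have h1 : N a <= C1 * (a %/ b).+1%:R * N b.
  apply: le_trans (N_mul KU U0 _ _); rewrite ?Db //.
  by apply: N_le; apply: ltnW; apply: ltn_ceil.
have h2 : b%:R * (a %/ b).+1%:R <= 2 * a%:R :> R.
  rewrite -natrM -[2]/(2%:R) -natrM ler_nat mulnS mulnC.
  have := leq_trunc_div a b; clear -ba; move: (_ %/ _ * _)%N => u; lia.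
have n0 := N_ge0 R Y q b; have c0 := C1_gt0.
apply: le_trans (_ : b%:R * (C1 * (a %/ b).+1%:R * N b) <= _); first by rewrite ler_wpM2l.
have -> : b%:R * (C1 * (a %/ b).+1%:R * N b) = b%:R * (a %/ b).+1%:R * (C1 * N b) by ring.
have -> : 2 * C1 * a%:R * N b = 2 * a%:R * (C1 * N b) by ring.
by rewrite ler_wpM2r // mulr_ge0 // ltW.
Qed.

Lemma N_ratio_div t w p : (0 < w <= p)%N -> (Y ^ 3 <= t)%N -> (t <= Y ^ U)%N -> (p <= Y)%N ->
  w%:R * N (t %/ w) <= 4 * C1 * p%:R * N (t %/ p).
Proof.
move=> /andP[w0 wp] Yt tU pY; have p0 := leq_trans w0 wp.
have w0' : 0 < w%:R :> R by rewrite ltr0n.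
have p0' : 0 < p%:R :> R by rewrite ltr0n.
have tp : (Y ^ 2 <= t %/ p)%N by apply: (@div_geX 1 2) => //; rewrite p0 expn1.
have tp0 : (0 < t %/ p)%N by apply: leq_trans tp; apply: YX_gt0.
have h := @N_ratio (t %/ w) (t %/ p).
have {}h : (t %/ p)%:R * N (t %/ w) <= 2 * C1 * (t %/ w)%:R * N (t %/ p).
  apply: h; first by apply: leq_trans tp; apply: leq_trans D2_leY _; rewrite -[leqLHS]expn1 YX_le.
    by apply: leq_div2l.
  by apply: leq_trans tU; apply: leq_div.
have t0 : (0 < t)%N by apply: leq_trans (leq_div t p).
have t0' : 0 < t%:R :> R by rewrite ltr0n.
have h1 : t%:R / (2 * p%:R) <= (t %/ p)%:R :> R by apply: trunc_div_ge_half; rewrite p0 -divn_gt0.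
have h2 := trunc_div_le t w0.
have Na := N_ge0 R Y q (t %/ w); have Nb := N_ge0 R Y q (t %/ p); have c0 := C1_gt0.
have h3 : t%:R / (2 * p%:R) * N (t %/ w) <= 2 * C1 * (t%:R / w%:R) * N (t %/ p).
  apply: le_trans (ler_wpM2r Na h1) _; apply: le_trans h _.
  by rewrite ler_wpM2r // ler_wpM2l //; lra.
have e0 : 0 <= 2 * p%:R * w%:R / t%:R :> R by rewrite !mulr_ge0 ?invr_ge0 ?ltW.
have := ler_wpM2l e0 h3.
have -> : 2 * p%:R * w%:R / t%:R * (t%:R / (2 * p%:R) * N (t %/ w)) = w%:R * N (t %/ w).
  by field; rewrite !gt_eqF.
have -> // : 2 * p%:R * w%:R / t%:R * (2 * C1 * (t%:R / w%:R) * N (t %/ p)) = 4 * C1 * p%:R * N (t %/ p).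
by field; rewrite !gt_eqF.
Qed.

(** By [N_ratio_div] each prime [p] between about [sqrt Y] and [Y] has [p * N (t / p)] at least of
    order [w * N (t / w)]. The average over these [p] with weights [lnn p / p], of sum at least
    [L / 4], is bounded by the walk identity. *)
Lemma N_div_upper t w : (0 < w)%N -> (w ^ 2 <= Y)%N -> (Y ^ 3 <= t)%N -> (t <= Y ^ U)%N ->
  w%:R * N (t %/ w) * L <= C2 * (N t * lnn t).
Proof.
move=> w0 wY Yt tU.
have t0 : (0 < t)%N by apply: leq_trans Yt; apply: YX_gt0.
(* Just above [sqrt Y]: [a ^ 2 = D.+1 ^ 8 > Y >= w ^ 2], so that [w < a]. *)
pose a := (D.+1 ^ 4)%N.
have discr : (D.+1 <= D ^ 2)%N by rewrite expnS expn1; have := D_ge; have : (2 <= 2 ^ 20)%N by []; clear; nia.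
have aY : (a <= Y)%N.
  by apply: leq_trans D8; rewrite (expnM D 2 4) leq_exp2r.
have Ya : (Y < a ^ 2)%N by rewrite -expnM; have /andP[] := rootnP 7 Y.
have wa : (w < a)%N by rewrite -(ltn_exp2r _ _ (isT : 0 < 2)%N); apply: leq_ltn_trans Ya.
have Da : (D <= a)%N by rewrite /a expnS; apply: leq_trans (leqnSn D) _; rewrite leq_pmulr // expn_gt0.
have la : lnn a <= L / 2 + 4.
  rewrite /a lnnX //; have h := lnnS_sub_le R D_gt0; have h2 := lnD_le.
  have : D%:R^-1 <= 1 :> R by rewrite invf_le1 ?ltr0n ?ler1n ?D_gt0.
  lra.
have h1 := @prime_window_ge a Y; rewrite Da aY in h1; have {}h1 := h1 isT.
have L1 := L_ge1000.
have h2 : L / 4 <= \sum_(a.+1 <= p < Y.+1 | pr q p) lnn p / p%:R by lra.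
have h3 := @N_ln_ge R Y q t (fun p => (a < p)%N) t0.
have x0 : 0 <= w%:R * N (t %/ w) by rewrite mulr_ge0 ?N_ge0.
have h4 : w%:R * N (t %/ w) * (L / 4) <= 4 * C1 * (N t * lnn t).
  apply: le_trans (ler_wpM2l x0 h2) _.
  apply: le_trans (ler_wpM2l _ h3); last by rewrite mulr_ge0 // ltW // C1_gt0.
  move: x0; set x := w%:R * N (t %/ w) => x0; rewrite !mulr_sumr.
  apply: le_trans (_ : \sum_(a.+1 <= p < Y.+1 | pr q p) 4 * C1 * (lnn p * N (t %/ p)) <= _).
    rewrite [leLHS]big_nat_cond [leRHS]big_nat_cond; apply: ler_sum => p /andP[/andP[ap pY] _].
    have p0 : 0 < p%:R :> R by rewrite ltr0n; apply: leq_trans ap.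
    have h := @N_ratio_div t w p; rewrite w0 (ltnW (ltn_trans wa ap)) in h.
    have {}h := h isT Yt tU pY; rewrite -/x in h.
    have -> : x * (lnn p / p%:R) = lnn p / p%:R * x by ring.
    have -> : 4 * C1 * (lnn p * N (t %/ p)) = lnn p / p%:R * (4 * C1 * p%:R * N (t %/ p)) by field; rewrite gt_eqF.
    by rewrite ler_wpM2l // divr_ge0 ?lnn_ge0 // ltW.
  apply: ler_sum_nat_sub => [p|p /andP[ap pY] hp].
    by rewrite !mulr_ge0 ?N_ge0 ?lnn_ge0 ?C1_ge0.
  by rewrite pY hp ap !andbT; apply: leq_trans ap.
lra.
Qed.

(** The integral in the walk identity is at most [3/8] of [N t * lnn t]: below [t / w] the count is
    much smaller than [N t], and above it the logarithmic length is about [L / 2], while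
    [lnn t >= 4 * L]. The prime powers up to [Y] are compared with [Y] by [N_ratio_div]. *)
Lemma N_div_lower t : (Y ^ 4 <= t)%N -> (t <= Y ^ U)%N ->
  N t * lnn t <= C3 * (Y%:R * N (t %/ Y) * L).
Proof.
move=> Yt tU.
have t0 : (0 < t)%N by apply: leq_trans Yt; apply: YX_gt0.
have Y3t : (Y ^ 3 <= t)%N by apply: leq_trans Yt; apply: YX_le.
have W : N t * lnn t = _ := N_walk R Y 1%g t0.
have ltL := lnn_geX Yt; have ltU := lnn_leX tU; have L1 := L_ge1000.
have Nt := N_ge0 R Y q t; have lt0 := lnn_ge0 R t.
pose w := (D ^ 4)%N.
have w0 : (0 < w)%N by rewrite expn_gt0 D_gt0.
have wY : (w ^ 2 <= Y)%N by rewrite -expnM D8.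
have wt : (w <= t)%N.
  by apply: leq_trans (leq_trans (leq_trans _ wY) _) Yt; [rewrite leq_pmulr|rewrite -[leqLHS]expn1 YX_le].
have c1 := C1_gt0; have L0 := L_gt0.
have dw0 : (0 < t %/ w)%N by rewrite divn_gt0.
have hI : \sum_(1 <= s < t) N s * (lnn s.+1 - lnn s) <= 3/8 * (N t * lnn t).
  rewrite (big_cat_nat (n := (t %/ w)%N)) //=; last exact: leq_div.
  have i1 : \sum_(1 <= s < t %/ w) N s * (lnn s.+1 - lnn s) <= 1/8 * (N t * lnn t).
    apply: le_trans (_ : N (t %/ w) * lnn t <= _).
      apply: le_trans (_ : \sum_(1 <= s < t %/ w) N (t %/ w) * (lnn s.+1 - lnn s) <= _).
        apply: ler_sum_nat => s /andP[_ hs]; rewrite ler_wpM2r ?lnnS_sub_ge0 //.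
        by apply: N_le; apply: ltnW.
      rewrite -mulr_sumr sum_lnnS // lnn1 subr0 ler_wpM2l ?N_ge0 // lnn_le //; exact: leq_div.
    have h := N_div_upper w0 wY Y3t tU.
    have w8 : 8 * C2 * U%:R <= w%:R.
      apply: le_trans KU2 (le_trans K_D _); rewrite ler_nat /w.
      by rewrite expnS leq_pmulr // expn_gt0 D_gt0.
    have x0 : 0 <= N (t %/ w) by apply: N_ge0.
    rewrite mulrA ler_wpM2r //.
    have h2 : w%:R * N (t %/ w) * L <= C2 * N t * U%:R * L.
      apply: le_trans h _; rewrite -[C2 * N t * _ * _]mulrA -[C2 * N t * _]mulrA ler_wpM2l ?ler_wpM2l //; lra.
    rewrite ler_pM2r // in h2.
    have h3 : 8 * C2 * U%:R * N (t %/ w) <= C2 * N t * U%:R.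
      by apply: le_trans h2; rewrite ler_wpM2r.
    have cu : 0 < C2 * U%:R by rewrite mulr_gt0 ?ltr0n //; lra.
    have : C2 * U%:R * (8 * N (t %/ w)) <= C2 * U%:R * N t by lra.
    rewrite ler_pM2l //; lra.
  have i2 : \sum_(t %/ w <= s < t) N s * (lnn s.+1 - lnn s) <= 1/4 * (N t * lnn t).
    apply: le_trans (_ : \sum_(t %/ w <= s < t) N t * (lnn s.+1 - lnn s) <= _).
      apply: ler_sum_nat => s /andP[_ hs]; rewrite ler_wpM2r ?lnnS_sub_ge0 //.
      by apply: N_le; apply: ltnW.
    rewrite -mulr_sumr sum_lnnS ?leq_div // mulrCA ler_wpM2l //.
    have h : lnn t <= lnn 2 + lnn w + lnn (t %/ w).
      have d2 : (0 < 2 * w)%N by rewrite muln_gt0 w0.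
      rewrite -(lnnM R _ w0) // -(lnnM R d2 dw0); apply: lnn_le.
      by apply: leq_trans (ltnW (ltn_ceil t w0)) _; rewrite mulSn mulnC -mulnA mul2n -addnn leq_add2r leq_pmulr.
    have h2 := lnn2_le R; have h3 : lnn w <= L / 2.
      rewrite /w lnnX ?D_gt0 //; have := lnD_le; lra.
    lra.
  lra.
have hII : \sum_(1 <= p < Y.+1 | pr q p) \sum_(1 <= j < t.+1) lnn p * N (t %/ p ^ j)
   <= (8 * C1 + 1) * (Y%:R * N (t %/ Y) * L).
  set x := Y%:R * N (t %/ Y).
  have x0 : 0 <= x by rewrite mulr_ge0 ?N_ge0.
  apply: le_trans (_ : \sum_(1 <= p < Y.+1 | pr q p) (\sum_(1 <= j < t.+1) 4 * C1 * x * (lnn p / (p ^ j)%:R) + N (t %/ Y) * lnn t) <= _).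
    rewrite [leLHS]big_nat_cond [leRHS]big_nat_cond; apply: ler_sum => p /andP[/andP[p0 pY] prp].
    have p1 : (1 < p)%N by apply: prime_gt1; case/andP: prp.
    have pj0 j : (0 < p ^ j)%N by rewrite expn_gt0 p0.
    have lp := lnn_ge0 R p.
    apply: le_trans (_ : \sum_(1 <= j < t.+1) (4 * C1 * x * (lnn p / (p ^ j)%:R) + (if (p ^ j <= t)%N then N (t %/ Y) * lnn p else 0)) <= _).
      apply: ler_sum_nat => j /andP[j0 _].
      have pj0' : 0 < (p ^ j)%:R :> R by rewrite ltr0n.
      case: (leqP (p ^ j) Y) => hj.
        apply: ler_wpDr; first by case: ifP => // _; rewrite mulr_ge0 ?N_ge0.
        have h := @N_ratio_div t (p ^ j) Y; rewrite pj0 hj in h.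
        have {}h := h isT Y3t tU (leqnn _).
        have -> : 4 * C1 * x * (lnn p / (p ^ j)%:R) = lnn p / (p ^ j)%:R * (4 * C1 * x) by ring.
        have -> : lnn p * N (t %/ p ^ j) = lnn p / (p ^ j)%:R * ((p ^ j)%:R * N (t %/ p ^ j)) by field; rewrite gt_eqF.
        by rewrite ler_wpM2l ?divr_ge0 // /x mulrA.
      apply: ler_wpDl; first by rewrite !mulr_ge0 ?invr_ge0 ?N_ge0 ?C1_ge0.
      case: ifP => hj2; last by rewrite divn_small ?N0 ?mulr0 // ltnNge hj2.
      rewrite mulrC ler_wpM2r //; apply: N_le; apply: leq_div2l => //; [exact: Y_gt0|exact: ltnW].
    rewrite big_split /= lerD2l -big_mkcond -mulr_sumr ler_wpM2l ?N_ge0 //.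
    by rewrite sum_trunc_log // trunc_log_lnn_le.
  rewrite big_split /=; under eq_bigr do rewrite -mulr_sumr.
  rewrite -mulr_sumr.
  have j1 : \sum_(1 <= p < Y.+1 | pr q p) \sum_(1 <= j < t.+1) lnn p / (p ^ j)%:R <= 2 * L.
    apply: le_trans (_ : \sum_(1 <= p < Y.+1 | prime p) \sum_(1 <= j < t.+1) lnn p / (p ^ j)%:R <= _).
      by apply: ler_sum_nat_sub => [p|p -> /andP[->]//]; apply: sumr_ge0 => j _; rewrite divr_ge0 ?lnn_ge0.
    apply: le_trans (prime_power_sum_le R t Y_gt0) _; have := mertens_le R Y_gt0; lra.
  have j2 : \sum_(1 <= p < Y.+1 | pr q p) N (t %/ Y) * lnn t <= x * L.
    apply: le_trans (_ : \sum_(1 <= p < Y.+1 | prime p) N (t %/ Y) * lnn t <= _).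
      by apply: ler_sum_nat_sub => [p|p -> /andP[->]//]; rewrite mulr_ge0 ?N_ge0.
    have h := prime_count_le R Y.
    have -> : \sum_(1 <= p < Y.+1 | prime p) N (t %/ Y) * lnn t = (\sum_(1 <= p < Y.+1 | prime p) 1) * (N (t %/ Y) * lnn t).
      by rewrite mulr_suml; apply: eq_bigr => p _; rewrite mul1r.
    set pi := \sum_(1 <= p < Y.+1 | prime p) 1 in h *.
    have pi0 : 0 <= pi by apply: sumr_ge0.
    apply: le_trans (_ : pi * (N (t %/ Y) * (U%:R * L)) <= _).
      by rewrite ler_wpM2l // ler_wpM2l ?N_ge0.
    have -> : pi * (N (t %/ Y) * (U%:R * L)) = pi * L * (N (t %/ Y) * U%:R) by ring.
    apply: le_trans (_ : 10 * Y%:R * (N (t %/ Y) * U%:R) <= _).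
      by rewrite ler_wpM2r // mulr_ge0 ?N_ge0.
    have -> : 10 * Y%:R * (N (t %/ Y) * U%:R) = x * (10 * U%:R) by rewrite /x; ring.
    rewrite ler_wpM2l //; apply: le_trans KL; apply: le_trans KU2.
    by have c11 := C1_ge1; rewrite ler_wpM2r //; lra.
  have : 4 * C1 * x * (\sum_(1 <= p < Y.+1 | pr q p) \sum_(1 <= j < t.+1) lnn p / (p ^ j)%:R) <= 4 * C1 * x * (2 * L).
    by rewrite ler_wpM2l // !mulr_ge0 ?C1_ge0 ?N_ge0.
  lra.
have z0 : 0 <= (8 * C1 + 1) * (Y%:R * N (t %/ Y) * L).
  by rewrite mulr_ge0 ?mulr_ge0 ?N_ge0 ?(ltW L0) //; lra.
lra.
Qed.

Lemma lnn_div_half t k : (Y ^ (2 * k + 1) <= t)%N -> lnn t <= 2 * lnn (t %/ Y ^ k).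
Proof.
move=> ht; have t0 : (0 < t)%N by apply: leq_trans ht; apply: YX_gt0.
have Yk0 := YX_gt0 k.
have d0 : (0 < t %/ Y ^ k)%N.
  by rewrite divn_gt0 //; apply: leq_trans ht; apply: YX_le; clear; lia.
have h : lnn t <= lnn 2 + lnn (Y ^ k) + lnn (t %/ Y ^ k).
  rewrite -!lnnM ?muln_gt0 //; apply: lnn_le.
  apply: leq_trans (ltnW (ltn_ceil t Yk0)) _; move: d0; clear; move: (t %/ Y ^ k)%N (Y ^ k)%N => a b; nia.
have := lnn_geX ht; rewrite lnnX ?Y_gt0 // in h; have h2 := lnn2_le R; have := L_ge1000.
rewrite natrD natrM; move: h; set z := k%:R * L; have -> : (2 * k%:R + 1) * L = 2 * z + L by rewrite /z; ring.
lra.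
Qed.

Lemma N_divX_lower t k : (Y ^ (2 * k + 4) <= t)%N -> (t <= Y ^ U)%N ->
  N t * lnn t ^+ k <= (2 * C3) ^+ k * ((Y ^ k)%:R * N (t %/ Y ^ k) * L ^+ k).
Proof.
move=> + tU; elim: k => [|k IH] ht.
  by rewrite !expr0 expn0 divn1 !mulr1 !mul1r.
have {}IH := IH (leq_trans (YX_le _) ht).
have c1 := C1_gt0; have L0 := L_gt0.
rewrite [lnn t ^+ _]exprS; have lt0 := lnn_ge0 R t.
have := ler_wpM2l lt0 (IH _); rewrite leq_add2r leq_mul2l leqnSn orbT => /(_ isT) h.
have -> : N t * (lnn t * lnn t ^+ k) = lnn t * (N t * lnn t ^+ k) by ring.
apply: le_trans h _; set A := (2 * C3) ^+ k.
have A0 : 0 <= A by rewrite exprn_ge0 //; lra.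
have h2 : lnn t <= 2 * lnn (t %/ Y ^ k).
  by apply: lnn_div_half; apply: leq_trans (YX_le _) ht; clear; lia.
have h3 := @N_div_lower (t %/ Y ^ k).
have {}h3 : N (t %/ Y ^ k) * lnn (t %/ Y ^ k) <= C3 * (Y%:R * N (t %/ Y ^ k %/ Y) * L).
  apply: h3; last by apply: leq_trans tU; apply: leq_div.
  apply: (@div_geX k 4); last by rewrite YX_gt0 leqnn.
  by apply: leq_trans (YX_le _) ht; clear; lia.
rewrite -divnMA -expnSr in h3.
have Yk : 0 <= (Y ^ k)%:R * L ^+ k * A :> R by rewrite !mulr_ge0 // exprn_ge0 // ltW.
have Nk := N_ge0 R Y q (t %/ Y ^ k).
have -> : lnn t * (A * ((Y ^ k)%:R * N (t %/ Y ^ k) * L ^+ k)) = (Y ^ k)%:R * L ^+ k * A * (N (t %/ Y ^ k) * lnn t) by ring.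
have -> : (2 * C3) ^+ k.+1 * ((Y ^ k.+1)%:R * N (t %/ Y ^ k.+1) * L ^+ k.+1) =
  (Y ^ k)%:R * L ^+ k * A * (2 * (C3 * (Y%:R * N (t %/ Y ^ k.+1) * L))).
  by rewrite /A !exprS expnS natrM; ring.
rewrite ler_wpM2l //; apply: le_trans (_ : N (t %/ Y ^ k) * (2 * lnn (t %/ Y ^ k)) <= _).
  by rewrite ler_wpM2l.
move: h3; lra.
Qed.

Definition C4 k : R := 2 * C2 * (2 * C3) ^+ k.+1.

(** [Y ^ k.+1] and [M] differ by a factor about [w] with [w ^ 2 <= Y], so [N_divX_lower] at
    [Y ^ k.+1] is followed by [N_div_upper] at [w]. The latter gives back one power of [lnn t / L],
    leaving [k] powers for a product of [k.+1] primes. *)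
Lemma N_div_share t k M : (Y ^ (2 * k + 6) <= t)%N -> (t <= Y ^ U)%N -> (0 < M <= Y ^ k.+1)%N ->
  ((Y ^ k.+1) ^ 2 <= M ^ 2 * Y)%N ->
  N t * lnn t ^+ k <= C4 k * L ^+ k * (M%:R * N (t %/ M)).
Proof.
move=> ht tU /andP[M0 MY] MY2.
have ht' : (Y ^ (2 * k.+1 + 4) <= t)%N by apply: leq_trans (YX_le _) ht; clear; lia.
have h := N_divX_lower ht' tU.
have t0 : (0 < t)%N by apply: leq_trans ht; apply: YX_gt0.
have t1 : (1 < t)%N by apply: leq_trans ht; rewrite -(expn0 Y) ltn_exp2l ?Y_gt1 // addn_gt0 orbT.
pose w := (Y ^ k.+1 %/ M)%N.
have w0 : (0 < w)%N by rewrite divn_gt0.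
have wM : (w * M <= Y ^ k.+1)%N by apply: leq_trunc_div.
have wY : (w ^ 2 <= Y)%N.
  have M20 : (0 < M ^ 2)%N by rewrite expn_gt0 M0.
  rewrite -(leq_pmul2l M20); apply: leq_trans MY2.
  by rewrite mulnC -expnMn leq_exp2r.
have Yw : (Y ^ k.+1 <= 2 * (M * w))%N.
  have := ltn_ceil (Y ^ k.+1) M0; rewrite -/w; move: w0 M0; clear; move: (Y ^ k.+1)%N => z; nia.
have h2 := @N_div_upper (t %/ M) w w0 wY.
have {}h2 : w%:R * N (t %/ M %/ w) * L <= C2 * (N (t %/ M) * lnn (t %/ M)).
  apply: h2; last by apply: leq_trans tU; apply: leq_div.
  by apply: (@div_geX k.+1 3); rewrite ?M0 //; apply: leq_trans (YX_le _) ht; clear; lia.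
rewrite -divnMA in h2.
have c1 := C1_gt0; have L0 := L_gt0; have Mn : 0 <= M%:R :> R by [].
have h3 : (Y ^ k.+1)%:R * N (t %/ Y ^ k.+1) * L <= 2 * M%:R * (C2 * (N (t %/ M) * lnn t)).
  apply: le_trans (_ : 2 * M%:R * (w%:R * N (t %/ (M * w)) * L) <= _); last first.
    rewrite ler_wpM2l ?mulr_ge0 //; apply: le_trans h2 _; rewrite !ler_wpM2l ?N_ge0 //; first by lra.
    by apply: lnn_le; apply: leq_div.
  have -> : 2 * M%:R * (w%:R * N (t %/ (M * w)) * L) = (2 * (M * w))%:R * N (t %/ (M * w)) * L.
    by rewrite !natrM; ring.
  rewrite ler_wpM2r ?(ltW L0) //; apply: ler_pM => //; rewrite ?N_ge0 // ?ler_nat //.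
  by apply: N_le; apply: leq_div2l; rewrite ?muln_gt0 ?M0 // mulnC.
have lt0 : 0 < lnn t by apply: lnn_gt0.
rewrite -(ler_pM2r lt0).
have -> : N t * lnn t ^+ k * lnn t = N t * lnn t ^+ k.+1 by rewrite exprSr mulrA.
apply: le_trans h _.
have -> : (2 * C3) ^+ k.+1 * ((Y ^ k.+1)%:R * N (t %/ Y ^ k.+1) * L ^+ k.+1) =
  (2 * C3) ^+ k.+1 * L ^+ k * ((Y ^ k.+1)%:R * N (t %/ Y ^ k.+1) * L) by rewrite (exprS L); ring.
have -> : C4 k * L ^+ k * (M%:R * N (t %/ M)) * lnn t = (2 * C3) ^+ k.+1 * L ^+ k * (2 * M%:R * (C2 * (N (t %/ M) * lnn t))).
  by rewrite /C4; ring.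
rewrite ler_wpM2l // mulr_ge0 ?exprn_ge0 //; lra.
Qed.

Notation kk := B.+4.
Notation ee := (2 * B + 7)%N.
Notation cls := (cls q).
Notation gT := {unit 'Z_q}.
Notation phi := (totient q)%:R.

(** * Products of large primes and the set of correlated classes *)

(* The window is ]Y^(1 - 1/(2B+8)), Y], so that a product of [B.+4] of its primes
   exceeds Y^(B+3) and the bins below are much longer than [q]. *)
Definition awin := rootn ee (Y ^ ee).
Definition win p := pr q p && (awin < p)%N.

Lemma awinP : (awin ^ ee.+1 <= Y ^ ee < awin.+1 ^ ee.+1)%N.
Proof. exact: rootnP. Qed.

Lemma D_awin : (D <= awin)%N.
Proof.
apply: rootn_ge; have -> : ee.+1 = (2 * kk)%N by lia.
rewrite expnM; apply: leq_trans (_ : Y ^ kk <= _)%N; first by rewrite leq_exp2r // D2_leY.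
by apply: YX_le; lia.
Qed.

Lemma awin_Y : (awin <= Y)%N.
Proof.
rewrite -(leq_exp2r _ _ (isT : 0 < ee.+1)%N); apply: leq_trans (_ : Y ^ ee <= _)%N.
  by have /andP[] := awinP.
exact: YX_le.
Qed.

Lemma win_gt p : win p -> (Y ^ ee <= p ^ ee.+1)%N.
Proof.
move=> /andP[_ h]; have /andP[_ h2] := awinP.
by apply: leq_trans (ltnW h2) _; rewrite leq_exp2r.
Qed.

Lemma L_k : 32 * kk%:R <= L.
Proof.
apply: le_trans KL; apply: le_trans K0.
have b0 : 0 <= B%:R :> R by [].
have -> : kk%:R = B%:R + 4 :> R by rewrite -addn4 natrD.
apply: le_trans (_ : 2 ^+ 7 * (B%:R + 1) <= _).
  have -> : 2 ^+ 7 = 128 :> R by rewrite -natrX.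
  lra.
by rewrite ler_wpM2r ?ler_eXn2l ?ltr1n //; lra.
Qed.

Lemma win_ln p : win p -> L / 2 <= lnn p.
Proof.
move=> wp; have p0 : (0 < p)%N by case/andP: wp => _; case: (p).
have := lnn_le R (win_gt wp); rewrite !lnnX ?Y_gt0 //.
have L0 := L_gt0; have e7 : 7 <= ee%:R :> R by rewrite ler_nat; lia.
rewrite -natr1; have := lnn_ge0 R p; move: (ee%:R : R) e7 (lnn p) => x h y y0 H.
rewrite ler_pdivrMr //; rewrite -(ler_pM2l (_ : 0 < x + 1)); last by lra.
apply: le_trans (_ : 2 * (x * L) <= _); last by lra.
have -> : 2 * (x * L) = (2 * x) * L by ring.
by rewrite ler_wpM2r ?(ltW L0) //; lra.
Qed.

(** The window has logarithmic length at least [L / (2 * kk)], of which the Mertens error 8 takes at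
    most half, by [L_k]. *)
Lemma win_sum_ge : (4 * kk%:R)^-1 <= \sum_(1 <= p < Y.+1 | win p) p%:R^-1 :> R.
Proof.
have h := @prime_window_ge awin Y; rewrite D_awin awin_Y in h; have {}h := h isT.
have L0 := L_gt0; have Lk := L_k.
have k0 : 0 < kk%:R :> R by rewrite ltr0n.
have la : 2 * kk%:R * lnn awin <= (2 * kk%:R - 1) * L.
  have /andP[h1 _] := awinP; have := lnn_le R h1.
  have a0 : (0 < awin)%N by apply: leq_trans D_awin; apply: D_gt0.
  rewrite !lnnX ?Y_gt0 //.
  have -> : ee.+1%:R = 2 * kk%:R :> R by rewrite -[2]/(2%:R) -natrM; congr _%:R; lia.
  have -> // : ee%:R = 2 * kk%:R - 1 :> R.
  by rewrite -[2]/(2%:R) -natrM -(natrB R (_ : 1 <= 2 * kk)%N) //; congr _%:R; lia.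
have h2 : L * (4 * kk%:R)^-1 <= L - lnn awin - 8.
  rewrite ler_pdivrMr; last by lra.
  move: la Lk; set x := lnn awin; move: (kk%:R : R) k0 => z z0.
  move=> la Lk; have -> : (L - x - 8) * (4 * z) = 4 * z * L - 2 * (2 * z * x) - 32 * z by ring.
  lra.
rewrite -(ler_pM2l L0); apply: le_trans h2 _; apply: le_trans h _.
rewrite mulr_sumr; apply: le_trans (_ : \sum_(awin.+1 <= p < Y.+1 | pr q p) L * p%:R^-1 <= _).
  rewrite [leLHS]big_nat_cond [leRHS]big_nat_cond; apply: ler_sum => p /andP[/andP[_ pY] _].
  by rewrite ler_wpM2r ?invr_ge0 // lnn_le.
apply: ler_sum_nat_sub => [p|p /andP[h1 h3] h4]; first by rewrite divr_ge0 // ltW.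
by rewrite h3 /win h4 h1 !andbT; apply: leq_trans h1.
Qed.

Lemma win_sum_le : \sum_(1 <= p < Y.+1 | win p) p%:R^-1 <= 1 :> R.
Proof.
have a0 : (0 < awin)%N by apply: leq_trans D_awin; apply: D_gt0.
have h := mertens_window_le R a0 awin_Y.
have L0 := L_gt0; have Lk := L_k.
have k0 : 4 <= kk%:R :> R by rewrite ler_nat.
have la : (2 * kk%:R - 1) * L <= 2 * kk%:R * (lnn awin + 1).
  have /andP[_ h1] := awinP; have := lnn_le R (ltnW h1).
  rewrite !lnnX ?Y_gt0 //.
  have -> : ee.+1%:R = 2 * kk%:R :> R by rewrite -[2]/(2%:R) -natrM; congr _%:R; lia.
  have -> : ee%:R = 2 * kk%:R - 1 :> R.
    by rewrite -[2]/(2%:R) -natrM -(natrB R (_ : 1 <= 2 * kk)%N) //; congr _%:R; lia.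
  have hS : lnn awin.+1 <= lnn awin + 1.
    have := lnnS_sub_le R a0; have : awin%:R^-1 <= 1 :> R by rewrite invf_le1 ?ltr0n ?ler1n.
    lra.
  by move=> hh; apply: le_trans hh _; rewrite ler_wpM2l ?mulr_ge0.
have h2 : L - lnn awin + 7 <= L / 2.
  have L1 := L_ge1000; move: la; set x := lnn awin; move: (kk%:R : R) k0 => z z0.
  have -> : (2 * z - 1) * L = 2 * z * L - L by ring.
  move=> la; rewrite -(ler_pM2l (_ : 0 < 2 * z)); last by lra.
  have : 4 * L <= z * L by rewrite ler_wpM2r // ltW.
  have zL : z * 1000 <= z * L by rewrite ler_wpM2l //; lra.
  have -> : 2 * z * (L - x + 7) = 2 * z * L - 2 * z * (x + 1) + 16 * z by ring.
  have -> : 2 * z * (L / 2) = z * L by field.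
  lra.
have L2 : 0 < L / 2 by lra.
rewrite -(ler_pM2l L2) mulr1; apply: le_trans h2; apply: le_trans h.
rewrite mulr_sumr; apply: le_trans (_ : \sum_(1 <= p < Y.+1 | win p) lnn p * p%:R^-1 <= _).
  by apply: ler_sum => p wp; rewrite ler_wpM2r ?invr_ge0 // win_ln.
apply: ler_sum_nat_sub => [p|p /andP[h1 h3] /andP[/andP[h4 _] h5]]; first by rewrite divr_ge0 ?lnn_ge0.
by rewrite h3 h5.
Qed.

(* The number of ordered [i]-tuples of window primes with product [M]. *)
Fixpoint tuple_count i (M : nat) : R :=
  if i is i'.+1 then \sum_(1 <= p < Y.+1 | win p && (p %| M)%N) tuple_count i' (M %/ p)%N
  else (M == 1%N)%:R.

Lemma tuple_count_ge0 i M : 0 <= tuple_count i M.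
Proof. by elim: i M => [|i IH] M /=; [case: eqP|apply: sumr_ge0]. Qed.

Lemma win_pr p : win p -> pr q p. Proof. by case/andP. Qed.
Lemma win_gt0 p : win p -> (0 < p)%N. Proof. by move=> /andP[/andP[h _] _]; apply: prime_gt0. Qed.

Lemma win_rough p : win p -> (lep D)^'.-nat p.
Proof.
move=> /andP[/andP[pp _] ap]; rewrite pnatE // inE /= inE -ltnNge.
exact: leq_ltn_trans D_awin ap.
Qed.

Lemma tuple_count_supp i M : tuple_count i M != 0 ->
  [/\ (0 < M <= Y ^ i)%N, (lep D)^'.-nat M, coprime M q, (size (primes M) <= i)%N
    & ((Y ^ ee) ^ i <= M ^ ee.+1)%N].
Proof.
elim: i M => [|i IH] M /=.
  case: (M =P 1%N) => [-> _|_]; last by rewrite eqxx.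
  by rewrite !expn0 exp1n coprime1n.
move=> h; have [p [pY wp pM rM]] : exists p, [/\ (p <= Y)%N, win p, (p %| M)%N & tuple_count i (M %/ p)%N != 0].
  apply: contrapT => hn; move/eqP: h; apply; rewrite big_nat_cond big1 // => p.
  move=> /andP[/andP[_ pY] /andP[wp pM]]; apply/eqP; apply: contrapT => /negP hr.
  by apply: hn; exists p.
have [/andP[m0 mY] mD mq ms ml] := IH _ rM.
have p0 := win_gt0 wp; have eM : M = (p * (M %/ p))%N by rewrite mulnC divnK.
move: (M %/ p)%N eM m0 mY mD mq ms ml => m -> m0 mY mD mq ms ml {h rM pM M}.
split.
- by rewrite muln_gt0 p0 m0 expnS leq_mul.
- by rewrite pnatM win_rough.
- by rewrite coprimeMl mq andbT; case/andP: wp => /andP[].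
- apply: leq_trans (_ : size (p :: primes m) <= _)%N => //.
  apply: uniq_leq_size => [|r]; first exact: primes_uniq.
  rewrite primesM // inE => /orP[]; last by move=> ->; rewrite orbT.
  by rewrite primes_prime ?inE; [move=> ->|case/andP: wp => /andP[]].
- by rewrite [in leqLHS]expnS expnMn leq_mul // win_gt.
Qed.

(** The first prime of a tuple of length [i.+1] is one of at most [i.+1] prime divisors of [M]. *)
Lemma tuple_count_le i M : tuple_count i M <= i`!%:R.
Proof.
elim: i M => [|i IH] M; first by rewrite /=; case: eqP.
have [->|h] := eqVneq (tuple_count i.+1 M) 0; first by [].
have [/andP[M0 _] _ _ hs _] := tuple_count_supp h.
rewrite /=; apply: le_trans (_ : \sum_(1 <= p < Y.+1 | win p && (p %| M)%N) i`!%:R <= _); first exact: ler_sum.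
rewrite -big_filter big_const_seq count_predT iter_addr addr0 -[_ *+ size _]mulr_natr -natrM ler_nat.
rewrite mulnC factS leq_mul2r; apply/orP; right; apply: leq_trans hs.
apply: uniq_leq_size => [|p]; first by rewrite filter_uniq // iota_uniq.
rewrite mem_filter => /andP[/andP[/andP[/andP[pp _] _] pM] _].
by rewrite mem_primes pp M0.
Qed.

Definition tuple_sum i (f : nat -> R) : R := \sum_(1 <= M < (Y ^ i).+1) tuple_count i M * f M.

Lemma tuple_sum0 f : tuple_sum 0 f = f 1%N.
Proof. by rewrite /tuple_sum expn0 big_nat1 /= mul1r. Qed.

Lemma tuple_sumS i f : tuple_sum i.+1 f = \sum_(1 <= p < Y.+1 | win p) tuple_sum i (fun M => f (p * M)%N).
Proof.
rewrite /tuple_sum /=; under eq_bigr do rewrite mulr_suml big_mkcondr.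
rewrite exchange_big_nat /= [LHS]big_nat_cond [RHS]big_nat_cond.
apply: eq_bigr => p /andP[/andP[_ pY] wp].
have p0 := win_gt0 wp.
rewrite -big_mkcond sum_multiples //; have le : (Y ^ i <= Y ^ i.+1 %/ p)%N.
  by rewrite leq_divRL // expnS mulnC leq_mul.
rewrite (big_cat_nat (n := (Y ^ i).+1)) //= [X in _ + X]big_nat_cond [X in _ + X]big1; last first.
  move=> M /andP[/andP[hM _] _]; rewrite mulKn //.
  have [->|/tuple_count_supp[/andP[_]]] := eqVneq (tuple_count i M) 0; first by rewrite mul0r.
  by rewrite leqNgt hM.
by rewrite addr0; apply: eq_bigr => M _; rewrite mulKn.
Qed.

Lemma tuple_sum_le i f g : (forall M, tuple_count i M != 0 -> f M <= g M) -> tuple_sum i f <= tuple_sum i g.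
Proof.
move=> h; apply: ler_sum => M _; have [->|h'] := eqVneq (tuple_count i M) 0; first by rewrite !mul0r.
by rewrite ler_wpM2l ?tuple_count_ge0 ?h.
Qed.

Lemma tuple_sum_inv i : tuple_sum i (fun M => M%:R^-1) = (\sum_(1 <= p < Y.+1 | win p) p%:R^-1) ^+ i.
Proof.
elim: i => [|i IH]; first by rewrite tuple_sum0 invr1 expr0.
rewrite tuple_sumS exprS -IH mulr_suml; apply: eq_bigr => p _.
by rewrite /tuple_sum mulr_sumr; apply: eq_bigr => M _; rewrite natrM invfM mulrCA.
Qed.

Arguments tuple_count : simpl never.
(* The products are grouped in bins [e^(T/Y), e^((T+1)/Y)[, on which counting
   functions at [t / M] are constant up to a relative error O(1/Y). *)
Definition bin M := Num.truncn (Y%:R * lnn M).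
Definition W T : R := expR (T%:R / Y%:R).
Definition bin_count T (g : gT) : R := \sum_(1 <= M < (Y ^ kk).+1 | (bin M == T) && (cls M == g)) tuple_count kk M.
Notation Z := (bin (Y ^ kk)).+1.

Lemma W_gt0 T : 0 < W T. Proof. exact: expR_gt0. Qed.

Lemma Y_gt0r : 0 < Y%:R :> R. Proof. by rewrite ltr0n Y_gt0. Qed.

Lemma WS T : W T.+1 <= W T * (1 + 2 / Y%:R).
Proof.
have Y0 := Y_gt0r; have Y2 : 2 <= Y%:R :> R by rewrite ler_nat Y_gt1.
rewrite /W -natr1 mulrDl expRD ler_wpM2l ?expR_ge0 // mul1r.
have h := expR_ge1Dx (- Y%:R^-1 : R); rewrite expRN in h.
have e0 := expR_gt0 (Y%:R^-1 : R).
have i0 : 0 < Y%:R^-1 :> R by rewrite invr_gt0.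
have i1 : Y%:R^-1 <= 2^-1 :> R by rewrite lef_pV2 ?posrE.
set x := expR _ in h e0 *; set y := Y%:R^-1 in h i0 i1 *.
have h2 : x * (1 - y) <= 1.
  by have := ler_wpM2l (ltW e0) h; rewrite mulfV ?gt_eqF.
rewrite -(ler_pM2r (_ : 0 < 1 - y)); last by lra.
apply: le_trans h2 _; nra.
Qed.

Lemma bin_W M : (0 < M)%N -> W (bin M) <= M%:R <= W (bin M) * (1 + 2 / Y%:R).
Proof.
move=> M0; have Y0 := Y_gt0r.
have M0' : 0 < M%:R :> R by rewrite ltr0n.
have x0 : 0 <= Y%:R * lnn M by rewrite mulr_ge0 ?lnn_ge0.
have /andP[h1 h2] := truncn_itv x0.
have eM : M%:R = expR (lnn M) by rewrite lnK ?posrE.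
apply/andP; split.
  by rewrite eM /W ler_expR ler_pdivrMr // mulrC.
apply: le_trans (WS _); rewrite eM /W ler_expR ler_pdivlMr // mulrC; exact: ltW.
Qed.

Lemma bin_W2 M : (0 < M)%N -> M%:R <= 2 * W (bin M).
Proof.
move=> M0; have /andP[_ h] := bin_W M0; apply: le_trans h _.
have Y2 : 2 <= Y%:R :> R by rewrite ler_nat Y_gt1.
rewrite mulrC ler_wpM2r ?(ltW (W_gt0 _)) //.
have : 2 / Y%:R <= 1 :> R by rewrite ler_pdivrMr ?Y_gt0r // mul1r.
lra.
Qed.

Lemma bin_le M : (0 < M <= Y ^ kk)%N -> (bin M < Z)%N.
Proof.
move=> /andP[M0 MY]; rewrite ltnS; apply: le_truncn.
by rewrite ler_wpM2l // lnn_le.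
Qed.

Lemma bin_count_ge0 T g : 0 <= bin_count T g.
Proof. by apply: sumr_ge0 => M _; apply: tuple_count_ge0. Qed.

Lemma phi_gt0 : 0 < phi :> R.
Proof. by rewrite ltr0n totient_gt0 ltnW. Qed.

Lemma phi_leY : phi <= Y%:R ^+ B :> R.
Proof.
rewrite -natrX ler_nat; apply: leq_trans qY.
rewrite -(card_unit q1) cardsT; apply: leq_trans (max_card _) _ => //.
by rewrite card_sub; apply: leq_trans (max_card _) _; rewrite card_ord Zp_cast.
Qed.

Lemma S_phi : phi * lnn D <= q%:R * S.
Proof.
have h := @hsum_coprime_ge R q D (ltnW q1).
have q0 : 0 < q%:R :> R by rewrite ltr0n ltnW.
rewrite -ler_pdivrMl //; apply: le_trans h.
by rewrite mulrA [_ * phi]mulrC.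
Qed.

Lemma supp_big M : tuple_count kk M != 0 -> Y%:R ^+ (B + 3) <= M%:R :> R.
Proof.
move=> /tuple_count_supp[/andP[M0 _] _ _ _ h].
rewrite -natrX ler_nat -(leq_exp2r _ _ (isT : 0 < ee.+1)%N); apply: leq_trans h.
rewrite -!expnM; apply: YX_le; nia.
Qed.

Notation kap := (4 * kk`!%:R / (Y%:R * lnn D) : R).

(** All prime factors of [M] exceed [D], so [M] is [D]-rough and the sieve applies to the interval
    of the bin, of length at least [Y ^ (B + 2)] against [q <= Y ^ B]. The factorial of [kk] bounds
    the multiplicity of each [M]. *)
Lemma bin_count_sieve T g : bin_count T g <= kap * (W T / phi).
Proof.
have lD := lnD_ge; have Y0 := Y_gt0r; have p0 := phi_gt0; have W0 := W_gt0 T.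
have [|] := pselect (exists M, [/\ tuple_count kk M != 0 & bin M = T]); last first.
  move=> hn; rewrite /bin_count big1; first by rewrite !mulr_ge0 ?invr_ge0 ?mulr_ge0 //; lra.
  move=> M /andP[/eqP h _]; apply/eqP; apply: contrapT => /negP h2.
  by apply: hn; exists M.
move=> [M0 [rM0 bM0]].
have [/andP[M0p _] _ _ _ _] := tuple_count_supp rM0.
have WY : Y%:R ^+ (B + 3) <= 2 * W T.
  by apply: le_trans (supp_big rM0) _; rewrite -bM0 bin_W2.
pose a := Num.truncn (W T); pose b := Num.truncn (W T * (1 + 2 / Y%:R)).
have Wb : 0 <= W T * (1 + 2 / Y%:R) by rewrite mulr_ge0 ?addr_ge0 ?mulr_ge0 ?invr_ge0 // ltW.
have /andP[a1 a2] := truncn_itv (ltW W0).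
have /andP[b1 b2] := truncn_itv Wb.
(* The sieve counts []a.-1, b]], which includes the endpoint [a], the integer part of [W T]. *)
have ab : (a.-1 <= b)%N.
  apply: leq_trans (leq_pred _) _; apply: le_truncn; rewrite ler_peMr ?(ltW W0) //.
  by rewrite lerDl divr_ge0 // ltW.
have h1 : bin_count T g <= kk`!%:R * (\sum_(a.-1.+1 <= M < b.+1 | (M%:R == val g) && (lep D)^'.-nat M) 1).
  rewrite mulr_sumr /bin_count big_mkcond.
  apply: le_trans (_ : \sum_(1 <= M < (Y ^ kk).+1 | [&& tuple_count kk M != 0, bin M == T & cls M == g]) kk`!%:R * 1 <= _).
    rewrite [leRHS]big_mkcond; apply: ler_sum => M _.
    have [->|] := eqVneq (tuple_count kk M) 0; first by case: ifP.
    by rewrite /= mulr1; case: ifP => // _ _; apply: tuple_count_le.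
  apply: ler_sum_nat_sub => [M|M _ /and3P[h2 /eqP h3 /eqP h4]]; first by rewrite mulr1.
  have [/andP[M1 _] Mr Mc _ _] := tuple_count_supp h2.
  rewrite Mr natr_eq_unit // Mc h4 eqxx !andbT.
  have := bin_W M1; rewrite h3 => /andP[w1 w2].
  have aM : (a <= M)%N by rewrite -(ler_nat R); apply: le_trans a1 w1.
  apply/andP; split; first by case: (a) aM => //= _; exact: M1.
  by rewrite ltnS truncn_ge_nat.
apply: le_trans h1 _.
have D0 := D_gt0; have S1 := S_ge1.
have h2 := @selberg_sieve R q q1 D g a.-1 b D0 ab.
have kf : 0 <= kk`!%:R :> R by [].
apply: le_trans (ler_wpM2l kf h2) _.
have -> : kap * (W T / phi) = kk`!%:R * (4 * (W T / Y%:R) / (phi * lnn D)).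
  by field; rewrite !gt_eqF //; lra.
rewrite ler_wpM2l //.
have q0 : 0 < q%:R :> R by rewrite ltr0n ltnW.
have l0 : 0 < phi * lnn D by rewrite mulr_gt0 //; lra.
have aw : W T - 2 <= a.-1%:R.
  have : a%:R <= a.-1%:R + 1 :> R by rewrite natr1 ler_nat; case: (a).
  by move: a2; rewrite -natr1; lra.
have b3 : b%:R - a.-1%:R <= 2 * (W T / Y%:R) + 2.
  have wE : W T * (1 + 2 / Y%:R) = W T + 2 * (W T / Y%:R) by ring.
  by move: b1; rewrite -/b wE; lra.
have WY2 : Y%:R ^+ (B + 2) <= 2 * (W T / Y%:R).
  rewrite mulrA ler_pdivlMr // -exprSr -addnS //.
have x0 : 0 <= 2 * (W T / Y%:R) + 2.
  have w1 : 0 <= W T / Y%:R by rewrite divr_ge0 // ltW.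
  lra.
have h3 : (b%:R - a.-1%:R) / q%:R / S <= (2 * (W T / Y%:R) + 2) / (phi * lnn D).
  rewrite -mulrA -invfM; apply: le_trans (_ : (2 * (W T / Y%:R) + 2) / (q%:R * S) <= _).
    by rewrite ler_wpM2r // invr_ge0 mulr_ge0 //; lra.
  rewrite ler_wpM2l // lef_pV2 ?posrE ?S_phi // mulr_gt0 //; lra.
apply: le_trans (lerD h3 (lexx _)) _.
rewrite -(ler_pM2r l0) mulrDl !divfK ?gt_eqF //.
have h4 : 6 * D%:R ^+ 6 * (phi * lnn D) <= Y%:R ^+ B.+1.
  rewrite [leRHS](exprS _ B); apply: le_trans (_ : phi * (6 * D%:R ^+ 6 * lnn D) <= _).
    by rewrite le_eqVlt; apply/orP; left; apply/eqP; ring.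
  rewrite mulrC; apply: ler_pM; rewrite ?phi_leY ?(ltW p0) //.
    by rewrite !mulr_ge0 ?exprn_ge0 //; lra.
  apply: le_trans (_ : D%:R ^+ 8 <= _); last by rewrite -natrX ler_nat D8.
  have d6 : 6 <= D%:R :> R.
    apply: le_trans (_ : (2 ^ 20)%:R <= _); last by rewrite ler_nat D_ge.
    by rewrite natrX; apply: le_trans (_ : 2 ^+ 3 <= _); [rewrite -natrX ler_nat|rewrite ler_eXn2l ?ltr1n].
  have ld := lnn_le_nat R D.
  have -> : D%:R ^+ 8 = D%:R ^+ 6 * (D%:R * D%:R) :> R by rewrite -expr2 -exprD.
  rewrite mulrAC mulrC ler_wpM2l ?exprn_ge0 //; apply: ler_pM => //; lra.
have h5 : 2 <= Y%:R ^+ B.+1 :> R.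
  have Y2 : 2 <= Y%:R :> R by rewrite ler_nat Y_gt1.
  apply: le_trans Y2 _; rewrite exprS ler_peMr ?(ltW Y0) // exprn_ege1 //.
  by rewrite ler1n Y_gt0.
have h6 : 2 * Y%:R ^+ B.+1 <= Y%:R ^+ (B + 2) :> R.
  by rewrite addn2 (exprS _ B.+1) ler_wpM2r ?exprn_ge0 ?(ltW Y0) // ler_nat Y_gt1.
lra.
Qed.

Lemma bin_count_sum (a : nat -> gT -> R) :
  tuple_sum kk (fun M => a (bin M) (cls M)) = \sum_(T < Z) \sum_(g : gT) bin_count T g * a T g.
Proof.
rewrite /bin_count; under [RHS]eq_bigr do under eq_bigr do rewrite mulr_suml big_mkcond.
rewrite exchange_big /=; under [RHS]eq_bigr do rewrite exchange_big.
rewrite /= exchange_big /=; under [RHS]eq_bigr do rewrite exchange_big.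
rewrite /tuple_sum; apply: eq_big_nat => M /andP[M0 MY].
have hb : (bin M < Z)%N by apply: bin_le; rewrite M0.
rewrite (bigD1 (Ordinal hb)) //= (bigD1 (cls M)) //= !eqxx /= big1 ?addr0; last first.
  by move=> g; rewrite eq_sym => /negbTE ->.
rewrite big1 ?addr0 // => T; rewrite -(inj_eq val_inj) /= eq_sym => /negbTE h.
by rewrite big1 // => g _; rewrite h.
Qed.

(** * Autocorrelation of the class counts in bins *)

Definition overlap T (h : gT) : R := \sum_(g : gT) Num.min (bin_count T g) (bin_count T (g * h)%g).
Definition correl (h : gT) : R := \sum_(T < Z) (W T)^-1 * overlap T h.
Definition mass : R := tuple_sum kk (fun M => (W (bin M))^-1).
(** A lower bound for the mean of [correl] over the group. The power is the square of the lower
    bound for [mass]; 72 is [4 * 2 * 9], from [kap], from the number of bins and from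
    [L <= 9 * lnn D]. *)
Definition c0 : R := (4 * kk%:R)^-1 ^+ (kk * 2) / (72 * (kk%:R * kk`!%:R)).

Lemma massE : mass = \sum_(T < Z) (\sum_(g : gT) bin_count T g) / W T.
Proof.
rewrite /mass (bin_count_sum (fun T _ => (W T)^-1)); apply: eq_bigr => T _.
by rewrite mulr_suml.
Qed.

Lemma mass_ge : (4 * kk%:R)^-1 ^+ kk <= mass.
Proof.
apply: le_trans (_ : tuple_sum kk (fun M => M%:R^-1) <= _).
  rewrite tuple_sum_inv lerXn2r // ?nnegrE ?win_sum_ge ?invr_ge0 ?mulr_ge0 //.
  by apply: sumr_ge0 => p _; rewrite invr_ge0.
apply: tuple_sum_le => M /tuple_count_supp[/andP[M0 _] _ _ _ _].
have /andP[h _] := bin_W M0.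
by rewrite lef_pV2 ?posrE ?W_gt0 ?ltr0n.
Qed.

Lemma mass_le : mass <= 2.
Proof.
apply: le_trans (_ : tuple_sum kk (fun M => 2 * M%:R^-1) <= _).
  apply: tuple_sum_le => M /tuple_count_supp[/andP[M0 _] _ _ _ _].
  have h := bin_W2 M0; have w0 := W_gt0 (bin M).
  have M0' : 0 < M%:R :> R by rewrite ltr0n.
  by rewrite ler_pdivlMr // mulrC ler_pdivrMr.
rewrite /tuple_sum; under eq_bigr do rewrite mulrCA.
rewrite -mulr_sumr -/(tuple_sum kk (fun M => M%:R^-1)) tuple_sum_inv.
rewrite -[leRHS]mulr1 ler_wpM2l //; apply: exprn_ile1; last exact: win_sum_le.
by apply: sumr_ge0 => p _; rewrite invr_ge0.
Qed.

Lemma overlap_ge0 T h : 0 <= overlap T h.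
Proof. by apply: sumr_ge0 => g _; rewrite le_min !bin_count_ge0. Qed.

Lemma overlap_le T h : overlap T h <= \sum_(g : gT) bin_count T g.
Proof. by apply: ler_sum => g _; rewrite ge_min lexx. Qed.

Lemma correl_le2 h : correl h <= 2.
Proof.
apply: le_trans mass_le; rewrite massE; apply: ler_sum => T _.
by rewrite mulrC ler_wpM2r ?overlap_le // invr_ge0 ltW // W_gt0.
Qed.

Lemma correl1 : correl 1%g = mass.
Proof.
rewrite massE; apply: eq_bigr => T _; rewrite mulrC; congr (_ / _).
by apply: eq_bigr => g _; rewrite mulg1 minxx.
Qed.

Lemma correlV h : correl h^-1%g = correl h.
Proof.
apply: eq_bigr => T _; congr (_ * _).
rewrite /overlap (reindex_inj (mulIg h)) /=; apply: eq_bigr => g _.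
by rewrite mulgK minC.
Qed.

Lemma min_ge_mul (x y m : R) : 0 < m -> 0 <= x <= m -> 0 <= y <= m -> x * y / m <= Num.min x y.
Proof.
move=> m0 /andP[x0 xm] /andP[y0 ym]; rewrite le_min !ler_pdivrMr //.
by rewrite ler_wpM2l //= mulrC ler_wpM2l.
Qed.

Lemma sum_sq_ge n (x : 'I_n.+1 -> R) :
  (\sum_(i < n.+1) x i) ^+ 2 / n.+1%:R <= \sum_(i < n.+1) x i ^+ 2.
Proof.
set s := \sum_(i < n.+1) x i.
pose c := s / n.+1%:R; have n0 : 0 < n.+1%:R :> R by rewrite ltr0n.
apply: le_trans (_ : \sum_(i < n.+1) (2 * c * x i - c ^+ 2) <= _).
  rewrite sumrB -mulr_sumr -/s sumr_const card_ord -[_ *+ n.+1]mulr_natr /c.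
  rewrite le_eqVlt; apply/orP; left; apply/eqP; field; rewrite addrC natr1 gt_eqF //.
apply: ler_sum => i _; have := sqr_ge0 (x i - c); rewrite sqrrB; lra.
Qed.

Lemma kap_gt0 : 0 < kap.
Proof.
have lD := lnD_ge; rewrite divr_gt0 ?mulr_gt0 ?Y_gt0r ?ltr0n ?fact_gt0 //; lra.
Qed.

(** Summed over [h], the overlap of a bin is the sum of the minimum of two class counts over all
    pairs of classes, at least the squared total of the bin divided by the sieve bound for one
    class. Cauchy-Schwarz over the bins brings in their number, about [Y * kk * L], whose factors
    [Y] and [L] cancel against [kap]. *)
Lemma correl_sum : c0 * phi <= \sum_(h : gT) correl h.
Proof.
have p0 := phi_gt0; have k0 := kap_gt0.
pose nn T := \sum_(g : gT) bin_count T g.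
have h1 : phi / kap * \sum_(T < Z) (nn T / W T) ^+ 2 <= \sum_(h : gT) correl h.
  rewrite /correl exchange_big /= mulr_sumr; apply: ler_sum => T _.
  have W0 := W_gt0 T; rewrite -mulr_sumr /overlap.
  have -> : \sum_(h : gT) \sum_(g : gT) Num.min (bin_count T g) (bin_count T (g * h)%g) =
     \sum_(g : gT) \sum_(h : gT) Num.min (bin_count T g) (bin_count T h).
    rewrite exchange_big /=; apply: eq_bigr => g _.
    by rewrite [RHS](reindex_inj (mulgI g)).
  have m0 : 0 < kap * (W T / phi) by apply: mulr_gt0 => //; apply: divr_gt0.
  apply: le_trans (_ : (W T)^-1 * (nn T ^+ 2 / (kap * (W T / phi))) <= _).
    rewrite le_eqVlt; apply/orP; left; apply/eqP; move: kap k0 => z z0.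
    by field; rewrite !gt_eqF.
  rewrite ler_wpM2l ?invr_ge0 ?(ltW W0) // expr2 {1}/nn !mulr_suml.
  apply: ler_sum => g _; rewrite mulr_sumr mulr_suml; apply: ler_sum => h _.
  by apply: min_ge_mul => //; rewrite bin_count_ge0 bin_count_sieve.
apply: le_trans h1.
have h2 := sum_sq_ge (fun T : 'I_Z => nn T / W T).
rewrite -massE in h2.
have h3 := mass_ge; have lD := lnD_ge; have Y0 := Y_gt0r; have L1 := L_ge1000.
have kk1 : 1 <= kk%:R :> R by rewrite ler1n.
have m00 : 0 <= (4 * kk%:R)^-1 ^+ kk :> R by rewrite exprn_ge0 // invr_ge0 mulr_ge0.
have hZ : Z%:R <= 2 * (Y%:R * (kk%:R * L)).
  have Y2 : 2 <= Y%:R :> R by rewrite ler_nat Y_gt1.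
  have x0 : 0 <= Y%:R * lnn (Y ^ kk) by rewrite mulr_ge0 ?lnn_ge0.
  have /andP[h4 _] := truncn_itv x0.
  rewrite -natr1 -/(bin _); rewrite -/(bin _) lnnX ?Y_gt0 // in h4.
  have : 1 <= Y%:R * (kk%:R * L).
    by rewrite !mulr_ege1 //; lra.
  lra.
have Z0 : 0 < Z%:R :> R by rewrite ltr0n.
have f0 : 0 < kk`!%:R :> R by rewrite ltr0n fact_gt0.
apply: le_trans (_ : phi / kap * (mass ^+ 2 / Z%:R) <= _); last first.
  by rewrite ler_wpM2l // divr_ge0 ?ltW.
apply: le_trans (_ : phi / kap * ((4 * kk%:R)^-1 ^+ (kk * 2) / (2 * (Y%:R * (kk%:R * L)))) <= _); last first.
  apply: ler_wpM2l; first by apply: divr_ge0; exact: ltW.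
  rewrite exprM; apply: ler_pM.
  - by rewrite exprn_ge0.
  - by rewrite invr_ge0 !mulr_ge0 //; lra.
  - by rewrite lerXn2r // nnegrE //; apply: le_trans h3.
  - by rewrite lef_pV2 ?posrE // !mulr_gt0 //; lra.
rewrite /c0; set x := (4 * kk%:R)^-1 ^+ (kk * 2).
have x0 : 0 <= x by rewrite exprn_ge0 // invr_ge0 mulr_ge0.
have hL := L_le.
have -> : x / (72 * (kk%:R * kk`!%:R)) * phi = x * phi / (8 * (kk%:R * kk`!%:R)) * 9^-1.
  by field; rewrite !gt_eqF //; lra.
have -> : phi / kap * (x / (2 * (Y%:R * (kk%:R * L)))) = x * phi / (8 * (kk%:R * kk`!%:R)) * (lnn D / L).
  by field; rewrite !gt_eqF //; lra.
apply: ler_wpM2l; last by rewrite ler_pdivlMr; lra.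
by apply: divr_ge0; [apply: mulr_ge0 => //; exact: ltW|rewrite !mulr_ge0].
Qed.

(** The threshold is half the lower bound for the mean; as [correl <= 2], a proportion of the group
    independent of [q] lies above it. *)
Definition corr_set : {set gT} := [set h | c0 / 2 <= correl h].

Lemma c0_gt0 : 0 < c0.
Proof.
rewrite /c0 divr_gt0 ?exprn_gt0 ?invr_gt0 ?mulr_gt0 ?ltr0n ?fact_gt0 //.
Qed.

Lemma c0_le : c0 <= (4 * kk%:R)^-1 ^+ kk.
Proof.
have k1 : 1 <= kk%:R :> R by rewrite ler1n.
have f1 : 1 <= kk`!%:R :> R by rewrite ler1n fact_gt0.
have i0 : 0 <= (4 * kk%:R)^-1 :> R by rewrite invr_ge0 mulr_ge0.
have i1 : (4 * kk%:R)^-1 <= 1 :> R by rewrite invf_le1; lra.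
have kf : 1 <= kk%:R * kk`!%:R :> R by rewrite mulr_ege1.
rewrite /c0 ler_pdivrMr; last by lra.
rewrite mulnC mul2n -addnn exprD -[leRHS]mulrC mulrC ler_pM ?exprn_ge0 //.
by apply: le_trans (exprn_ile1 _ i0 i1) _; lra.
Qed.

Lemma corr_set1 : 1%g \in corr_set.
Proof.
rewrite inE correl1; apply: le_trans mass_ge; apply: le_trans c0_le.
have := c0_gt0; lra.
Qed.

Lemma corr_setV h : (h^-1%g \in corr_set) = (h \in corr_set).
Proof. by rewrite !inE correlV. Qed.

Lemma corr_set_card : c0 / 4 * phi <= #|corr_set|%:R.
Proof.
have h := correl_sum; have p0 := phi_gt0.
have : \sum_(h : gT) correl h <= 2 * #|corr_set|%:R + c0 / 2 * phi.
  rewrite (bigID (mem corr_set)) /=; apply: lerD.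
    apply: le_trans (_ : \sum_(i in corr_set) 2 <= _); first by apply: ler_sum => x _; apply: correl_le2.
    by rewrite sumr_const mulr_natr.
  apply: le_trans (_ : \sum_(i : gT | i \notin corr_set) c0 / 2 <= _).
    by apply: ler_sum => x; rewrite inE -ltNge => /ltW.
  rewrite sumr_const -[_ *+ _]mulr_natr ler_wpM2l //; first by have := c0_gt0; lra.
  rewrite ler_nat -(card_unit q1) cardsT; exact: max_card.
lra.
Qed.

Lemma N_small1 t : (Y ^ 3 <= t)%N -> (t <= Y ^ U)%N -> D%:R ^+ 3 * N (t %/ D ^ 4) <= N t.
Proof.
move=> Yt tU; have D0 := D_gt0.
have h := @N_div_upper t (D ^ 4) _ _ Yt tU.
have {}h : (D ^ 4)%:R * N (t %/ D ^ 4) * L <= C2 * (N t * lnn t).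
  by apply: h; rewrite ?expn_gt0 ?D0 // -expnM D8.
have L0 := L_gt0; have Dr : 0 < D%:R :> R by rewrite ltr0n.
have lt := lnn_leX tU; have Nt := N_ge0 R Y q t; have c1 := C1_ge0.
have CD : C2 * U%:R <= D%:R.
  apply: le_trans K_D; apply: le_trans KU2.
  have : 0 <= C2 * U%:R by rewrite !mulr_ge0.
  lra.
have h2 : (D ^ 4)%:R * N (t %/ D ^ 4) * L <= D%:R * N t * L.
  apply: le_trans h _; apply: le_trans (_ : C2 * (N t * (U%:R * L)) <= _).
    by rewrite ler_wpM2l ?ler_wpM2l // mulr_ge0.
  have -> : C2 * (N t * (U%:R * L)) = C2 * U%:R * (N t * L) by ring.
  by rewrite -[leRHS]mulrA ler_wpM2r // mulr_ge0 // ltW.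
rewrite ler_pM2r // natrX exprS -mulrA ler_pM2l // in h2.
Qed.

(** Four divisions by [D ^ 4] gain [D ^ 12 >= 3 * Y * D], as [Y < D ^ 9], and [D ^ 16 <= Y ^ 2].
    This makes the arguments below [Y ^ v], reached from at most [Y] primes, negligible in
    [step_bound]. *)
Lemma N_small t : (Y ^ 5 <= t)%N -> (t <= Y ^ U)%N -> 3 * Y%:R * D%:R * N (t %/ Y ^ 2) <= N t.
Proof.
move=> Yt tU; have D0 := D_gt0; have Dr : 0 < D%:R :> R by rewrite ltr0n.
have D16 : (D ^ 16 <= Y ^ 2)%N by rewrite (expnM D 8 2) leq_exp2r // D8.
have iter j : (j <= 4)%N -> D%:R ^+ (3 * j) * N (t %/ D ^ (4 * j)) <= N t.
  elim: j => [_|j IH hj]; first by rewrite !muln0 expr0 mul1r expn0 divn1.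
  apply: le_trans (IH (ltnW hj)).
  rewrite !mulnS exprD addnC expnD divnMA [_ * D%:R ^+ (3 * j)]mulrC -mulrA ler_wpM2l ?exprn_ge0 //.
  apply: N_small1; last by apply: leq_trans tU; apply: leq_div.
  apply: (@div_geX 2 3) => //; rewrite expn_gt0 D0 /=; apply: leq_trans D16.
  by rewrite leq_exp2l; [lia|apply: leq_trans D_ge].
apply: le_trans (iter 4%N isT).
apply: ler_pM; rewrite ?N_ge0 ?mulr_ge0 //; last first.
  by apply: N_le; apply: leq_div2l; rewrite ?expn_gt0 ?D0.
have Y9 := Y_lt.
rewrite -[3]/(3%:R) -!natrM -natrX ler_nat.
apply: leq_trans (_ : 3 * D ^ 9 * D <= _)%N; first by rewrite leq_mul2r leq_mul2l (ltnW Y9) !orbT.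
rewrite -mulnA -expnSr -[(3 * 4)%N]/(2 + 10)%N expnD leq_mul2r; apply/orP; right.
have : (4 <= D)%N by apply: leq_trans D_ge.
by rewrite expnS expn1; clear; nia.
Qed.

Notation F := (@F R Y q).
(** * The contraction argument *)

Definition discr (h : gT) (g : gT) t : R := F g t - F (g * h)%g t.

Lemma discr_walk h : walk Y (discr h).
Proof.
exact: (walkB (F_walk R Y q1) (walk_shift h (F_walk R Y q1))). Qed.

Lemma discr0 h g : discr h g 0 = 0. Proof. by rewrite /discr !F0 subrr. Qed.

(** * Taking a share of the window primes out of the walk *)

Section Rho.
Variable V : nat.
Hypothesis V0 : (0 < V)%N.
Notation rho := ((2 * V%:R)^-1 : R).

Lemma rho_gt0 : 0 < rho. Proof. by rewrite invr_gt0 mulr_gt0 ?ltr0n. Qed.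

(** As [lnn t <= V * L] and [lnn p >= L / 2], every window prime can give up the weight
    [rho * lnn t] and keep a nonnegative one. *)
Lemma rho_ln t p : (t <= Y ^ V)%N -> win p -> rho * lnn t <= lnn p.
Proof.
move=> tV wp; apply: le_trans (win_ln wp); have h := lnn_leX tV.
have V1 : 0 < V%:R :> R by rewrite ltr0n.
rewrite mulrC ler_pdivrMr ?mulr_gt0 //.
have -> // : L / 2 * (2 * V%:R) = V%:R * L by field.
Qed.

Lemma rho_sum t : (1 < t <= Y ^ V)%N -> rho * \sum_(1 <= p < Y.+1 | win p) N (t %/ p) <= N t.
Proof.
move=> /andP[t1 tV]; have lt0 : 0 < lnn t by apply: lnn_gt0.
have h := @N_ln_ge R Y q t (fun p => (awin < p)%N) (ltnW t1).
rewrite -(ler_pM2r lt0); apply: le_trans h.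
rewrite mulrAC mulr_sumr; apply: ler_sum => p wp.
by rewrite ler_wpM2r ?N_ge0 // rho_ln.
Qed.

Lemma rho_tuple_sum_le i t : (Y ^ i.+1 <= t <= Y ^ V)%N -> rho ^+ i * tuple_sum i (fun M => N (t %/ M)) <= N t.
Proof.
elim: i t => [|i IH] t /andP[Yt tV]; first by rewrite tuple_sum0 expr0 mul1r divn1.
have t1 : (1 < t)%N by apply: leq_trans Yt; rewrite -(expn0 Y) ltn_exp2l ?Y_gt1.
rewrite tuple_sumS exprS -mulrA mulr_sumr; apply: le_trans (rho_sum _); last by rewrite t1.
rewrite ler_wpM2l ?(ltW rho_gt0) // [leLHS]big_nat_cond [leRHS]big_nat_cond.
apply: ler_sum => p /andP[/andP[p0 pY] wp]; rewrite /tuple_sum.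
under eq_bigr do rewrite divnMA.
apply: IH; rewrite (leq_trans (leq_div _ _) tV) andbT.
by apply: (@div_geX 1); rewrite // p0 expn1.
Qed.

End Rho.

Section Step.
Variables (Df : gT -> nat -> R) (beta Kw : R) (v V : nat).
Hypothesis Dw : walk Y Df.
Hypothesis Df0 : forall g, Df g 0%N = 0.
Hypothesis b0 : 0 <= beta.
Hypothesis Kw0 : 0 <= Kw.
Hypothesis v2 : (2 <= v)%N.
Hypothesis VU : (V <= U)%N.
Hypothesis V0 : (0 < V)%N.
Hypothesis Hbig : forall g s, (Y ^ v <= s <= Y ^ V)%N -> `|Df g s| <= beta * N s.
Hypothesis Hsmall : forall g s, (s < Y ^ v)%N -> `|Df g s| <= Kw * N (Y ^ v).
Notation rho := ((2 * V%:R)^-1 : R).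

Definition wt t p j : R := if (j == 1%N) && win p then lnn p - rho * lnn t else lnn p.

Lemma wt_sum (E : gT -> nat -> R) g t : walk Y E -> (0 < t)%N ->
  (E g t - rho * \sum_(1 <= p < Y.+1 | win p) E (g * (cls p)^-1)%g (t %/ p)%N) * lnn t =
  \sum_(1 <= s < t) E g s * (lnn s.+1 - lnn s) +
  \sum_(1 <= p < Y.+1 | pr q p) \sum_(1 <= j < t.+1) wt t p j * E (g * (cls p ^- j))%g (t %/ p ^ j)%N.
Proof.
move=> wE t0; rewrite mulrBl wE // -addrA; congr (_ + _).
rewrite [X in _ - X](_ : _ = \sum_(1 <= p < Y.+1 | pr q p) (if (awin < p)%N then rho * lnn t * E (g * (cls p)^-1)%g (t %/ p)%N else 0)); last first.
  by rewrite mulrAC mulr_sumr -big_mkcondr.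
rewrite -sumrB; apply: eq_bigr => p prp.
rewrite big_ltn // [X in _ = X]big_ltn // /wt eqxx /= expn1 expg1 /win prp /=.
rewrite addrAC; congr (_ + _); last first.
  by apply: eq_big_nat => j /andP[j1 _]; have -> : (j == 1%N) = false by case: j j1 => [|[]].
by case: ifP => _; rewrite ?subr0 // mulrBl.
Qed.

(** [Df] and [N] obey the same walk identity with the reduced nonnegative weights [wt], so the bound
    [beta * N] at smaller arguments controls what the window primes do not carry. The part they
    carry is kept exactly, for the regrouping. *)
Lemma step_bound g t : (Y ^ (v + 3) <= t <= Y ^ V)%N ->
  `|Df g t - rho * \sum_(1 <= p < Y.+1 | win p) Df (g * (cls p)^-1)%g (t %/ p)%N| <=
  beta * (N t - rho * \sum_(1 <= p < Y.+1 | win p) N (t %/ p)) + Kw / D%:R * N t.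
Proof.
move=> /andP[Yt tV].
have T0 := YX_gt0 v.
have Tt : (Y ^ v <= t)%N by apply: leq_trans (YX_le _) Yt; lia.
have Y5 : (Y ^ 5 <= t)%N by apply: leq_trans (YX_le _) Yt; clear -v2; lia.
have tU : (t <= Y ^ U)%N by apply: leq_trans tV (YX_le _).
have t1 : (1 < t)%N by apply: leq_trans Y5; rewrite -(expn0 Y) ltn_exp2l ?Y_gt1.
have t0 := ltnW t1; have lt0 : 0 < lnn t by apply: lnn_gt0.
rewrite -(ler_pM2r lt0) -[X in `|_| * X](ger0_norm (ltW lt0)) -normrM wt_sum //.
have w0 p j : pr q p -> 0 <= wt t p j <= lnn p.
  move=> prp; rewrite /wt; case: ifP => [/andP[_ wp]|_]; last by rewrite lnn_ge0 lexx.
  by rewrite subr_ge0 rho_ln //= gerBl mulr_ge0 ?(ltW (rho_gt0 V0)) ?(ltW lt0).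
have KN : 0 <= Kw * N (Y ^ v) by rewrite mulr_ge0 ?N_ge0.
have hb := @walk_bound R Y q Df (fun s => beta * N s) (Y ^ v) t (Kw * N (Y ^ v)) (wt t) g Df0.
rewrite T0 Tt in hb; have {}hb := hb isT KN w0.
apply: le_trans (hb _ Hsmall) _ => {hb}.
  by move=> g' s /andP[h1 h2]; apply: Hbig; rewrite h1 (leq_trans (ltnW h2)).
rewrite mulrDl; apply: lerD.
  have wN : (N t - rho * \sum_(1 <= p < Y.+1 | win p) N (t %/ p)) * lnn t = _ := wt_sum 1%g (@N_walk R Y q) t0.
  rewrite -mulrA wN mulrDr; apply: lerD.
    rewrite mulr_sumr; under eq_bigr do rewrite -mulrA.
    apply: ler_sum_nat_sub => [s|s /andP[h1 h2] _]; first by rewrite !mulr_ge0 ?N_ge0 ?lnnS_sub_ge0.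
    by rewrite h2 (leq_trans T0 h1).
  rewrite mulr_sumr; apply: ler_sum => p prp; rewrite mulr_sumr [leLHS]big_mkcond; apply: ler_sum => j _.
  have /andP[w1 _] := w0 p j prp.
  by case: ifP => _; rewrite ?[_ * (beta * _)]mulrCA // !mulr_ge0 ?N_ge0.
have D0 : 0 < D%:R :> R by rewrite ltr0n D_gt0.
have h1 : lnn (Y ^ v) + \sum_(1 <= p < Y.+1 | pr q p) (lnn (Y ^ v) + lnn p) <= 3 * Y%:R * lnn t.
  have lT : lnn (Y ^ v) <= lnn t by apply: lnn_le.
  have Yt1 : (Y <= t)%N by apply: leq_trans Y5; rewrite -{1}(expn1 Y) YX_le.
  have s1 : \sum_(1 <= p < Y.+1 | pr q p) (lnn (Y ^ v) + lnn p) <= Y%:R * (2 * lnn t).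
    rewrite -(sum_nat1 R) mulr_suml big_mkcond; apply: ler_sum_nat => p /andP[_ pY].
    rewrite mul1r; case: ifP => _; last by lra.
    have : lnn p <= lnn t by apply: lnn_le; apply: leq_trans Yt1.
    lra.
  have : lnn t <= Y%:R * lnn t by rewrite ler_peMl ?(ltW lt0) // ler1n Y_gt0.
  lra.
apply: le_trans (ler_wpM2l KN h1) _.
have h2 := N_small Y5 tU.
have h3 : N (Y ^ v) <= N (t %/ Y ^ 2).
  apply: N_le; rewrite leq_divRL ?YX_gt0 // -expnD; apply: leq_trans (YX_le _) Yt; clear; lia.
have -> : Kw * N (Y ^ v) * (3 * Y%:R * lnn t) = Kw / D%:R * (3 * Y%:R * D%:R * N (Y ^ v)) * lnn t.
  by field; rewrite gt_eqF.
rewrite ler_wpM2r ?(ltW lt0) // ler_wpM2l ?divr_ge0 //.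
apply: le_trans h2; rewrite ler_wpM2l // !mulr_ge0 //.
Qed.

(** [step_bound] is applied again at each [t / p]; every pass adds one error [Kw / D], because [rho]
    times the sum of [N (t / p)] is at most [N t]. *)
Lemma iter_bound i g t : (Y ^ (v + 3 + i) <= t <= Y ^ V)%N ->
  `|Df g t - rho ^+ i * tuple_sum i (fun M => Df (g * (cls M)^-1)%g (t %/ M)%N)| <=
  beta * (N t - rho ^+ i * tuple_sum i (fun M => N (t %/ M))) + i%:R * (Kw / D%:R) * N t.
Proof.
elim: i g t => [|i IH] g t /andP[Yt tV].
  by rewrite !tuple_sum0 !expr0 !mul1r !divn1 cls1 // invg1 mulg1 !subrr normr0 mulr0 !mul0r addr0.
have t1 : (1 < t)%N by apply: leq_trans Yt; rewrite -(expn0 Y) ltn_exp2l ?Y_gt1 //; lia.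
set Sd := \sum_(1 <= p < Y.+1 | win p) Df (g * (cls p)^-1)%g (t %/ p)%N.
set Sn := \sum_(1 <= p < Y.+1 | win p) N (t %/ p).
pose dp p := Df (g * (cls p)^-1)%g (t %/ p)%N - rho ^+ i * tuple_sum i (fun M => Df (g * (cls p)^-1 * (cls M)^-1)%g (t %/ p %/ M)%N).
pose np p := N (t %/ p) - rho ^+ i * tuple_sum i (fun M => N (t %/ p %/ M)%N).
have e1 : Df g t - rho ^+ i.+1 * tuple_sum i.+1 (fun M => Df (g * (cls M)^-1)%g (t %/ M)%N) =
   (Df g t - rho * Sd) + rho * \sum_(1 <= p < Y.+1 | win p) dp p.
  rewrite tuple_sumS /dp sumrB -mulr_sumr -/Sd.
  have -> : \sum_(1 <= p < Y.+1 | win p) tuple_sum i (fun M => Df (g * (cls (p * M))^-1)%g (t %/ (p * M))%N) =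
    \sum_(1 <= p < Y.+1 | win p) tuple_sum i (fun M => Df (g * (cls p)^-1 * (cls M)^-1)%g (t %/ p %/ M)%N).
    apply: eq_bigr => p wp; apply: eq_bigr => M _.
    have [->|h] := eqVneq (tuple_count i M) 0; first by rewrite !mul0r.
    have [_ _ cM _ _] := tuple_count_supp h; have cp : coprime p q by case/andP: wp => /andP[].
    by rewrite clsM // invMg -mulgA (unit_mulC (cls p)^-1%g) divnMA.
  by rewrite exprS; ring.
have e2 : N t - rho ^+ i.+1 * tuple_sum i.+1 (fun M => N (t %/ M)) =
   (N t - rho * Sn) + rho * \sum_(1 <= p < Y.+1 | win p) np p.
  rewrite tuple_sumS /np sumrB -mulr_sumr -/Sn.
  have -> : \sum_(1 <= p < Y.+1 | win p) tuple_sum i (fun M => N (t %/ (p * M))) =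
    \sum_(1 <= p < Y.+1 | win p) tuple_sum i (fun M => N (t %/ p %/ M)).
    by apply: eq_bigr => p wp; apply: eq_bigr => M _; rewrite divnMA.
  by rewrite exprS; ring.
rewrite e1 e2; apply: le_trans (ler_normD _ _) _.
have r0 := rho_gt0 V0.
have h1 : `|Df g t - rho * Sd| <= beta * (N t - rho * Sn) + Kw / D%:R * N t.
  by apply: step_bound; rewrite tV andbT; apply: leq_trans (YX_le _) Yt; lia.
have h2 : `|rho * \sum_(1 <= p < Y.+1 | win p) dp p| <=
    beta * (rho * \sum_(1 <= p < Y.+1 | win p) np p) + i%:R * (Kw / D%:R) * (rho * Sn).
  rewrite normrM gtr0_norm // (mulrCA beta) (mulrCA _ rho) -mulrDr ler_wpM2l ?(ltW r0) //.
  apply: le_trans (ler_norm_sum _ _ _) _.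
  rewrite !mulr_sumr -big_split /= [leLHS]big_nat_cond [leRHS]big_nat_cond.
  apply: ler_sum => p /andP[/andP[p0 pY] wp]; apply: IH.
  rewrite (leq_trans (leq_div _ _) tV) andbT; apply: (@div_geX 1); last by rewrite p0 expn1.
  by apply: leq_trans (YX_le _) Yt; clear; lia.
have h3 : rho * Sn <= N t by apply: (rho_sum V0); rewrite t1.
have kd : 0 <= i%:R * (Kw / D%:R) by rewrite !mulr_ge0 ?invr_ge0.
have h4 := ler_wpM2l kd h3.
apply: le_trans (lerD h1 (le_trans h2 (lerD (lexx _) h4))) _.
by rewrite le_eqVlt; apply/orP; left; apply/eqP; rewrite -natr1; ring.
Qed.
End Step.

(** * Replacing [t / M] by a value depending only on the bin *)

Lemma F_incr (g : gT) a b : (a <= b)%N -> 0 <= F g b - F g a <= (b%:R - a%:R) / q%:R + 4.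
Proof.
move=> ab; rewrite subr_ge0 F_le //=.
have h : F g b - F g a <= cnt R g b - cnt R g a.
  rewrite /F /cnt [X in X - _](big_cat_nat (n := a.+1)) //= [X in _ <= X - _](big_cat_nat (n := a.+1)) //=.
  rewrite addrAC subrr add0r [leRHS]addrAC subrr add0r.
  apply: ler_sum_nat_sub => // n -> /andP[/andP[_ cn] /eqP <-].
  by rewrite natr_eq_unit // cn eqxx.
have /ler_normlP[h1 _] := cnt_approx R q1 g a; have /ler_normlP[_ h2] := cnt_approx R q1 g b.
apply: le_trans h _; rewrite mulrBl; lra.
Qed.

Definition bin_div T t := Num.truncn (t%:R / W T).
Definition eta : R := 81 / (lowc U * Y%:R).

Lemma eta_ge0 : 0 <= eta.
Proof. by rewrite /eta divr_ge0 // mulr_ge0 // ltW // lowc_gt0. Qed.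

Lemma bin_div_ge M t : (0 < M)%N -> (t %/ M <= bin_div (bin M) t)%N.
Proof.
move=> M0; have M0' : 0 < M%:R :> R by rewrite ltr0n.
have W0 := W_gt0 (bin M); have /andP[h _] := bin_W M0.
rewrite truncn_ge_nat; last by rewrite divr_ge0 // ltW.
apply: le_trans (trunc_div_le t M0) _.
by rewrite ler_wpM2l // lef_pV2 ?posrE.
Qed.

Lemma bin_div_le T t : (bin_div T t <= t)%N.
Proof.
rewrite -(ler_nat R); have W0 := W_gt0 T.
have x0 : 0 <= t%:R / W T by rewrite divr_ge0 // ltW.
have /andP[h _] := truncn_itv x0; apply: le_trans h _.
rewrite ler_pdivrMr // ler_peMr //.
have y0 : 0 <= T%:R / Y%:R :> R by rewrite divr_ge0.
by have := expR_ge1Dx (T%:R / Y%:R : R); rewrite -/(W T); lra.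
Qed.

(** [t / M] and [t / W] differ by a factor [1 + O(1 / Y)], and an interval of that length contains
    few integers of the class, since [Y * q <= t / M]. Relating this to [N (t / M)] costs
    [1 / lowc U], harmless against the factor [1 / Y] in [eta]. *)
Lemma F_bin (g : gT) M t : (0 < M)%N -> (Y ^ (B + 2) <= t %/ M)%N -> (t <= Y ^ U)%N ->
  0 <= F g (bin_div (bin M) t) - F g (t %/ M) <= eta * (N (t %/ M) / phi).
Proof.
move=> M0 hm tU; have M0' : 0 < M%:R :> R by rewrite ltr0n.
have W0 := W_gt0 (bin M); have /andP[w1 w2] := bin_W M0.
have Y0 := Y_gt0r; have q0 : 0 < q%:R :> R by rewrite ltr0n ltnW.
have /andP[f1 f2] := F_incr g (bin_div_ge t M0); rewrite f1 /=; apply: le_trans f2 _.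
have m1 : (0 < t %/ M)%N by apply: leq_trans hm; apply: YX_gt0.
have tM : t%:R / M%:R <= 2 * (t %/ M)%:R :> R.
  have : t%:R / (2 * M%:R) <= (t %/ M)%:R :> R by apply: trunc_div_ge_half; rewrite M0 -divn_gt0.
  have -> : t%:R / M%:R = 2 * (t%:R / (2 * M%:R)) :> R by field; rewrite gt_eqF.
  lra.
have tT : (bin_div (bin M) t)%:R <= t%:R / M%:R * (1 + 2 / Y%:R) :> R.
  have x0 : 0 <= t%:R / W (bin M) by rewrite divr_ge0 // ltW.
  have /andP[h _] := truncn_itv x0; apply: le_trans h _.
  by rewrite -mulrA ler_wpM2l // [leRHS]mulrC ler_pdivlMr // [leLHS]mulrC ler_pdivrMr // mulrC.
have tm := trunc_div_ge t M0.
set m := (t %/ M)%:R : R; rewrite -/m in tM tm.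
have mq : Y%:R * q%:R <= m.
  rewrite -natrM ler_nat; apply: leq_trans hm; rewrite addn2 expnS leq_mul2l; apply/orP; right.
  by apply: leq_trans qY _; rewrite YX_le.
have Yq : 0 < Y%:R * q%:R :> R by rewrite mulr_gt0.
have q2 : 1 <= q%:R :> R by rewrite ler1n ltnW.
have s1 : ((bin_div (bin M) t)%:R - m) / q%:R + 4 <= 9 * m / (Y%:R * q%:R).
  have a1 : (bin_div (bin M) t)%:R - m <= 4 * m / Y%:R + 1.
    have : t%:R / M%:R * (2 / Y%:R) <= 2 * m * (2 / Y%:R) by rewrite ler_wpM2r ?divr_ge0.
    by move: tT; rewrite mulrDr mulr1; lra.
  have a2 : ((bin_div (bin M) t)%:R - m) / q%:R <= (4 * m / Y%:R + 1) / q%:R by rewrite ler_wpM2r // invr_ge0.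
  have a3 : 1 / q%:R <= 1 :> R by rewrite ler_pdivrMr // mul1r.
  have a4 : 5 <= 5 * m / (Y%:R * q%:R) by rewrite ler_pdivlMr // ler_wpM2l.
  have -> : 9 * m / (Y%:R * q%:R) = 4 * m / Y%:R / q%:R + 5 * m / (Y%:R * q%:R) by field; rewrite !gt_eqF.
  by move: a2; rewrite mulrDl; lra.
apply: le_trans s1 _.
have c0 := lowc_gt0 U0; have p0 := phi_gt0; have L0 := L_gt0.
have D2m : (D ^ 2 <= t %/ M)%N.
  by apply: leq_trans (leq_trans D2_leY _) hm; rewrite -{1}(expn1 Y) YX_le // addn2.
have low : lowc U * (m * S) <= N (t %/ M) * L.
  by apply: N_lower => //; rewrite D2m (leq_trans (leq_div _ _) tU).
have lD := lnD_ge; have hL := L_le.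
have l1 : lowc U * m * phi <= 9 * (q%:R * N (t %/ M)).
  have Nm := N_ge0 R Y q (t %/ M).
  have e1 : lowc U * m * (phi * lnn D) <= q%:R * (N (t %/ M) * L).
    apply: le_trans (_ : lowc U * m * (q%:R * S) <= _).
      by rewrite ler_wpM2l ?S_phi // mulr_ge0 // ltW.
    have -> : lowc U * m * (q%:R * S) = q%:R * (lowc U * (m * S)) by ring.
    by rewrite ler_wpM2l // ltW.
  have e2 : q%:R * (N (t %/ M) * L) <= q%:R * (N (t %/ M) * (9 * lnn D)).
    by rewrite !ler_wpM2l // ltW.
  have lD0 : 0 < lnn D by lra.
  rewrite -(ler_pM2r lD0); apply: le_trans (le_trans _ e2) _; last first.
    by rewrite le_eqVlt; apply/orP; left; apply/eqP; ring.
  by apply: le_trans e1; rewrite mulrA.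
rewrite /eta ler_pdivrMr //.
have -> : 81 / (lowc U * Y%:R) * (N (t %/ M) / phi) * (Y%:R * q%:R) = 9 * (9 * (q%:R * N (t %/ M))) / (lowc U * phi).
  by field; rewrite !gt_eqF.
rewrite ler_pdivlMr; last by apply: mulr_gt0.
have -> : 9 * m * (lowc U * phi) = 9 * (lowc U * m * phi) by ring.
by rewrite ler_wpM2l.
Qed.

Lemma card_gT : #|{: gT}| = totient q. Proof. by rewrite -(card_unit q1) cardsT. Qed.

Lemma N_bin M t : (0 < M)%N -> (Y ^ (B + 2) <= t %/ M)%N -> (t <= Y ^ U)%N ->
  N (bin_div (bin M) t) <= (1 + eta) * N (t %/ M).
Proof.
move=> M0 hm tU; have p0 := phi_gt0.
suff : N (bin_div (bin M) t) - N (t %/ M) <= eta * N (t %/ M) by lra.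
rewrite (N_sum_F R Y q (bin_div _ _)) [X in _ - X](N_sum_F R Y q) -sumrB; apply: le_trans (_ : \sum_(g : gT) eta * (N (t %/ M) / phi) <= _).
  by apply: ler_sum => g _; have /andP[] := F_bin g M0 hm tU.
rewrite sumr_const card_gT -[_ *+ _]mulr_natr -mulrA divfK ?gt_eqF //.
Qed.

Lemma discr_bin (h g : gT) M t : (0 < M)%N -> (Y ^ (B + 2) <= t %/ M)%N -> (t <= Y ^ U)%N ->
  `|discr h g (t %/ M) - discr h g (bin_div (bin M) t)| <= eta * (N (t %/ M) / phi).
Proof.
move=> M0 hm tU; rewrite /discr.
have /andP[a1 a2] := F_bin g M0 hm tU; have /andP[b1 b2] := F_bin (g * h)%g M0 hm tU.
by rewrite ler_norml; apply/andP; split; lra.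
Qed.

(* On the overlap of [n] and its translate by [h1], the differences along [h] at
   [x] and [x * h1] regroup into differences along [h / h1] and [h * h1]. *)
Lemma repair (n Fx : gT -> R) (g h h1 : gT) (X lj l1 l2 : R) :
  (forall x, 0 <= n x) ->
  (forall x, `|Fx x - Fx (x * h)%g| <= lj * X) ->
  (forall x, `|Fx x - Fx (x * (h * h1^-1))%g| <= l1 * X) ->
  (forall x, `|Fx x - Fx (x * (h * h1))%g| <= l2 * X) ->
  `|\sum_x n x * (Fx (g * x^-1)%g - Fx (g * x^-1 * h)%g)| <=
  (\sum_x n x - \sum_x Num.min (n x) (n (x * h1)%g)) * (lj * X) +
  (\sum_x Num.min (n x) (n (x * h1)%g)) * ((l1 + l2) / 2 * X).
Proof.
move=> n0 H0 H1 H2.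
pose a x := Num.min (n x) (n (x * h1)%g).
pose d x := Fx (g * x^-1)%g - Fx (g * x^-1 * h)%g.
have sa : \sum_x a (x * h1^-1)%g = \sum_x a x.
  by rewrite [RHS](reindex_inj (mulIg h1^-1%g)).
pose rest x := n x - a x / 2 - a (x * h1^-1)%g / 2.
have r0 x : 0 <= rest x.
  have : a x <= n x by rewrite /a ge_min lexx.
  have : a (x * h1^-1)%g <= n x by rewrite /a mulgKV ge_min lexx orbT.
  rewrite /rest; lra.
have e1 : \sum_x n x * d x = \sum_x rest x * d x + \sum_x a x / 2 * (d x + d (x * h1)%g).
  have -> : \sum_x a x / 2 * (d x + d (x * h1)%g) = \sum_x a x / 2 * d x + \sum_x a (x * h1^-1)%g / 2 * d x.
    rewrite [X in _ = _ + X](reindex_inj (mulIg h1)) /= -big_split /=.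
    by apply: eq_bigr => x _; rewrite mulgK mulrDr.
  by rewrite -!big_split /=; apply: eq_bigr => x _; rewrite /rest; ring.
have e2 : \sum_x rest x = \sum_x n x - \sum_x a x.
  rewrite /rest !sumrB -!mulr_suml sa; lra.
have h3 x : `|d x + d (x * h1)%g| <= (l1 + l2) * X.
  have -> : d x + d (x * h1)%g = (Fx (g * x^-1)%g - Fx (g * x^-1 * (h * h1^-1))%g) +
      (Fx (g * x^-1 * h1^-1)%g - Fx (g * x^-1 * h1^-1 * (h * h1))%g).
    rewrite /d invMg.
    have -> : (g * (h1^-1 * x^-1) = g * x^-1 * h1^-1)%g by rewrite (unit_mulC h1^-1%g) mulgA.
    have -> : (g * x^-1 * h1^-1 * (h * h1) = g * x^-1 * h)%g.
      by rewrite -mulgA (unit_mulC h) mulKg.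
    have -> : (g * x^-1 * (h * h1^-1) = g * x^-1 * h1^-1 * h)%g by rewrite -!mulgA (unit_mulC h).
    ring.
  by apply: le_trans (ler_normD _ _) _; rewrite mulrDl; apply: lerD.
rewrite e1 -e2; apply: le_trans (ler_normD _ _) _; apply: lerD.
  apply: le_trans (ler_norm_sum _ _ _) _; rewrite mulr_suml; apply: ler_sum => x _.
  by rewrite normrM (ger0_norm (r0 x)) ler_wpM2l // H0.
apply: le_trans (ler_norm_sum _ _ _) _; rewrite mulr_suml; apply: ler_sum => x _.
have ax : 0 <= a x by rewrite le_min !n0.
rewrite normrM ger0_norm ?divr_ge0 //.
have -> : a x * ((l1 + l2) / 2 * X) = a x / 2 * ((l1 + l2) * X) by field.
by rewrite ler_wpM2l // divr_ge0.
Qed.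

Lemma exists_pr : exists2 p, pr q p & (p <= Y)%N.
Proof.
apply: contrapT => hn; have := win_sum_ge.
rewrite big_nat_cond big1 => [|p /andP[/andP[_ pY] /win_pr prp]]; last first.
  by case: hn; exists p.
by rewrite leNgt invr_gt0 mulr_gt0 ?ltr0n.
Qed.

(** * Contraction over word lengths and over scales *)

Section Contraction.
Variables (ell v0 : nat) (C0 : R).
Hypothesis v0B : (B + 2 <= v0)%N.
Hypothesis C00 : 0 <= C0.
Hypothesis HF : forall (g : gT) s, (Y ^ v0 <= s)%N -> F g s <= C0 * (N s / phi).
Hypothesis Qell : forall h h1, h \in (corr_set ^+ ell)%g -> h1 \in corr_set -> (h * h1)%g \in (corr_set ^+ ell)%g.
Notation lam j := (1 - 2^-1 ^+ j : R).
Notation del := (2^-1 ^+ ell.+1 : R).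
(** [V] times half of the relative gain of one step; the other half absorbs the errors. *)
Definition contr : R := del * 4^-1 ^+ B.+3 * c0 / (16 * C4 B.+3).

(* The weights [lam j] are concave in the word length [j], hence regrouping
   ([lam_mid]) gains [del] at every [j <= ell]. *)
Definition good (b : R) v V := forall j (h g : gT) s, (j <= ell)%N -> h \in (corr_set ^+ j)%g ->
  (Y ^ v <= s <= Y ^ V)%N -> `|discr h g s| <= b * lam j * (N s / phi).

Lemma lam_ge0 j : 0 <= lam j.
Proof. by rewrite subr_ge0 exprn_ile1 //; lra. Qed.

Lemma lam_le1 j : lam j <= 1.
Proof. by rewrite gerBl exprn_ge0 // invr_ge0. Qed.

Lemma lam_mid j : (lam j + lam ell) / 2 = lam j.+1 - del.
Proof. by rewrite (exprS _ j) (exprS _ ell); field. Qed.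

Lemma C4_gt0 : 0 < C4 B.+3.
Proof. by rewrite /C4; have := C1_gt0; move=> h; rewrite mulr_gt0 ?exprn_gt0 //; lra. Qed.

Lemma contr_gt0 : 0 < contr.
Proof.
rewrite /contr; apply: divr_gt0; last by apply: mulr_gt0 => //; exact: C4_gt0.
by apply: mulr_gt0; [rewrite mulr_gt0 ?exprn_gt0 // invr_gt0|exact: c0_gt0].
Qed.

Lemma corr_set_sub j : (j <= ell)%N -> (corr_set ^+ j \subset corr_set ^+ ell)%g.
Proof. by apply: expgs_sub; apply: corr_set1. Qed.

Lemma supp_share M : tuple_count kk M != 0 -> ((Y ^ kk) ^ 2 <= M ^ 2 * Y)%N.
Proof.
move=> /tuple_count_supp[/andP[M0 MY] _ _ _ h].
rewrite -(leq_exp2r _ _ (isT : 0 < kk)%N) expnMn -expnM -[((M ^ 2) ^ kk)%N]expnM.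
have -> : (2 * kk)%N = ee.+1 by lia.
apply: leq_trans (leq_mul h (leqnn _)); rewrite -!expnM -expnD; apply: YX_le; nia.
Qed.

(** [N_div_share] gives a product of [kk] primes a share containing [B.+3] powers of [v], one less
    than the powers of [V] in the normalisation. As [V <= 2 * v], a factor of order [1 / V]
    remains. *)
Lemma gain t (h1 : gT) v V : (v <= V)%N -> (0 < v)%N -> (V <= 2 * v)%N -> (V <= U)%N -> h1 \in corr_set ->
  (Y ^ (2 * B.+3 + 6) <= t)%N -> (Y ^ v <= t <= Y ^ V)%N ->
  4^-1 ^+ B.+3 * c0 / (8 * C4 B.+3 * V%:R) * N t <= (2 * V%:R)^-1 ^+ kk * \sum_(T < Z) overlap T h1 * N (bin_div T t).
Proof.
move=> vV v00 V2 VU hh tk /andP[tv tV].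
have tU : (t <= Y ^ U)%N by apply: leq_trans tV (YX_le _).
have L0 := L_gt0; have c4 := C4_gt0; have lt := lnn_geX tv.
have v1 : 0 < v%:R :> R by rewrite ltr0n.
have V1 : 0 < V%:R :> R by rewrite ltr0n (leq_trans v00).
have Nt := N_ge0 R Y q t.
pose x := N t * v%:R ^+ B.+3 / (2 * C4 B.+3).
have x0 : 0 <= x.
  by apply: divr_ge0; [rewrite mulr_ge0 ?exprn_ge0|apply: mulr_ge0 => //; exact: ltW].
have hT T : x * ((W T)^-1 * overlap T h1) <= overlap T h1 * N (bin_div T t).
  have [[M [rM bM]]|hn] := pselect (exists M, tuple_count kk M != 0 /\ bin M = T); last first.
    suff -> : overlap T h1 = 0 by rewrite mul0r !mulr0.
    have z g : bin_count T g = 0.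
      rewrite /bin_count big1 // => M /andP[/eqP h _]; apply/eqP; apply: contrapT => /negP h2.
      by apply: hn; exists M.
    by rewrite /overlap big1 // => g _; rewrite !z minxx.
  have [/andP[M0 MY] _ _ _ _] := tuple_count_supp rM.
  have M0' : 0 < M%:R :> R by rewrite ltr0n.
  have W0 := W_gt0 T.
  rewrite mulrA [leRHS]mulrC ler_wpM2r ?overlap_ge0 //.
  apply: le_trans (_ : N (t %/ M) <= _); last by apply: N_le; rewrite -bM; apply: bin_div_ge.
  have hs := @N_div_share t B.+3 M tk tU; rewrite M0 MY in hs; have {}hs := hs isT (supp_share rM).
  have Mw : M%:R <= 2 * W T by rewrite -bM bin_W2.
  have Nm := N_ge0 R Y q (t %/ M).
  have h3 : N t * (v%:R * L) ^+ B.+3 <= C4 B.+3 * L ^+ B.+3 * (2 * W T * N (t %/ M)).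
    apply: le_trans (_ : N t * lnn t ^+ B.+3 <= _).
      rewrite ler_wpM2l // lerXn2r // nnegrE ?lnn_ge0 // mulr_ge0 // ltW //.
    apply: le_trans hs _; rewrite ler_wpM2l ?ler_wpM2r //.
    by apply: mulr_ge0; [exact: ltW|rewrite exprn_ge0 // ltW].
  have Lk : 0 < L ^+ B.+3 by rewrite exprn_gt0.
  rewrite exprMn in h3.
  have h4 : N t * v%:R ^+ B.+3 <= C4 B.+3 * (2 * W T * N (t %/ M)).
    rewrite -(ler_pM2r Lk) -[leLHS]mulrA; apply: le_trans h3 _.
    by rewrite le_eqVlt; apply/orP; left; apply/eqP; ring.
  rewrite /x ler_pdivrMr // ler_pdivrMr; last by apply: mulr_gt0.
  apply: le_trans h4 _.
  by rewrite le_eqVlt; apply/orP; left; apply/eqP; ring.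
have h2 : x * (c0 / 2) <= \sum_(T < Z) overlap T h1 * N (bin_div T t).
  apply: le_trans (_ : x * correl h1 <= _).
    by rewrite ler_wpM2l //; move: hh; rewrite inE.
  by rewrite /correl mulr_sumr; apply: ler_sum => T _.
have rk0 : 0 <= (2 * V%:R)^-1 ^+ kk :> R by rewrite exprn_ge0 // invr_ge0 mulr_ge0.
apply: le_trans (ler_wpM2l rk0 h2).
have vv : (V%:R / 2) ^+ B.+3 <= v%:R ^+ B.+3 :> R.
  rewrite lerXn2r ?nnegrE ?divr_ge0 // ler_pdivrMr // -[2]/(2%:R) -natrM ler_nat.
  by rewrite mulnC.
have k1 : 0 <= (2 * V%:R)^-1 ^+ kk * (N t / (2 * C4 B.+3) * (c0 / 2)).
  apply: mulr_ge0 => //; apply: mulr_ge0; last by rewrite divr_ge0 // ltW // c0_gt0.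
  by apply: divr_ge0 => //; apply: mulr_ge0 => //; exact: ltW.
have := ler_wpM2l k1 vv.
have -> : (2 * V%:R)^-1 ^+ kk * (N t / (2 * C4 B.+3) * (c0 / 2)) * v%:R ^+ B.+3 = (2 * V%:R)^-1 ^+ kk * (x * (c0 / 2)).
  by rewrite /x; ring.
apply: le_trans.
have -> : (2 * V%:R)^-1 ^+ kk = (2 * V%:R)^-1 * (2 * V%:R)^-1 ^+ B.+3 :> R by rewrite exprS.
have -> : 4^-1 ^+ B.+3 = (2 * V%:R)^-1 ^+ B.+3 * (V%:R / 2) ^+ B.+3 :> R.
  by rewrite -exprMn; congr (_ ^+ _); field; rewrite gt_eqF.
move: ((2 * V%:R)^-1 ^+ B.+3) ((V%:R / 2) ^+ B.+3) => y z.
by rewrite le_eqVlt; apply/orP; left; apply/eqP; field; rewrite !gt_eqF.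
Qed.

(** [iter_bound] isolates the products of [kk] window primes; after passing to bins, [repair] gains
    on the overlapping part. By [herr], half of that gain pays for the passage to bins ([eta]) and
    for the small arguments ([C0 / D]). *)
Lemma contraction (b : R) v V : (v0 <= v)%N -> (2 * B.+3 + 6 <= v)%N -> (V <= 2 * v)%N -> (V <= U)%N ->
  0 <= b -> (b + 1) * eta + kk%:R * C0 / D%:R <= b * contr / V%:R ->
  good b v V -> good (b * (1 - contr / V%:R)) (v + 3 + kk) V.
Proof.
move=> vv0 vk V2 VU b0 herr Hg j h g t jl hj /andP[tl tV].
have p0 := phi_gt0; have Nt := N_ge0 R Y q t.
have tv : (Y ^ v <= t)%N by apply: leq_trans (YX_le _) tl; rewrite -addnA leq_addr.
have vV : (v <= V)%N.
  by rewrite -(leq_exp2l _ _ Y_gt1); apply: leq_trans tv tV.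
have v1 : (2 <= v)%N by apply: leq_trans vk; rewrite addnC.
have V0 : (0 < V)%N by apply: leq_trans vV; apply: ltnW.
have V1 : 0 < V%:R :> R by rewrite ltr0n.
have th := contr_gt0.
have tU : (t <= Y ^ U)%N by apply: leq_trans tV (YX_le _).
(* At [j = 0] the weight [lam 0] is 0, consistently with [h = 1], where the difference vanishes. *)
case: j jl hj => [|j] jl hj.
  move: hj; rewrite expg0 inE => /eqP ->.
  by rewrite /discr mulg1 subrr normr0 expr0 subrr mulr0 mul0r.
(* One letter is split off: [h / h1] has word length [j], and [h * h1] is counted with the largest
   weight [lam ell], as [corr_set ^+ ell] is stable under [corr_set]. *)
have [h1 h1Q [h' h'Q eh]] : exists2 h1, h1 \in corr_set & exists2 h', h' \in (corr_set ^+ j)%g & h = (h1 * h')%g.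
  by move: hj; rewrite expgS => /mulsgP[x y hx hy ->]; exists x => //; exists y.
have hl : h \in (corr_set ^+ ell)%g by apply: (subsetP (corr_set_sub jl)).
pose beta := b * lam j.+1 / phi.
have bl0 : 0 <= b * lam j.+1 by rewrite mulr_ge0 // lam_ge0.
have beta0 : 0 <= beta by rewrite divr_ge0 // ltW.
have Kw0 : 0 <= C0 / phi by rewrite divr_ge0 // ltW.
have Hbig g' s : (Y ^ v <= s <= Y ^ V)%N -> `|discr h g' s| <= beta * N s.
  by move=> hs; apply: le_trans (Hg j.+1 h g' s jl hj hs) _; rewrite /beta mulrA mulrAC.
have Hsmall g' s : (s < Y ^ v)%N -> `|discr h g' s| <= C0 / phi * N (Y ^ v).
  move=> hs; have f x : 0 <= F x s <= C0 / phi * N (Y ^ v).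
    rewrite F_ge0 /=; apply: le_trans (F_le R Y x (ltnW hs)) _.
    by apply: le_trans (HF x (YX_le vv0)) _; rewrite mulrA mulrAC.
  have /andP[a1 a2] := f g'; have /andP[b1 b2] := f (g' * h)%g.
  by rewrite /discr ler_norml; apply/andP; split; lra.
have hi := @iter_bound (discr h) beta (C0 / phi) v V (discr_walk h) (discr0 h) beta0 Kw0 v1 VU V0 Hbig Hsmall kk g t.
rewrite tl tV in hi; have {}hi := hi isT.
set OpN := tuple_sum kk (fun M => N (t %/ M)) in hi.
set OpD := tuple_sum kk _ in hi.
set rho := (2 * V%:R)^-1 ^+ kk in hi.
have rho0 : 0 <= rho by rewrite exprn_ge0 // invr_ge0 mulr_ge0.
have OpN0 : 0 <= OpN by apply: sumr_ge0 => M _; rewrite mulr_ge0 ?tuple_count_ge0 ?N_ge0.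
have rN : rho * OpN <= N t.
  apply: (rho_tuple_sum_le V0); rewrite tV andbT; apply: leq_trans (YX_le _) tl.
  by clear -v1; lia.
have tM M : tuple_count kk M != 0 -> (0 < M)%N /\ (Y ^ (v + 3) <= t %/ M)%N.
  move=> /tuple_count_supp[/andP[M0 MY] _ _ _ _]; split => //.
  by apply: (@div_geX kk); rewrite ?M0 // addnC.
have tMB M : tuple_count kk M != 0 -> (Y ^ (B + 2) <= t %/ M)%N.
  move=> /tM[_ hh]; apply: leq_trans (YX_le _) hh.
  by apply: leq_trans v0B (leq_trans vv0 _); rewrite leq_addr.
pose OpDb := tuple_sum kk (fun M => discr h (g * (cls M)^-1)%g (bin_div (bin M) t)).
have e1 : `|OpD - OpDb| <= eta * OpN / phi.
  rewrite /OpD /OpDb /OpN /tuple_sum -sumrB; apply: le_trans (ler_norm_sum _ _ _) _.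
  rewrite mulr_sumr mulr_suml; apply: ler_sum => M _; rewrite -mulrBr.
  have [->|hM] := eqVneq (tuple_count kk M) 0; first by rewrite !mul0r normr0 mulr0 mul0r.
  rewrite normrM ger0_norm ?tuple_count_ge0 // mulrCA -[leRHS]mulrA ler_wpM2l ?tuple_count_ge0 // -mulrA.
  by apply: discr_bin => //; [case: (tM M hM)|apply: tMB].
have e2 : `|OpDb| <= b / phi * (lam j.+1 * \sum_(T < Z) (\sum_x bin_count T x) * N (bin_div T t)
    - del * \sum_(T < Z) overlap T h1 * N (bin_div T t)).
  rewrite /OpDb (bin_count_sum (fun T x => discr h (g * x^-1)%g (bin_div T t))).
  apply: le_trans (ler_norm_sum _ _ _) _.
  rewrite !mulr_sumr -sumrB mulr_sumr; apply: ler_sum => T _.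
  have [[M [rM bM]]|hn] := pselect (exists M, tuple_count kk M != 0 /\ bin M = T); last first.
    have z x : bin_count T x = 0.
      rewrite /bin_count big1 // => M /andP[/eqP hb _]; apply/eqP; apply: contrapT => /negP h2.
      by apply: hn; exists M.
    have -> : overlap T h1 = 0 by rewrite /overlap big1 // => x _; rewrite !z minxx.
    rewrite big1 => [|x _]; last by rewrite z mul0r.
    by rewrite normr0 big1 => [|x _]; rewrite ?z // !mul0r !mulr0 subrr mulr0.
  have [M0 hM] := tM M rM.
  have tTv : (Y ^ v <= bin_div T t <= Y ^ V)%N.
    rewrite (leq_trans (bin_div_le _ _) tV) andbT -bM; apply: leq_trans (bin_div_ge _ M0).
    by apply: leq_trans (YX_le _) hM; rewrite leq_addr.
  have X0 : 0 <= N (bin_div T t) / phi by rewrite divr_ge0 ?N_ge0 // ltW.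
  have hr := @repair (bin_count T) (fun x => F x (bin_div T t)) g h h1 (N (bin_div T t) / phi) (b * lam j.+1) (b * lam j) (b * lam ell) (bin_count_ge0 T).
  apply: le_trans (hr _ _ _) _.
  - by move=> x; apply: (Hg j.+1).
  - move=> x; apply: (Hg j) => //; first exact: ltnW.
    by rewrite eh unit_mulC mulKg.
  - by move=> x; apply: (Hg ell) => //; apply: Qell.
  rewrite -/(overlap T h1); have -> : (b * lam j + b * lam ell) / 2 = b * (lam j.+1 - del).
    by rewrite -lam_mid; field.
  by rewrite le_eqVlt; apply/orP; left; apply/eqP; field; rewrite gt_eqF.
have e3 : \sum_(T < Z) (\sum_x bin_count T x) * N (bin_div T t) <= (1 + eta) * OpN.
  under eq_bigr do rewrite mulr_suml.
  rewrite -(bin_count_sum (fun T _ => N (bin_div T t))) /OpN /tuple_sum mulr_sumr; apply: ler_sum => M _.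
  have [->|hM] := eqVneq (tuple_count kk M) 0; first by rewrite !mul0r mulr0.
  rewrite mulrCA ler_wpM2l ?tuple_count_ge0 //.
  by apply: N_bin => //; [case: (tM M hM)|apply: tMB].
have e4 := @gain t h1 v V vV (ltnW v1) V2 VU h1Q _ _; rewrite tv tV in e4.
have {}e4 := e4 (leq_trans (YX_le vk) tv) isT.
set G := \sum_(T < Z) overlap T h1 * N (bin_div T t) in e2 e4.
have eta0 := eta_ge0.
have l1 := lam_le1 j.+1; have l0 := lam_ge0 j.+1.
have bp : 0 <= b / phi by rewrite divr_ge0 // ltW.
have f1 : `|OpDb| <= b / phi * (lam j.+1 * ((1 + eta) * OpN) - del * G).
  apply: le_trans e2 _; rewrite ler_wpM2l // lerD2r ler_wpM2l //.
have f2 : `|OpD| <= eta * OpN / phi + b / phi * (lam j.+1 * ((1 + eta) * OpN) - del * G).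
  have -> : OpD = (OpD - OpDb) + OpDb by rewrite subrK.
  by apply: le_trans (ler_normD _ _) _; apply: lerD.
have f3 : `|discr h g t| <= rho * `|OpD| + (beta * (N t - rho * OpN) + kk%:R * (C0 / phi / D%:R) * N t).
  have -> : discr h g t = rho * OpD + (discr h g t - rho * OpD) by ring.
  apply: le_trans (ler_normD _ _) _; rewrite normrM (ger0_norm rho0) lerD2l //.
apply: le_trans f3 _.
apply: le_trans (lerD (ler_wpM2l rho0 f2) (lexx _)) _.
have De : 0 < D%:R :> R by rewrite ltr0n D_gt0.
have g1 : del * (4^-1 ^+ B.+3 * c0 / (8 * C4 B.+3 * V%:R) * N t) <= del * (rho * G).
  by rewrite ler_wpM2l // exprn_ge0 // invr_ge0.
have c4 := C4_gt0.
have g2 : del * (4^-1 ^+ B.+3 * c0 / (8 * C4 B.+3 * V%:R) * N t) = 2 * (contr / V%:R) * N t.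
  by rewrite /contr; field; rewrite !gt_eqF.
rewrite g2 in g1.
have g3 := ler_wpM2l b0 g1.
have g4 : (b * lam j.+1 + 1) * eta * (rho * OpN) <= (b + 1) * eta * N t.
  apply: ler_pM => //.
  - by apply: mulr_ge0 => //; apply: addr_ge0.
  - by apply: mulr_ge0.
  - by apply: ler_wpM2r => //; rewrite lerD2r ler_piMr.
have g5 := ler_wpM2r Nt herr.
have g6 : b * (lam j.+1 * (contr / V%:R)) * N t <= b * (contr / V%:R) * N t.
  by rewrite ler_wpM2r // ler_wpM2l // ler_piMl // divr_ge0 // ltW.
rewrite -(ler_pM2r p0).
have -> : b * (1 - contr / V%:R) * lam j.+1 * (N t / phi) * phi =
   b * lam j.+1 * N t - b * (lam j.+1 * (contr / V%:R)) * N t by field; rewrite !gt_eqF.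
have -> : (rho * (eta * OpN / phi + b / phi * (lam j.+1 * ((1 + eta) * OpN) - del * G)) +
   (beta * (N t - rho * OpN) + kk%:R * (C0 / phi / D%:R) * N t)) * phi =
   (b * lam j.+1 + 1) * eta * (rho * OpN) + b * lam j.+1 * N t - b * (del * (rho * G)) + kk%:R * C0 / D%:R * N t.
  by rewrite /beta; field; rewrite !gt_eqF.
have h5 : b * contr / V%:R * N t = b * (contr / V%:R) * N t by rewrite mulrA.
rewrite h5 mulrDl in g5.
have h6 : b * (2 * (contr / V%:R) * N t) = 2 * (b * (contr / V%:R) * N t) by ring.
rewrite h6 in g3.
move: g3 g4 g5 g6.
move: (b * (contr / V%:R) * N t) (b * (del * (rho * G))) ((b * lam j.+1 + 1) * eta * (rho * OpN)) ((b + 1) * eta * N t) (kk%:R * C0 / D%:R * N t) (b * (lam j.+1 * (contr / V%:R)) * N t) => x1 x2 x3 x4 x5 x6.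
lra.
Qed.

Lemma good_le b b' v v' V V' : b <= b' -> (v <= v')%N -> (V' <= V)%N -> good b v V -> good b' v' V'.
Proof.
move=> bb vv VV H j h g s jl hj /andP[s1 s2].
apply: le_trans (H j h g s jl hj _) _.
  by rewrite (leq_trans (YX_le vv) s1) (leq_trans s2 (YX_le VV)).
by rewrite ler_wpM2r ?divr_ge0 ?N_ge0 ?(ltW phi_gt0) // ler_wpM2r // lam_ge0.
Qed.

Lemma contr_le1 : contr <= 1.
Proof.
have c4 : 1 <= C4 B.+3.
  have h := C1_ge1; rewrite /C4 mulr_ege1 ?exprn_ege1 //; lra.
have c01 : c0 <= 1.
  apply: le_trans c0_le _; apply: exprn_ile1; first by rewrite invr_ge0 mulr_ge0.
  have : 1 <= kk%:R :> R by rewrite ler1n.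
  by move=> h; rewrite invf_le1; lra.
rewrite /contr ler_pdivrMr; last by lra.
apply: le_trans (_ : 1 <= _); last by lra.
apply: mulr_ile1 => //; [|exact: ltW c0_gt0|].
  by rewrite mulr_ge0 ?exprn_ge0 // invr_ge0.
by apply: mulr_ile1; rewrite ?exprn_ge0 ?invr_ge0 ?exprn_ile1 // ?invr_ge0 //; lra.
Qed.

(** [bmax] is the starting bound and [bmin] the target. [Herr] guarantees the contraction only for
    bounds between them, whence the maxima with [bmin] below. *)
Variables (bmin bmax : R).
Hypothesis bmin0 : 0 < bmin.
Hypothesis bmM : bmin <= bmax.
Hypothesis Herr : (bmax + 1) * eta + kk%:R * C0 / D%:R <= bmin * contr / U%:R.

Lemma contraction_iter b v V i : (v0 <= v)%N -> (2 * B.+3 + 6 <= v)%N -> (V <= 2 * v)%N -> (V <= U)%N ->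
  (0 < V)%N -> bmin <= b <= bmax -> good b v V ->
  good (Num.max bmin (b * (1 - contr / V%:R) ^+ i)) (v + i * (3 + kk)) V.
Proof.
move=> vv0 vk V2 VU V0 /andP[b1 b2] Hg; elim: i => [|i IH].
  by rewrite expr0 mulr1 mul0n addn0; apply: good_le Hg => //; rewrite le_max lexx orbT.
have V1 : 1 <= V%:R :> R by rewrite ler1n.
have th := contr_gt0; have th1 := contr_le1.
set x := 1 - contr / V%:R in IH *.
have x0 : 0 <= x by rewrite subr_ge0 ler_pdivrMr; lra.
have x1 : x <= 1 by rewrite gerBl divr_ge0 //; lra.
have xi : x ^+ i <= 1 by rewrite exprn_ile1.
set bi := Num.max bmin (b * x ^+ i) in IH.
have bi1 : bmin <= bi by rewrite le_max lexx.
have bi2 : bi <= bmax.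
  have bb0 : 0 <= b := le_trans (ltW bmin0) b1.
  by rewrite ge_max bmM /=; apply: le_trans b2; rewrite ler_piMr.
have herr : (bi + 1) * eta + kk%:R * C0 / D%:R <= bi * contr / V%:R.
  apply: le_trans (_ : (bmax + 1) * eta + kk%:R * C0 / D%:R <= _).
    by rewrite lerD2r ler_wpM2r ?eta_ge0 // lerD2r.
  apply: le_trans Herr _; apply: ler_pM.
  - by rewrite mulr_ge0 // ltW.
  - by rewrite invr_ge0.
  - by rewrite ler_wpM2r // ltW.
  - by rewrite lef_pV2 ?posrE ?ltr0n // ler_nat.
have bi0 : 0 <= bi := le_trans (ltW bmin0) bi1.
have V2' : (V <= 2 * (v + i * (3 + kk)))%N by apply: leq_trans V2 _; rewrite leq_mul2l leq_addr.
have H := contraction (leq_trans vv0 (leq_addr _ _)) (leq_trans vk (leq_addr _ _)) V2' VU bi0 herr IH.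
apply: good_le H => //.
- rewrite -/x /bi maxr_pMl //; rewrite ge_max; apply/andP; split.
    by rewrite le_max; apply/orP; left; rewrite ler_piMr // ltW.
  by rewrite le_max -mulrA -exprSr lexx orbT.
- by rewrite mulSn -!addnA; clear; lia.
Qed.

Notation yy := (contr / (8 * (3 + kk)%:R)).

Lemma bernoulli_inv (x : R) i : 0 <= x <= 1 -> (1 - x) ^+ i <= (1 + i%:R * x)^-1.
Proof.
move=> /andP[x0 x1]; have ix : 0 <= i%:R * x by rewrite mulr_ge0.
rewrite -[leRHS]mul1r ler_pdivlMr; last by lra.
elim: i {ix} => [|i IH]; first by rewrite expr0 mul0r addr0 mulr1.
apply: le_trans IH; rewrite exprSr -mulrA ler_wpM2l ?exprn_ge0 //; first by lra.
have i0 : 0 <= i%:R :> R by [].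
rewrite -natr1; move: (i%:R : R) i0 => z z0.
have -> : (1 - x) * (1 + (z + 1) * x) = 1 + z * x - (z + 1) * (x * x) by ring.
have : 0 <= (z + 1) * (x * x) by rewrite !mulr_ge0 //; lra.
lra.
Qed.

(** For the least [V] with [s <= Y ^ V], the contraction starts at [V / 2] and loses [3 + kk] on the
    left each time. The number [i] of steps that fit is at least [V / (8 * (3 + kk))], so
    [(1 - contr / V) ^ i] is bounded by a constant below 1 independent of [V]. *)
Lemma doubling b v : (v0 <= v)%N -> (8 * (3 + kk) <= v)%N -> bmin <= b <= bmax ->
  good b v U -> good (Num.max bmin (b * (1 + yy)^-1)) (4 * v) U.
Proof.
move=> vv0 v8 bb Hg j h g s jl hj /andP[s1 s2].
have [V hV Vmin] : exists2 V, (s <= Y ^ V)%N & forall V', (s <= Y ^ V')%N -> (V <= V')%N.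
  have ex : exists V, (s <= Y ^ V)%N by exists U.
  by case: (ex_minnP ex) => V h1 h2; exists V.
have VU := Vmin _ s2.
have v1 : (0 < v)%N by apply: leq_trans v8.
have V4 : (4 * v <= V)%N.
  by rewrite -(leq_exp2l _ _ Y_gt1); apply: leq_trans s1 hV.
have V0 : (0 < V)%N by apply: leq_trans V4; rewrite muln_gt0.
have sV : (Y ^ V.-1 < s)%N.
  rewrite ltnNge; apply/negP => /Vmin; case: (V) V0 => // n _ /=; rewrite ltnn //.
pose v' := uphalf V; pose i := ((V.-1 - v') %/ (3 + kk))%N.
have v'v : (v <= v')%N by rewrite /v' uphalf_half; move: V4; clear; lia.
have V2 : (V <= 2 * v')%N by rewrite /v' uphalf_half; clear; lia.
have iV : (v' + i * (3 + kk) <= V.-1)%N.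
  have := leq_trunc_div (V.-1 - v') (3 + kk); rewrite -/i.
  have : (v' <= V.-1)%N by rewrite /v' uphalf_half; move: V4 v1; clear; lia.
  clear; lia.
have bb' := bb; move/andP: bb' => [b1 b2].
have vk : (2 * B.+3 + 6 <= v')%N by apply: leq_trans v'v; apply: leq_trans v8; clear; lia.
have H := @contraction_iter b v' V i (leq_trans vv0 v'v) vk V2 VU V0 bb.
have {}H := H (good_le (lexx b) v'v VU Hg).
have {}H := good_le (lexx _) iV (leqnn V) H.
apply: le_trans (H j h g s jl hj _) _; first by rewrite (ltnW sV) hV.
rewrite ler_wpM2r ?divr_ge0 ?N_ge0 ?(ltW phi_gt0) // ler_wpM2r ?lam_ge0 //.
rewrite ge_max le_max lexx /= le_max; apply/orP; right.
have bb0 : 0 <= b := le_trans (ltW bmin0) b1.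
rewrite ler_wpM2l //.
have th := contr_gt0; have th1 := contr_le1; have V1 : 1 <= V%:R :> R by rewrite ler1n.
apply: le_trans (bernoulli_inv i _) _.
  by rewrite divr_ge0 ?(ltW th) //= ler_pdivrMr; lra.
have iV2 : (V <= 8 * (3 + kk) * i)%N.
  have := ltn_ceil (V.-1 - v') (isT : 0 < 3 + kk)%N; rewrite -/i mulSn.
  have : (V <= 4 * (V.-1 - v'))%N.
    by rewrite /v' uphalf_half; move: V4 v8; clear; lia.
  rewrite -mulnA [((3 + kk) * i)%N]mulnC.
  move: V4 v8; clear; move: (V.-1 - v')%N (i * (3 + kk))%N (3 + kk)%N => a P m; lia.
have V1' : 0 < V%:R :> R by lra.
have m0 : 0 < 8 * (3 + kk)%:R :> R by rewrite mulr_gt0 ?ltr0n.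
have yi : yy <= i%:R * (contr / V%:R).
  have -> : i%:R * (contr / V%:R) = contr * (i%:R / V%:R) by ring.
  rewrite ler_wpM2l ?(ltW th) // ler_pdivlMr // ler_pdivrMl //.
  by rewrite -[8]/(8%:R) -!natrM ler_nat.
have y0 : 0 <= yy by rewrite divr_ge0 // ltW.
rewrite lef_pV2 ?posrE; lra.
Qed.

Lemma doubling_iter b v n : (v0 <= v)%N -> (8 * (3 + kk) <= v)%N -> bmin <= b <= bmax ->
  good b v U -> good (Num.max bmin (b * (1 + yy)^-1 ^+ n)) (4 ^ n * v) U.
Proof.
move=> vv0 v8 /andP[b1 b2] Hg; elim: n => [|n IH].
  by rewrite expr0 mulr1 expn0 mul1n; apply: good_le Hg => //; rewrite le_max lexx orbT.
have th := contr_gt0.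
have y0 : 0 <= yy by rewrite divr_ge0 ?(ltW th) // mulr_ge0.
have x0 : 0 <= (1 + yy)^-1 by rewrite invr_ge0; lra.
have x1 : (1 + yy)^-1 <= 1 by rewrite invf_le1; lra.
have v4 : (v <= 4 ^ n * v)%N by rewrite leq_pmull // expn_gt0.
set x := (1 + yy)^-1 in IH x0 x1 *.
have bb0 : 0 <= b := le_trans (ltW bmin0) b1.
set bn := Num.max bmin _ in IH.
have h : bmin <= bn <= bmax.
  rewrite le_max lexx ge_max bmM /=; apply: le_trans b2; rewrite ler_piMr // exprn_ile1 //.
have H := @doubling bn _ (leq_trans vv0 v4) (leq_trans v8 v4) h IH.
rewrite expnS -mulnA; apply: good_le H => //.
rewrite -/x ge_max le_max lexx /= /bn maxr_pMl // ge_max !le_max; apply/andP; split.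
  by apply/orP; left; rewrite ler_piMr // ltW.
by apply/orP; right; rewrite -mulrA -exprSr.
Qed.

Lemma initial_good : 2 * C0 <= bmax -> good bmax v0 U.
Proof.
move=> hb j h g s jl hj /andP[s1 _].
case: j jl hj => [|j] jl hj.
  move: hj; rewrite expg0 inE => /eqP ->.
  by rewrite /discr mulg1 subrr normr0 expr0 subrr mulr0 mul0r.
have p0 := phi_gt0; have X0 : 0 <= N s / phi by rewrite divr_ge0 ?N_ge0 // ltW.
have l2 : 2^-1 <= lam j.+1.
  have : 2^-1 ^+ j.+1 <= 2^-1 :> R by rewrite exprS ler_piMr ?invr_ge0 // exprn_ile1 ?invr_ge0 //; lra.
  lra.
apply: le_trans (_ : C0 * (N s / phi) <= _); last first.
  rewrite ler_wpM2r //.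
  have : bmax * 2^-1 <= bmax * lam j.+1 by rewrite ler_wpM2l // (le_trans (ltW bmin0) bmM).
  lra.
have := HF g s1; have := HF (g * h)%g s1; have := F_ge0 R Y g s; have := F_ge0 R Y (g * h)%g s.
by move=> *; rewrite /discr ler_norml; apply/andP; split; lra.
Qed.

(** After [n] rounds the bound [bmin] holds on [[T, T ^ B']] with [T = Y ^ (4 ^ n * v)], and
    [walk_tail] extends it to all larger arguments at the price of a factor 2. *)
Lemma final_decay n v B' : (v0 <= v)%N -> (8 * (3 + kk) <= v)%N -> 2 * C0 <= bmax ->
  bmax * (1 + yy)^-1 ^+ n <= bmin -> (4 ^ n * v * B' <= U)%N -> (0 < B')%N ->
  3 * C0 <= bmin * (B'%:R - 3) ->
  forall (h g : gT) s, h \in (corr_set ^+ ell)%g -> (Y ^ (4 ^ n * v) <= s)%N ->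
  `|discr h g s| <= 2 * bmin * (N s / phi).
Proof.
move=> vv0 v8 hb hn hU B'0 hB h g s hh hs.
have p0 := phi_gt0.
have g0 := good_le (lexx bmax) vv0 (leqnn U) (initial_good hb).
have H : good bmin (4 ^ n * v) U.
  have := doubling_iter (n := n) vv0 v8 _ g0; rewrite bmM lexx => /(_ isT).
  by apply: good_le => //; rewrite ge_max lexx.
set w := (4 ^ n * v)%N in H hU hs *.
have v1 : (0 < v)%N by apply: leq_trans v8.
have w1 : (v <= w)%N by rewrite leq_pmull // expn_gt0.
have b0' : 0 < bmin / phi by rewrite divr_gt0.
have T1 : (1 < Y ^ w)%N by rewrite -(expn0 Y) ltn_exp2l ?Y_gt1 // (leq_trans v1).
have YT : (Y <= Y ^ w)%N by rewrite -{1}(expn1 Y) YX_le // (leq_trans v1).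
have K0' : 0 <= C0 / phi by rewrite divr_ge0 // ltW.
have hBp : 3 * (C0 / phi) <= bmin / phi * (B'%:R - 3).
  have -> : bmin / phi * (B'%:R - 3) = bmin * (B'%:R - 3) / phi by ring.
  by rewrite mulrA ler_wpM2r // invr_ge0 ltW.
have := @walk_tail R Y q q1 (discr h) (bmin / phi) (C0 / phi) (Y ^ w) B' (discr_walk h) (discr0 h) exists_pr T1 YT b0' K0' B'0 hBp.
move=> HT; have -> : 2 * bmin * (N s / phi) = 2 * (bmin / phi) * N s by ring.
apply: HT hs.
- move=> g' s' /andP[a1 a2]; apply: le_trans (H ell h g' s' (leqnn _) hh _) _.
    by rewrite a1 (leq_trans a2) // -expnM YX_le.
  have -> : bmin / phi * N s' = bmin * (N s' / phi) by ring.
  rewrite ler_wpM2r ?divr_ge0 ?N_ge0 ?(ltW p0) // ler_piMr ?lam_le1 // ltW //.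
- move=> g' s' hs'.
  have f x : 0 <= F x s' <= C0 / phi * N (Y ^ w).
    rewrite F_ge0 /=; apply: le_trans (F_le R Y x (ltnW hs')) _.
    by apply: le_trans (HF x (YX_le (leq_trans vv0 w1))) _; rewrite mulrA mulrAC.
  have /andP[a1 a2] := f g'; have /andP[b1 b2] := f (g' * h)%g.
  by rewrite /discr ler_norml; apply/andP; split; lra.
Qed.
End Contraction.

(** * The a priori bound for each class *)

Lemma F_base (g : gT) s v0 : (B + 2 <= v0)%N -> (6 * v0 <= U)%N -> (Y ^ v0 <= s <= Y ^ (6 * v0))%N ->
  F g s <= 27 / lowc (6 * v0) * (N s / phi).
Proof.
move=> v0B vU /andP[s1 s2].
have v00 : (0 < 6 * v0)%N by move: v0B; clear; lia.
have c := lowc_gt0 v00; have q0 : 0 < q%:R :> R by rewrite ltr0n ltnW.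
have p0 := phi_gt0; have L0 := L_gt0; have lD := lnD_ge; have hL := L_le.
(* All integers of the class are counted, smooth or not; [s >= 2 * q] absorbs the rounding error
   4. *)
have h1 : F g s <= 3 * (s%:R / q%:R).
  have := @F_incr g 0 s (leq0n s); rewrite F0 !subr0 => /andP[_ h].
  apply: le_trans (_ : s%:R / q%:R + 4 <= _) => //.
  have : 2 <= s%:R / q%:R :> R.
    rewrite ler_pdivlMr // -[2]/(2%:R) -natrM ler_nat.
    apply: leq_trans s1; apply: leq_trans (_ : Y ^ (B + 2) <= _)%N; last exact: YX_le.
    rewrite addn2 expnS; apply: leq_mul; first exact: Y_gt1.
    by apply: leq_trans qY _; apply: YX_le.
  lra.
apply: le_trans h1 _.
have Y2 : (D ^ 2 <= s)%N.
  by apply: leq_trans (leq_trans D2_leY _) s1; rewrite -{1}(expn1 Y) YX_le //; move: v0B; clear; lia.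
have low : lowc (6 * v0) * (s%:R * S) <= N s * L by apply: N_lower => //; rewrite Y2.
have Ns := N_ge0 R Y q s.
have l1 : lowc (6 * v0) * s%:R * phi <= 9 * (q%:R * N s).
  have lD0 : 0 < lnn D by lra.
  rewrite -(ler_pM2r lD0).
  apply: le_trans (_ : q%:R * (lowc (6 * v0) * (s%:R * S)) <= _).
    have -> : lowc (6 * v0) * s%:R * phi * lnn D = lowc (6 * v0) * s%:R * (phi * lnn D) by ring.
    have -> : q%:R * (lowc (6 * v0) * (s%:R * S)) = lowc (6 * v0) * s%:R * (q%:R * S) by ring.
    by apply: ler_wpM2l; [apply: mulr_ge0 => //; exact: ltW|exact: S_phi].
  apply: le_trans (_ : q%:R * (N s * (9 * lnn D)) <= _); last first.
    by rewrite le_eqVlt; apply/orP; left; apply/eqP; ring.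
  rewrite ler_wpM2l ?(ltW q0) //; apply: le_trans low _; by rewrite ler_wpM2l.
have -> : 27 / lowc (6 * v0) * (N s / phi) = 3 * ((9 * (q%:R * N s)) / (lowc (6 * v0) * phi) / q%:R).
  by field; rewrite !gt_eqF.
rewrite ler_wpM2l // ler_wpM2r ?invr_ge0 ?(ltW q0) //.
rewrite ler_pdivlMr; last by apply: mulr_gt0.
by apply: le_trans l1; rewrite le_eqVlt; apply/orP; left; apply/eqP; ring.
Qed.

(** With [K = beta] the condition of [walk_tail] reads [3 <= B - 3], whence the exponent 6 in the
    initial range. *)
Lemma F_all (g : gT) s v0 : (B + 2 <= v0)%N -> (6 * v0 <= U)%N -> (Y ^ v0 <= s)%N ->
  F g s <= 54 / lowc (6 * v0) * (N s / phi).
Proof.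
move=> v0B vU hs.
have v00 : (0 < 6 * v0)%N by move: v0B; clear; lia.
have v1 : (0 < v0)%N by move: v0B; clear; lia.
have c := lowc_gt0 v00; have p0 := phi_gt0.
pose beta := 27 / lowc (6 * v0) / phi.
have b0 : 0 < beta by apply: divr_gt0 => //; apply: divr_gt0.
have T1 : (1 < Y ^ v0)%N by rewrite -(expn0 Y) ltn_exp2l ?Y_gt1.
have YT : (Y <= Y ^ v0)%N by rewrite -{1}(expn1 Y) YX_le.
have bB : 3 * beta <= beta * (6%:R - 3) by rewrite mulrC ler_wpM2l ?(ltW b0) //; lra.
have H := @walk_tail R Y q q1 F beta beta (Y ^ v0) 6 (F_walk R Y q1) (@F0 R Y q) exists_pr T1 YT b0 (ltW b0) isT bB.
have -> : 54 / lowc (6 * v0) * (N s / phi) = 2 * beta * N s by rewrite /beta; field; rewrite !gt_eqF.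
rewrite -[leLHS]ger0_norm ?F_ge0 //; apply: H hs.
- move=> g' s' hs'; rewrite ger0_norm ?F_ge0 //.
  have -> : beta * N s' = 27 / lowc (6 * v0) * (N s' / phi) by rewrite /beta; field; rewrite !gt_eqF.
  by apply: F_base => //; rewrite [(6 * v0)%N]mulnC expnM.
- move=> g' s' hs'; rewrite ger0_norm ?F_ge0 //; apply: le_trans (F_le R Y g' (ltnW hs')) _.
  have -> : beta * N (Y ^ v0) = 27 / lowc (6 * v0) * (N (Y ^ v0) / phi) by rewrite /beta; field; rewrite !gt_eqF.
  by apply: F_base => //; rewrite leqnn YX_le //; clear; lia.
Qed.
End Regularity.

(** * Moduli that are a small power of the smoothness bound *)

Section SmallModulus.
Variable R : realType.
Variables (Y q Q D : nat) (eta : R).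
Notation lnn := (lnn R).
Notation cls := (cls q).
Notation gT := {unit 'Z_q}.
Notation F := (@F R Y q).
Notation cnt := (@cnt R q).
Notation rough := (pnat (lep Y)^').
Notation copr := (fun n => coprime n q).
Hypothesis q1 : (1 < q)%N.
Hypothesis qY : (q <= Y)%N.
Hypothesis D0 : (0 < D <= Y)%N.
Hypothesis eta0 : 0 <= eta.
(** Three errors made small: rounding for arguments beyond [Q], the harmonic mass of cofactors up to
    [Q] against the density of the sieve of level [D], and the remainder of that sieve at size
    [Y]. *)
Hypothesis hQ : 4 * q%:R <= eta * Q%:R.
Hypothesis hS : hsum R copr Q <= eta * hsum R copr D.
Hypothesis hD : 6 * Q%:R * D%:R ^+ 6 * q%:R <= eta * Y%:R.

Lemma partC_eq1 (pi : nat_pred) m : (0 < m)%N -> (m`_pi^' == 1)%N = pi.-nat m.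
Proof.
move=> m0; apply/eqP/idP => [h|h]; last by apply: part_p'nat; rewrite pnatNK.
by rewrite -(partnC pi m0) h muln1 part_pnat.
Qed.

Lemma rough_smooth_sum (V : nmodType) (f : nat -> V) s :
  \sum_(1 <= n < s.+1) f n =
  \sum_(1 <= r < s.+1 | rough r) \sum_(1 <= m < (s %/ r).+1 | (lep Y).-nat m) f (r * m)%N.
Proof.
rewrite (partition_sum_nat (g := fun n => (n`_(lep Y)^')%N) (X' := s) (Q := rough)); last first.
  move=> n /andP[n0 nX] _; rewrite part_pnat part_gt0 andbT /=.
  by apply: leq_ltn_trans nX; apply: dvdn_leq => //; apply: dvdn_part.
rewrite [LHS]big_nat_cond [RHS]big_nat_cond; apply: eq_bigr => r /andP[/andP[r0 _] hr].
rewrite (eq_bigl (fun n => (r %| n)%N && (n`_(lep Y)^' == r)%N)); last first.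
  move=> n /=; apply/idP/andP => [/eqP h|[]//]; rewrite h eqxx; split => //.
  by rewrite -h dvdn_part.
rewrite big_mkcondr sum_multiples // [RHS]big_mkcond; apply: eq_big_nat => m /andP[m0 _].
by rewrite partnM // part_pnat_id // -{2}(muln1 r) eqn_pmul2l // partC_eq1.
Qed.

Lemma rough_coprime r : rough r -> coprime r q.
Proof. by apply: lep_pnat'_coprime; rewrite qY ltnW. Qed.

(** Each integer is uniquely a rough number times a smooth one, and [q <= Y] makes the rough factor
    coprime to [q]. *)
Lemma cnt_rough (a : gT) s :
  cnt a s = \sum_(1 <= r < s.+1 | rough r) F (a * (cls r)^-1)%g (s %/ r)%N.
Proof.
rewrite /cnt big_mkcond rough_smooth_sum [LHS]big_nat_cond [RHS]big_nat_cond.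
apply: eq_bigr => r /andP[/andP[r0 _] hr]; rewrite /F -big_mkcondr.
have cr := rough_coprime hr.
apply: eq_bigl => m; rewrite natr_eq_unit // coprimeMl cr /= /Sm.
case: (lep Y).-nat => //=; case cm: (coprime m q) => //=.
rewrite clsM // -(inj_eq (mulIg (cls r)^-1%g)) /=.
by rewrite (unit_mulC (cls r)) mulgK.
Qed.

Lemma F_cnt (a : gT) s : (s <= Y)%N -> F a s = cnt a s.
Proof.
move=> sY; rewrite /F /cnt [LHS]big_nat_cond [RHS]big_nat_cond; apply: eq_bigl => n.
case: (boolP (0 < n < s.+1)%N) => //= /andP[n0 ns].
rewrite natr_eq_unit // /Sm lep_nat_leq // n0 /=; apply: leq_trans sY; exact: ns.
Qed.

(** The summations are exchanged: for a smooth cofactor [m <= Q], the rough [r <= s / m] lie in a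
    single class and are [D]-rough, so the sieve applies. The remaining sum of [1 / m] is small
    against the sieve density by [hS]. *)
Lemma boundary (a : gT) s :
  \sum_(1 <= r < s.+1 | rough r && (s %/ r < Q)%N) F (a * (cls r)^-1)%g (s %/ r)%N <=
  s%:R / q%:R * eta + 6 * Q%:R * D%:R ^+ 6.
Proof.
have /andP[D1 DY] := D0.
have S1 : 1 <= hsum R copr D by apply: hsum_ge1; rewrite ?coprime1n.
have q0 : 0 < q%:R :> R by rewrite ltr0n ltnW.
apply: le_trans (_ : \sum_(1 <= m < Q.+1 | copr m)
    \sum_(1 <= r < (s %/ m).+1 | (r%:R == val (a * (cls m)^-1)%g) && (lep D)^'.-nat r) 1 <= _).
  apply: le_trans (_ : \sum_(1 <= r < s.+1 | rough r) \sum_(1 <= m < Q.+1 | copr m)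
     (if (m <= s %/ r)%N && (cls m == a * (cls r)^-1)%g then 1 else 0) <= _).
    rewrite big_mkcondr [leLHS]big_nat_cond [leRHS]big_nat_cond.
    apply: ler_sum => r /andP[/andP[r0 _] hr]; case: ifP => hs; last first.
      by apply: sumr_ge0 => m _; case: ifP.
    rewrite -big_mkcondr /F; apply: ler_sum_nat_sub => // m /andP[m0 ms] /andP[/andP[_ cm] hm].
    rewrite m0 cm hm andbT /= (_ : (m <= s %/ r)%N) // andbT ltnS.
    by apply: leq_trans (ltnW hs).
  rewrite exchange_big_nat /= [leLHS]big_nat_cond [leRHS]big_nat_cond.
  apply: ler_sum => m /andP[/andP[m0 _] cm]; rewrite -big_mkcondr.
  apply: ler_sum_nat_sub => // r /andP[r0 rs] /andP[hr /andP[ms hm]].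
  have E := natr_eq_unit q1 r (a * (cls m)^-1)%g; rewrite /= in E.
  rewrite E (rough_coprime hr) r0 /= ltnS leq_divRL // mulnC -leq_divRL // ms /=.
  rewrite (eqP hm) invMg invgK; apply/andP; split.
    by rewrite (unit_mulC (cls r)) mulgA mulgV mul1g eqxx.
  apply: sub_in_pnat hr => p _; rewrite !inE -!ltnNge => h; apply: leq_ltn_trans h; exact: DY.
apply: le_trans (_ : \sum_(1 <= m < Q.+1 | copr m) (s%:R / q%:R / hsum R copr D * m%:R^-1 + 6 * D%:R ^+ 6) <= _).
  rewrite [leLHS]big_nat_cond [leRHS]big_nat_cond; apply: ler_sum => m /andP[/andP[m0 _] _].
  apply: le_trans (selberg_sieve R q1 (a * (cls m)^-1)%g D1 (leq0n (s %/ m))) _.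
  rewrite subr0 lerD2r.
  have -> : s%:R / q%:R / hsum R copr D * m%:R^-1 = s%:R / m%:R / q%:R / hsum R copr D by ring.
  rewrite ler_wpM2r ?invr_ge0 ?hsum_ge0 // ler_wpM2r ?invr_ge0 ?(ltW q0) //; exact: trunc_div_le.
rewrite big_split /= -mulr_sumr -/(hsum R copr Q); apply: lerD.
  have hS0 : 0 < hsum R copr D by lra.
  by rewrite -[leLHS]mulrA ler_wpM2l ?divr_ge0 ?(ltW q0) // ler_pdivrMl // [leRHS]mulrC.
rewrite mulrAC -[leRHS]mulrC.
have d6 : 0 <= 6 * D%:R ^+ 6 :> R by rewrite mulr_ge0 ?exprn_ge0.
apply: le_trans (_ : \sum_(1 <= m < Q.+1) 6 * D%:R ^+ 6 <= _).
  by rewrite big_mkcond; apply: ler_sum => m _; case: ifP.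
by rewrite sumr_const_nat subSS subn0 -[_ *+ Q]mulr_natr mulrC.
Qed.

(** The accumulated constant of [small_diff]: rough [r <= Y ^ i.+1] have harmonic sum at most
    [i + 3], and the last 3 collects one rounding error and two boundary errors. *)
Fixpoint dl (i : nat) : R := if i is i'.+1 then (i'%:R + 3) * dl i' + 3 else 1.

Lemma dl_ge1 i : 1 <= dl i.
Proof.
elim: i => //= i IH; have i0 : 0 <= i%:R :> R by [].
have : 0 <= (i%:R + 3) * dl i by rewrite mulr_ge0 //; lra.
lra.
Qed.

Hypothesis Y2 : 1 <= lnn Y.

(* Induction on [i], sorting all integers by their [Y]-rough part [r]: the terms
   with [s / r < Q] are sieved, the others have [s / r <= Y ^ i.-1]. *)
Lemma small_diff i s (a b : gT) : (Q <= s <= Y ^ i)%N -> `|F a s - F b s| <= dl i * eta * (s%:R / q%:R).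
Proof.
have q0 : 0 < q%:R :> R by rewrite ltr0n ltnW.
have Y0 : (0 < Y)%N by apply: leq_trans qY; apply: ltnW.
have c4 (a' b' : gT) t : (Q <= t)%N -> `|cnt a' t - cnt b' t| <= eta * (t%:R / q%:R).
  move=> Qt; apply: le_trans (_ : 4 <= _).
    have /ler_normlP[x1 x2] := cnt_approx R q1 a' t; have /ler_normlP[x3 x4] := cnt_approx R q1 b' t.
    by rewrite ler_norml; apply/andP; split; lra.
  rewrite mulrA ler_pdivlMr //; apply: le_trans hQ _; by rewrite ler_wpM2l // ler_nat.
have base t (a' b' : gT) j : (Q <= t)%N -> (t <= Y)%N -> `|F a' t - F b' t| <= dl j * eta * (t%:R / q%:R).
  move=> Qt tY; rewrite !F_cnt //; apply: le_trans (c4 a' b' t Qt) _.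
  by rewrite -mulrA ler_peMl ?dl_ge1 // mulr_ge0 // divr_ge0 // ltW.
elim: i s a b => [|i IH] s a b /andP[Qs sY].
  by apply: base => //; apply: leq_trans sY _; rewrite expn0.
case: (leqP s Y) => hs; first exact: base.
have s0 : (0 < s)%N by apply: leq_trans hs.
have key (a' : gT) : F a' s = cnt a' s - \sum_(2 <= r < s.+1 | rough r) F (a' * (cls r)^-1)%g (s %/ r)%N.
  rewrite cnt_rough [X in _ = X - _]big_ltn_cond //= divn1 cls1 // invg1 mulg1.
  by rewrite addrK.
set Ra := fun a' : gT => \sum_(2 <= r < s.+1 | rough r && (s %/ r < Q)%N) F (a' * (cls r)^-1)%g (s %/ r)%N.
have Rb a' : 0 <= Ra a' <= s%:R / q%:R * eta + 6 * Q%:R * D%:R ^+ 6.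
  apply/andP; split; first by apply: sumr_ge0 => r _; apply: F_ge0.
  apply: le_trans (boundary a' s); rewrite /Ra [leRHS]big_ltn_cond //=.
  by case: ifP => _; rewrite ?lexx // lerDr F_ge0.
have e (a' : gT) : F a' s = cnt a' s - \sum_(2 <= r < s.+1 | rough r && (Q <= s %/ r)%N) F (a' * (cls r)^-1)%g (s %/ r)%N - Ra a'.
  rewrite key (bigID (fun r => (Q <= s %/ r)%N)) /= opprD addrA; congr (_ - _).
  by rewrite /Ra; apply: eq_bigl => r; rewrite -ltnNge.
have h1 : `|\sum_(2 <= r < s.+1 | rough r && (Q <= s %/ r)%N) F (a * (cls r)^-1)%g (s %/ r)%N -
    \sum_(2 <= r < s.+1 | rough r && (Q <= s %/ r)%N) F (b * (cls r)^-1)%g (s %/ r)%N| <=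
    (i%:R + 3) * dl i * eta * (s%:R / q%:R).
  rewrite -sumrB; apply: le_trans (ler_norm_sum _ _ _) _.
  apply: le_trans (_ : \sum_(2 <= r < s.+1 | rough r) dl i * eta * (s%:R / q%:R) * r%:R^-1 <= _).
    rewrite big_mkcondr [leLHS]big_nat_cond [leRHS]big_nat_cond.
    apply: ler_sum => r /andP[/andP[r2 rs] hr].
    have r0 : 0 < r%:R :> R by rewrite ltr0n; apply: leq_trans r2.
    have nn : 0 <= dl i * eta * (s%:R / q%:R) * r%:R^-1.
      by rewrite !mulr_ge0 ?invr_ge0 //; have := dl_ge1 i; lra.
    case: ifP => // hQr; apply: le_trans (IH _ _ _ _) _.
      rewrite hQr /= -ltnS ltn_divLR ?(leq_trans _ r2) //.
      have rY : (Y < r)%N.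
        have := @pnatPpi _ _ (pdiv r) hr; rewrite pi_pdiv.
        move=> /(_ r2); rewrite inE /= inE -ltnNge => h.
        exact: leq_trans h (dvdn_leq (ltnW r2) (pdiv_dvd r)).
      have h : (Y * Y ^ i <= Y ^ i * r)%N by rewrite mulnC leq_mul2l (ltnW rY) orbT.
      apply: leq_ltn_trans sY _; rewrite expnS; apply: leq_ltn_trans h _.
      by rewrite mulSn -[ltnLHS]add0n ltn_add2r (leq_trans _ r2).
    rewrite -[leRHS]mulrA ler_wpM2l //; first by rewrite mulr_ge0 //; have := dl_ge1 i; lra.
    rewrite mulrAC ler_wpM2r ?invr_ge0 ?(ltW q0) //; apply: trunc_div_le; exact: leq_trans r2.
  rewrite -mulr_sumr.
  have hr : \sum_(2 <= r < s.+1 | rough r) r%:R^-1 <= i%:R + 3 :> R.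
    apply: le_trans (_ : hsum R rough s <= _).
      rewrite /hsum; apply: ler_sum_nat_sub => [r|r /andP[r2 ->] ->]; first by rewrite invr_ge0.
      by rewrite (leq_trans _ r2).
    have h := hsum_rough_le R Y s; have lY : 0 < lnn Y := lt_le_trans ltr01 Y2; have lY1 := Y2.
    rewrite -(ler_pM2r lY); apply: le_trans h _; rewrite lnnM //.
    have : lnn s <= (i%:R + 1) * lnn Y by rewrite natr1 -lnnX ?lnn_le.
    lra.
  have nn : 0 <= dl i * eta * (s%:R / q%:R).
    by rewrite !mulr_ge0 ?invr_ge0 //; have := dl_ge1 i; lra.
  apply: le_trans (ler_wpM2l nn hr) _.
  by rewrite le_eqVlt; apply/orP; left; apply/eqP; ring.
have h2 := c4 a b s Qs.
have h3 : 6 * Q%:R * D%:R ^+ 6 <= eta * (s%:R / q%:R).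
  rewrite [leRHS]mulrA ler_pdivlMr //; apply: le_trans hD _; by rewrite ler_wpM2l // ler_nat ltnW.
have /andP[ra1 ra2] := Rb a; have /andP[rb1 rb2] := Rb b.
rewrite (e a) (e b).
move: h1 h2 h3 ra1 ra2 rb1 rb2; rewrite [s%:R / q%:R * eta]mulrC.
have -> : dl i.+1 * eta * (s%:R / q%:R) = (i%:R + 3) * dl i * eta * (s%:R / q%:R) + 3 * (eta * (s%:R / q%:R)).
  by rewrite /=; ring.
move: (\sum_(2 <= r < s.+1 | _) _) (\sum_(2 <= r < s.+1 | _) _) (Ra a) (Ra b) (cnt a s) (cnt b s).
move: (eta * (s%:R / q%:R)) ((i%:R + 3) * dl i * eta * (s%:R / q%:R)) (6 * Q%:R * D%:R ^+ 6).
move=> z1 z2 z3 x1 x2 x3 x4 x5 x6 /ler_normlP[h1 h1'] /ler_normlP[h2 h2'] h3 ra1 ra2 rb1 rb2.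
by rewrite ler_norml; apply/andP; split; lra.
Qed.
End SmallModulus.

(** * Choice of the parameters for small moduli *)

Section SmallModulusUniform.
Variable R : realType.
Notation lnn := (lnn R).

Lemma exp2_ge (C : R) : exists n : nat, C <= 2 ^+ n.
Proof.
exists (Num.truncn C).+1; apply: ltW; apply: lt_le_trans (truncnS_gt C) _.
by rewrite -natrX ler_nat ltnW // ltn_expl.
Qed.

(** All parameters are powers of [q]. The exponent [b] makes [q / Q] small, [m] makes the harmonic
    sum up to [D = Q ^ m.+1] much larger than that up to [Q], and [R0] adds up the exponents in
    [q ^ c * Q * D ^ 6 * q]. *)
Lemma small_modulus i (delta : R) : 0 < delta -> exists R0 : nat, forall Y q : nat,
  (1 < q)%N -> (q ^ R0 <= Y)%N -> forall (a b : {unit 'Z_q}) s, (Y <= s <= Y ^ i)%N ->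
  `|F R Y a s - F R Y b s| <= delta * (s%:R / q%:R).
Proof.
move=> d0; have d1 := dl_ge1 R i.
pose eta := delta / dl R i; have eta0 : 0 < eta by rewrite divr_gt0 //; lra.
have [b0 hb0] := exp2_ge (4 / eta).
(* The summand 25 ensures [lnn Q >= 25 / 2], above the 12 required by [hsum_coprime_long]. *)
pose b := (b0 + 25)%N.
have [m hm] : exists m : nat, 8 / eta <= m%:R.
  by exists (Num.truncn (8 / eta)).+1; apply/ltW/truncnS_gt.
have [c hc] := exp2_ge (6 / eta).
exists (c + (b + (b * m.+1 * 6 + 1)))%N => Y q q1 hY a b' s /andP[Ys sY].
have q2 : (2 <= q)%N by [].
have q0 := ltnW q1.
pose Q := (q ^ b)%N; pose D := (Q * Q ^ m)%N.
have DE : D = (q ^ (b * m.+1))%N by rewrite /D /Q -expnM -expnD mulnS.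
have pe n k : (n <= k)%N -> (q ^ n <= q ^ k)%N by move=> h; rewrite leq_exp2l.
have qn n : (2 ^ n <= q ^ n)%N by case: n => // n; rewrite leq_exp2r.
have Q0 : (0 < Q)%N by rewrite expn_gt0 q0.
have b1 : (1 <= b)%N by rewrite /b addn_gt0 orbT.
have QY : (Q <= Y)%N by apply: leq_trans hY; apply: pe; rewrite addnCA leq_addr.
have qQ : (q <= Q)%N by rewrite -{1}(expn1 q) pe.
have DY : (D <= Y)%N.
  rewrite DE; apply: leq_trans hY; apply: pe; move: (b * m.+1)%N; clear; lia.
have D0 : (0 < D)%N by rewrite DE expn_gt0 q0.
have q0r : 0 < q%:R :> R by rewrite ltr0n.
have lQ : 12 <= lnn Q.
  rewrite /Q lnnX //; have h2 := lnn2_ge R; have h3 := lnn_le R q2.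
  have b25 : 25 <= b%:R :> R by rewrite ler_nat /b leq_addl.
  apply: le_trans (_ : 25 * 2^-1 <= _); first by lra.
  by apply: ler_pM => //; lra.
have h1 : 4 * q%:R <= eta * Q%:R.
  apply: le_trans (_ : eta * (2 ^ b0 * q)%:R <= _).
    rewrite natrM mulrA ler_wpM2r // natrX mulrC -ler_pdivrMr //.
  rewrite ler_wpM2l ?(ltW eta0) // ler_nat /Q expnD leq_mul // -{1}(expn1 q) pe //.
have h2 : hsum R (fun n => coprime n q) Q <= eta * hsum R (fun n => coprime n q) D.
  have := @hsum_coprime_long R q Q (Q ^ m) lQ; rewrite q0 qQ => /(_ isT); rewrite -/D lnnX //.
  have := hsum_ge0 R (fun n => coprime n q) Q; have := hsum_ge0 R (fun n => coprime n q) D.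
  move: (hsum R _ Q) (hsum R _ D) => x y y0 x0 h.
  have l0 : 0 < lnn Q by lra.
  have h3 : x * m%:R <= 8 * y.
    rewrite -(ler_pM2r l0) -mulrA; apply: le_trans h _.
    have -> : 8 * y * lnn Q = 8 * lnn Q * y by ring.
    by rewrite ler_wpM2r //; lra.
  have h4 : 8 <= m%:R * eta by rewrite -ler_pdivrMr.
  have h5 : x * 8 <= x * (m%:R * eta) by rewrite ler_wpM2l.
  have h6 : eta * (x * m%:R) <= eta * (8 * y) by rewrite ler_wpM2l // ltW.
  have e1 : x * (m%:R * eta) = eta * (x * m%:R) by ring.
  have e2 : eta * (8 * y) = 8 * (eta * y) by ring.
  by move: h5 h6; rewrite e1 e2; lra.
have h3 : 6 * Q%:R * D%:R ^+ 6 * q%:R <= eta * Y%:R.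
  have hq : 6 <= eta * (q ^ c)%:R.
    rewrite mulrC -ler_pdivrMr //; apply: le_trans hc _; by rewrite -natrX ler_nat qn.
  apply: le_trans (_ : eta * (q ^ c * (Q * (D ^ 6 * q)))%:R <= _); last first.
    rewrite ler_wpM2l ?(ltW eta0) // ler_nat; apply: leq_trans hY.
    by rewrite DE /Q -expnM -expnSr -!expnD addn1.
  have -> : eta * (q ^ c * (Q * (D ^ 6 * q)))%:R = eta * (q ^ c)%:R * (Q%:R * D%:R ^+ 6 * q%:R).
    by rewrite !natrM natrX; ring.
  have -> : 6 * Q%:R * D%:R ^+ 6 * q%:R = 6 * (Q%:R * D%:R ^+ 6 * q%:R) :> R by ring.
  by rewrite ler_wpM2r // !mulr_ge0 ?exprn_ge0.
have lY : 1 <= lnn Y by have := lnn_le R QY; lra.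
have DD0 : (0 < D <= Y)%N by rewrite D0 DY.
have := @small_diff R Y q Q D eta q1 (leq_trans qQ QY) DD0 (ltW eta0) h1 h2 h3 lY i s a b'.
rewrite (leq_trans QY Ys) sY => /(_ isT) h; apply: le_trans h _.
rewrite le_eqVlt; apply/orP; left; apply/eqP; rewrite /eta; field.
by rewrite gt_eqF ?gt_eqF //; lra.
Qed.
End SmallModulusUniform.

(** * Bounded smoothness bounds *)

Section FixedSmoothness.
Variable R : realType.
Variables (Y q : nat).
Hypothesis q1 : (1 < q)%N.
Notation cls := (cls q).
Notation gT := {unit 'Z_q}.
Notation F := (@F R Y q).
Notation N := (N R Y q).
Notation Sm := (Sm Y q).

Lemma count_multiples p a t : pr q p -> (p <= Y)%N ->
  \sum_(1 <= n < t.+1 | Sm n && (p ^ a %| n)%N) 1 = N (t %/ p ^ a).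
Proof.
move=> hp pY; have p0 : (0 < p ^ a)%N by rewrite expn_gt0 prime_gt0 //; case/andP: hp.
rewrite (eq_bigl (fun n => (p ^ a %| n)%N && Sm n)); last by move=> n; rewrite andbC.
rewrite big_mkcondr sum_multiples // /N [RHS]big_mkcond; apply: eq_big_nat => n /andP[n0 _].
by rewrite SmM // Sm_primeX.
Qed.

(** For [1 <= j <= J], division by [p ^ (j * m)] maps these numbers into []x / p ^ (j * m), x / p ^
    ((j - 1) * m)]], because [m <= p ^ m]. These [J] intervals are disjoint and lie below [x]. *)
Lemma shell_prime p m J x : pr q p -> (p <= Y)%N -> (0 < m)%N ->
  J%:R * \sum_(x.+1 <= n < (m * x).+1 | Sm n && (p ^ (J * m) %| n)%N) 1 <= N x.
Proof.
move=> hp pY m0; have p1 : (1 < p)%N by apply: prime_gt1; case/andP: hp.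
have pj a : (0 < p ^ a)%N by rewrite expn_gt0 ltnW.
have xm : (x <= m * x)%N by rewrite leq_pmull.
set E := \sum_(x.+1 <= n < _ | _) 1.
have h j : (1 <= j <= J)%N -> E <= N (x %/ p ^ (j.-1 * m)) - N (x %/ p ^ (j * m)).
  move=> /andP[j0 jJ].
  apply: le_trans (_ : N (m * x %/ p ^ (j * m)) - N (x %/ p ^ (j * m)) <= _); last first.
    rewrite lerD2r; apply: N_le; case: j j0 jJ => // j _ _ /=.
    rewrite mulSn expnD; apply: leq_trans (_ : m * x %/ (m * p ^ (j * m)) <= _)%N.
      by apply: leq_div2l; rewrite ?muln_gt0 ?m0 ?pj // leq_mul2r ltnW ?orbT // ltn_expl.
    by rewrite divnMl.
  rewrite -!count_multiples // lerBrDr addrC.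
  rewrite [leRHS](big_cat_nat (n := x.+1)) //= lerD2l.
  apply: ler_sum_nat_sub => // n -> /andP[-> h]; rewrite /=.
  by apply: dvdn_trans h; rewrite dvdn_exp2l // leq_mul2r jJ orbT.
have -> : J%:R * E = \sum_(1 <= j < J.+1) E.
  by rewrite sumr_const_nat subSS subn0 mulr_natl.
apply: le_trans (_ : \sum_(1 <= j < J.+1) (N (x %/ p ^ (j.-1 * m)) - N (x %/ p ^ (j * m))) <= _).
  by apply: ler_sum_nat => j hj; apply: h.
have -> : \sum_(1 <= j < J.+1) (N (x %/ p ^ (j.-1 * m)) - N (x %/ p ^ (j * m))) = N x - N (x %/ p ^ (J * m)).
  elim: (J) => [|j IH]; first by rewrite big_geq // mul0n expn0 divn1 subrr.
  by rewrite big_nat_recr //= IH; ring.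
by rewrite gerBl N_ge0.
Qed.

(** If every prime of [n] occurred fewer than [e] times, [n] would be a product of at most [Y]
    factors, each at most [Y ^ e]. *)
Lemma big_prime_power n e : Sm n -> (0 < n)%N -> (0 < Y)%N -> (Y ^ (e * Y) < n)%N ->
  exists p, [/\ pr q p, (p <= Y)%N & (p ^ e %| n)%N].
Proof.
move=> /andP[sn cn] n0 Y0 hn; apply: contrapT => hx.
have small p : p \in primes n -> (p ^ logn p n <= Y ^ e)%N.
  move=> hp; have pY : (p <= Y)%N by move: sn; rewrite lep_natE => /andP[_ /allP]; apply.
  move: (hp); rewrite mem_primes => /and3P[pp _ pn].
  have le : (logn p n < e)%N.
    rewrite ltnNge; apply/negP => h; apply: hx; exists p; split=> //.
      by rewrite /pr pp (coprime_dvdl pn).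
    by apply: dvdn_trans (pfactor_dvdnn p n); rewrite dvdn_exp2l.
  apply: leq_trans (_ : Y ^ logn p n <= _)%N; first by case: (logn p n) => // m; rewrite leq_exp2r.
  by rewrite leq_pexp2l // ltnW.
move: hn; rewrite ltnNge => /negP; apply.
rewrite {1}(prod_prime_decomp n0) prime_decompE big_map /=.
apply: leq_trans (_ : \prod_(p <- primes n) Y ^ e <= _)%N.
  by rewrite big_seq [leqRHS]big_seq; apply: leq_prod => p hp; apply: small.
rewrite big_const_seq count_predT iter_muln muln1 -expnM leq_pexp2l // leq_mul2l.
apply/orP; right; rewrite -[leqRHS](size_iota 1 Y); apply: uniq_leq_size; first exact: primes_uniq.
move=> p hp; rewrite mem_iota add1n ltnS.
have -> : (p <= Y)%N by move: sn; rewrite lep_natE => /andP[_ /allP]; apply.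
by move: hp; rewrite mem_primes andbT => /andP[/prime_gt0].
Qed.

(* A large smooth number is divisible by a high power of some prime [p]; dividing
   by successive powers of [p] gives many disjoint copies of the shell below [x]. *)
Lemma shell_small m (eps : R) : (0 < m)%N -> 0 < eps -> (0 < Y)%N ->
  exists x0, forall x, (x0 <= x)%N -> N (m * x) - N x <= eps * N x.
Proof.
move=> m0 e0 Y0; have [J hJ] : exists J : nat, Y%:R / eps <= J%:R.
  by exists (Num.truncn (Y%:R / eps)).+1; apply/ltW/truncnS_gt.
exists (Y ^ (J * m * Y))%N => x hx.
have Y0r : 0 < Y%:R :> R by rewrite ltr0n.
have J0 : 0 < J%:R :> R by apply: lt_le_trans hJ; rewrite divr_gt0.
have xm : (x <= m * x)%N by rewrite leq_pmull.
have -> : N (m * x) - N x = \sum_(x.+1 <= n < (m * x).+1 | Sm n) 1.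
  by rewrite /N [X in X - _](big_cat_nat (n := x.+1)) //= addrAC subrr add0r.
apply: le_trans (_ : \sum_(1 <= p < Y.+1 | pr q p) \sum_(x.+1 <= n < (m * x).+1 | Sm n && (p ^ (J * m) %| n)%N) 1 <= _).
  under [leRHS]eq_bigr do rewrite big_mkcondr.
  rewrite exchange_big_nat /= [leLHS]big_nat_cond [leRHS]big_nat_cond.
  apply: ler_sum => n /andP[/andP[xn _] sn].
  have [|||p [hp pY pn]] := @big_prime_power n (J * m) sn.
  - by apply: leq_trans xn.
  - by [].
  - by apply: leq_ltn_trans xn.
  rewrite big_mkcond (bigD1_seq p) ?iota_uniq //=; last first.
    by rewrite mem_index_iota ltnS pY prime_gt0 //; case/andP: hp.
  rewrite hp pn lerDl; apply: sumr_ge0 => p' _; case: ifP => // _; by case: ifP.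
apply: le_trans (_ : \sum_(1 <= p < Y.+1 | pr q p) N x / J%:R <= _).
  rewrite [leLHS]big_nat_cond [leRHS]big_nat_cond; apply: ler_sum => p /andP[/andP[_ pY] hp].
  by rewrite ler_pdivlMr // mulrC; apply: shell_prime.
have Nx := N_ge0 R Y q x.
apply: le_trans (_ : Y%:R * (N x / J%:R) <= _).
  rewrite -(sum_nat1 R) mulr_suml big_mkcond; apply: ler_sum => p _.
  by case: ifP => _; rewrite mul1r // divr_ge0 // ltW.
rewrite mulrCA mulrC ler_wpM2r // ler_pdivrMr // mulrC -ler_pdivrMr //.
Qed.

Lemma F_mul (g : gT) s x : Sm s -> (0 < s)%N -> F g x <= F (g * cls s)%g (s * x).
Proof.
move=> hs s0; rewrite /F.
apply: le_trans (_ : \sum_(1 <= n < (s * x).+1 | (s %| n)%N && (Sm n && (cls n == g * cls s)%g)) 1 <= _).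
  rewrite [leRHS]big_mkcondr sum_multiples // mulKn // big_mkcond.
  apply: ler_sum_nat => n /andP[n0 _]; case: ifP => [/andP[hn /eqP <-]|_]; last by case: ifP.
  rewrite SmM // hs hn /=; move: hs hn => /andP[_ cs] /andP[_ cn].
  by rewrite clsM // unit_mulC eqxx.
by apply: ler_sum_nat_sub => // n -> /andP[_ ->].
Qed.

(* Multiplication by [s] injects the class [g] below [x] into the class [g * h]
   below [s * x]. *)
Lemma fixed_smooth (h : gT) (eps : R) s : (0 < Y)%N -> Sm s -> (0 < s)%N -> cls s = h -> 0 < eps ->
  exists x0, forall x g, (x0 <= x)%N -> `|F g x - F (g * h)%g x| <= eps * N x.
Proof.
move=> Y0 hs s0 hh e0.
have one t (k : gT) : Sm t -> (0 < t)%N -> cls t = k ->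
    exists x0, forall x g, (x0 <= x)%N -> F g x - F (g * k)%g x <= eps * N x.
  move=> ht t0 hk; have [x0 H] := @shell_small t eps t0 e0 Y0.
  exists x0 => x g hx; apply: le_trans (H x hx).
  have xt : (x <= t * x)%N by rewrite leq_pmull.
  apply: le_trans (_ : F (g * k)%g (t * x) - F (g * k)%g x <= _).
    by rewrite lerD2r -hk F_mul.
  rewrite !(N_sum_F R Y q) -sumrB (bigD1 (g * k)%g) //= lerDl; apply: sumr_ge0 => g' _.
  by rewrite subr_ge0 F_le.
have [x1 H1] := one s h hs s0 hh.
(* The reverse inequality needs a smooth number in the class [h^-1]; a power of [s] is one. *)
have [x2 H2] : exists x0, forall x g, (x0 <= x)%N -> F g x - F (g * h^-1)%g x <= eps * N x.
  apply: (one (s ^ (#[h]%g).-1)%N).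
  - by move: hs => /andP[a b]; rewrite /Sm pnatX a /= coprimeXl.
  - by rewrite expn_gt0 s0.
  rewrite clsX //; last by case/andP: hs.
  by rewrite hh invg_expg.
exists (maxn x1 x2) => x g; rewrite geq_max => /andP[hx1 hx2].
have := H1 x g hx1; have := H2 x (g * h)%g hx2; rewrite mulgK => a1 a2.
by rewrite ler_norml; apply/andP; split; lra.
Qed.

Definition smooth_classes : {set gT} := [set h | `[< exists s, [/\ Sm s, (0 < s)%N & cls s = h] >] ].

Lemma smooth_classesP h : reflect (exists s, [/\ Sm s, (0 < s)%N & cls s = h]) (h \in smooth_classes).
Proof. by rewrite inE; apply: asboolP. Qed.

Lemma smooth_classes_group : group_set smooth_classes.
Proof.
apply/group_setP; split; first by apply/smooth_classesP; exists 1%N; rewrite Sm1 cls1.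
move=> g h /smooth_classesP[s [hs s0 <-]] /smooth_classesP[t [ht t0 <-]].
apply/smooth_classesP; exists (s * t)%N; rewrite SmM // hs ht muln_gt0 s0 t0 clsM //.
  by case/andP: hs.
by case/andP: ht.
Qed.
End FixedSmoothness.

(** * Combination of the three ranges *)

Section Assembly.
Variable R : realType.
Notation lnn := (lnn R).
Notation phi q := (totient q)%:R.

(** Proved without the largeness assumptions behind [tuple_count_supp], since it serves bounded
    [Y]. *)
Lemma tuple_count_Sm Y q B i M : tuple_count R Y q B i M != 0 -> Sm Y q M && (0 < M)%N.
Proof.
elim: i M => [|i IH] M.
  have -> : tuple_count R Y q B 0 M = (M == 1%N)%:R by [].
  by case: (M =P 1%N) => [-> _|_]; rewrite ?eqxx ?Sm1.
have -> : tuple_count R Y q B i.+1 M = \sum_(1 <= p < Y.+1 | win Y q B p && (p %| M)%N) tuple_count R Y q B i (M %/ p)%N by [].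
move=> h; have [p [pY wp pM rM]] : exists p, [/\ (p <= Y)%N, win Y q B p, (p %| M)%N & tuple_count R Y q B i (M %/ p)%N != 0].
  apply: contrapT => hn; move/eqP: h; apply; rewrite big_nat_cond big1 // => p.
  move=> /andP[/andP[_ pY] /andP[wp pM]]; apply/eqP; apply: contrapT => /negP hr.
  by apply: hn; exists p.
have /andP[s0 m0] := IH _ rM; have hp : pr q p by case/andP: wp.
have p0 : (0 < p)%N by apply: prime_gt0; case/andP: hp.
have eM : M = (p * (M %/ p))%N by rewrite mulnC divnK.
by rewrite eM SmM // Sm_prime // s0 muln_gt0 p0.
Qed.

Lemma bin_count_smooth Y q B T (g : {unit 'Z_q}) : (1 < q)%N -> bin_count R Y B T g != 0 -> g \in smooth_classes Y q.
Proof.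
move=> q1 h; have [M [/eqP hM rM]] : exists M, cls q M == g /\ tuple_count R Y q B B.+4 M != 0.
  apply: contrapT => hn; move/eqP: h; apply; rewrite /bin_count big1 // => M /andP[_ hM].
  by apply/eqP; apply: contrapT => /negP hr; apply: hn; exists M.
have /andP[s0 M0] := tuple_count_Sm rM.
by apply/smooth_classesP; exists M.
Qed.

(** A positive overlap provides [g] such that [g] and [g * h] are both classes of products of primes
    up to [Y]; [h] is their quotient. *)
Lemma corr_set_smooth Y q B : (1 < q)%N -> (<<corr_set R Y q B>> \subset smooth_classes Y q)%g.
Proof.
move=> q1; pose H := Group (smooth_classes_group Y q1).
suff : (corr_set R Y q B \subset H)%g by rewrite -gen_subG.
apply/subsetP => h; rewrite inE => hp.
have c0_pos := c0_gt0 R B.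
have [T hT] : exists T, overlap R Y B T h != 0.
  apply: contrapT => hn; move: hp; rewrite /correl big1 => [|T _]; first by lra.
  by apply/eqP; apply: contrapT => /negP hr; apply: hn; exists (T : nat); move: hr; apply: contra => /eqP ->; rewrite mulr0.
have [g hg] : exists g, Num.min (bin_count R Y B T g) (bin_count R Y B T (g * h)%g) != 0.
  apply: contrapT => hn; move/eqP: hT; apply; rewrite /overlap big1 // => g _.
  by apply/eqP; apply: contrapT => /negP hr; apply: hn; exists g.
have n0 x : 0 <= bin_count R Y B T x by apply: bin_count_ge0.
have g1 : g \in H.
  apply: (@bin_count_smooth Y q B T) => //; apply: contra hg => /eqP ->.
  by rewrite min_l.
have g2 : (g * h)%g \in H.
  apply: (@bin_count_smooth Y q B T) => //; apply: contra hg => /eqP ->.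
  by rewrite min_r.
by rewrite -(mulKg g h) groupM // groupV.
Qed.

Lemma regime_large (C : R) : exists Y1, forall Y, (Y1 <= Y)%N ->
  C <= lnn Y /\ C * lnn Y <= (rootn 7 Y)%:R.
Proof.
have [a ha] := ln_unbounded C; have [b hb] := @ln_pow_le_root R C 1 7.
exists (maxn a b) => Y; rewrite geq_max => /andP[h1 h2]; split; first exact: ha.
by have := hb Y h2; rewrite expr1.
Qed.

Definition Kreg B U : R := 2 ^+ 20 * (B%:R + 1) + 9 * U%:R / lowc R 6 + 8 * (16 * C1 R) * U%:R.

Lemma Kreg_parts B U : (0 < U)%N -> [/\ 2 ^+ 20 * (B%:R + 1) <= Kreg B U,
  9 * U%:R / lowc R 6 <= Kreg B U & 8 * (16 * C1 R) * U%:R <= Kreg B U].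
Proof.
move=> U0; have l := lowc_gt0 R (isT : 0 < 6)%N; have c := C1_ge1 R.
have x0 : 0 <= 2 ^+ 20 * (B%:R + 1) :> R by rewrite mulr_ge0 ?exprn_ge0 ?addr_ge0.
have y0 : 0 <= 9 * U%:R / lowc R 6 by apply: divr_ge0; [rewrite mulr_ge0|exact: ltW].
have z0 : 0 <= 8 * (16 * C1 R) * U%:R by rewrite !mulr_ge0 //; lra.
rewrite /Kreg; move: x0 y0 z0; move: (2 ^+ 20 * _) (9 * _ / _) (8 * _ * _) => x y z x0 y0 z0.
by split; lra.
Qed.

(** [corr_set] fills at least a proportion [c0 / 4] of the group; the inverse of this proportion
    bounds the index, and three times it the word length. *)
Definition growth_radius B := Num.truncn (4 / c0 R B).

Lemma corr_set_gen Y q B (K : R) : (1 < q)%N -> (q <= Y ^ B)%N -> Kreg B 1 <= K -> K <= lnn Y ->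
  K * lnn Y <= (rootn 7 Y)%:R ->
  (<<corr_set R Y q B>> = corr_set R Y q B ^+ (3 * growth_radius B))%g /\ (#|[set: {unit 'Z_q}] : <<corr_set R Y q B>>|%g <= growth_radius B)%N.
Proof.
move=> q1 qY hK KL KD; have [k1 k2 k3] := @Kreg_parts B 1 isT.
have {}k1 := le_trans k1 hK; have {}k2 := le_trans k2 hK; have {}k3 := le_trans k3 hK.
have i1 := corr_set1 q1 qY k1 KL KD (isT : 0 < 1)%N k2 k3.
have ic := corr_set_card q1 qY k1 KL KD (isT : 0 < 1)%N k2 k3.
have iV := corr_setV R Y (q := q) B.
have c0_pos := c0_gt0 R B.
have hr : (#|[set: {unit 'Z_q}]| < (growth_radius B).+1 * #|corr_set R Y q B|)%N.
  rewrite (card_unit q1) -(ltr_nat R) natrM.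
  have Q0 : 0 < #|corr_set R Y q B|%:R :> R by rewrite ltr0n; apply/card_gt0P; exists 1%g.
  have := truncnS_gt (4 / c0 R B); rewrite -/(growth_radius B) => h.
  apply: le_lt_trans (_ : 4 / c0 R B * #|corr_set R Y q B|%:R < _); last by rewrite ltr_pM2r.
  have -> : 4 / c0 R B * #|corr_set R Y q B|%:R = #|corr_set R Y q B|%:R / (c0 R B / 4).
    by field; rewrite gt_eqF.
  by rewrite ler_pdivlMr 1?mulrC //; lra.
by split; [apply: gen_expgs|apply: gen_index].
Qed.

Lemma geom_decay (b c x : R) : 0 < c -> 0 < x -> exists n : nat, b * (1 + x)^-1 ^+ n <= c.
Proof.
move=> c0 x0; exists (Num.truncn (b / (c * x))).+1; set n := _.+1.
have h1 : b / (c * x) <= n%:R by apply/ltW/truncnS_gt.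
rewrite exprVn ler_pdivrMr ?exprn_gt0 //; last by lra.
apply: le_trans (_ : c * (1 + n%:R * x) <= _).
  rewrite ler_pdivrMr ?mulr_gt0 // in h1.
  have -> : c * (1 + n%:R * x) = c + n%:R * (c * x) by ring.
  lra.
rewrite ler_wpM2l ?(ltW c0) //; elim: (n) => [|k IH]; first by rewrite mul0r addr0 expr0.
have k0 : 0 <= k%:R :> R by [].
rewrite exprS; apply: le_trans (_ : (1 + x) * (1 + k%:R * x) <= _); last by rewrite ler_wpM2l //; lra.
rewrite -natr1; move: (k%:R : R) k0 => z z0.
have : 0 <= z * (x * x) by rewrite !mulr_ge0 // ltW.
have -> : (1 + x) * (1 + z * x) = 1 + (z + 1) * x + z * (x * x) by ring.
lra.
Qed.

Lemma mulf_div_inv (x u z : R) : 0 < u -> 0 < z -> x * (u / z) * (z / u) = x.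
Proof. by move=> u0 z0; field; rewrite !gt_eqF. Qed.

(** The choices are ordered: [C0] and [contr] depend on [B] alone, then [n] and [B'] on [eps], then
    the range [U], and at last [K] and the threshold [Y1], which may depend on [lowc U]. *)
Lemma large_case B (eps : R) : 0 < eps -> exists w Y1 : nat, forall Y q : nat, (Y1 <= Y)%N -> (1 < q)%N ->
  (q <= Y ^ B)%N -> forall (h g : {unit 'Z_q}) s, h \in <<corr_set R Y q B>>%g -> (Y ^ w <= s)%N ->
  `|F R Y g s - F R Y (g * h)%g s| <= eps * (N R Y q s / phi q).
Proof.
move=> e0.
pose v0 := (B + 2)%N; pose ell := (3 * growth_radius B)%N.
have v6 : (0 < 6 * v0)%N by rewrite /v0 muln_gt0 addn_gt0 orbT.
pose C0 : R := 54 / lowc R (6 * v0).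
have C00 : 0 < C0 by apply: divr_gt0 => //; exact: lowc_gt0.
pose bmin := eps / 2; pose bmax := 2 * C0 + bmin.
have bm : 0 < bmin by rewrite divr_gt0.
have th := contr_gt0 R B ell.
pose yy := contr R B ell / (8 * (3 + B.+4)%:R).
have yy0 : 0 < yy by rewrite divr_gt0 // mulr_gt0 ?ltr0n.
have [n hn] := @geom_decay bmax bmin yy bm yy0.
have [B' B'0 hB'] : exists2 B' : nat, (0 < B')%N & 3 * C0 <= bmin * (B'%:R - 3).
  exists (Num.truncn (3 * C0 / bmin)).+4 => //.
  have := truncnS_gt (3 * C0 / bmin); rewrite ltr_pdivrMr // => h.
  by rewrite -[(Num.truncn _).+4]addn3 natrD addrK [leRHS]mulrC ltW.
pose v := (v0 + 8 * (3 + B.+4))%N; pose w := (4 ^ n * v)%N; pose U := (w * B' + 6 * v0)%N.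
have U0 : (0 < U)%N by rewrite /U addn_gt0 v6 orbT.
have lU := lowc_gt0 R U0.
(* The size of [D] from which the errors stay below [bmin * contr / U], as [Herr] demands. *)
pose E : R := ((bmax + 1) * (81 / lowc R U) + B.+4%:R * C0) * (U%:R / (bmin * contr R B ell)).
have U0r : 0 < U%:R :> R by rewrite ltr0n.
have bt : 0 < bmin * contr R B ell by apply: mulr_gt0.
have bM0 : 0 <= bmax by rewrite /bmax; lra.
have X0 : 0 <= (bmax + 1) * (81 / lowc R U) + B.+4%:R * C0.
  apply: addr_ge0; last by rewrite mulr_ge0 // ltW.
  by apply: mulr_ge0; [lra|apply: divr_ge0 => //; exact: ltW].
have E0 : 0 <= E by apply: mulr_ge0 => //; apply: divr_ge0 => //; exact: ltW.
have [k1 k2 k3] := @Kreg_parts B U U0.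
have [_ _ _] := @Kreg_parts B 1 isT.
pose K := Kreg B U + Kreg B 1 + E + 1.
have P1 : 0 <= Kreg B 1.
  by have [a _ _] := @Kreg_parts B 1 isT; apply: le_trans a; rewrite mulr_ge0 ?exprn_ge0 ?addr_ge0.
have PU : 0 <= Kreg B U.
  by apply: le_trans k1; rewrite mulr_ge0 ?exprn_ge0 ?addr_ge0.
have KU : Kreg B U <= K by rewrite /K; lra.
have K1 : Kreg B 1 <= K by rewrite /K; lra.
have KE : E <= K by rewrite /K; lra.
have KK1 : 1 <= K by rewrite /K; lra.
have [Y1 HY] := regime_large K.
exists w, Y1 => Y q YY q1 qY h g s hh hs.
have [KL KD] := HY Y YY.
have [eg _] := corr_set_gen q1 qY K1 KL KD.
have KDD : K <= (rootn 7 Y)%:R by apply: le_trans KD; rewrite ler_peMr //; lra.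
have D0 : 0 < (rootn 7 Y)%:R :> R by lra.
have Qell (x y : {unit 'Z_q}) : x \in (corr_set R Y q B ^+ ell)%g -> y \in corr_set R Y q B -> (x * y)%g \in (corr_set R Y q B ^+ ell)%g.
  by rewrite -eg => hx hy; rewrite groupM // mem_gen.
have HF (x : {unit 'Z_q}) t : (Y ^ v0 <= t)%N -> F R Y x t <= C0 * (N R Y q t / phi q).
  move=> ht; apply: (F_all q1 qY (le_trans k1 KU) KL KD U0 (le_trans k2 KU) (le_trans k3 KU)) ht => //.
  by rewrite /U leq_addl.
have bb : bmin <= bmax by rewrite /bmax; lra.
have Herr : (bmax + 1) * eta R Y U + B.+4%:R * C0 / (rootn 7 Y)%:R <= bmin * contr R B ell / U%:R.
  apply: le_trans (_ : ((bmax + 1) * (81 / lowc R U) + B.+4%:R * C0) / (rootn 7 Y)%:R <= _).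
    rewrite [leRHS]mulrDl; apply: lerD => //; rewrite -[leRHS]mulrA; apply: ler_wpM2l; first by lra.
    rewrite /eta invfM mulrA; apply: ler_wpM2l; first by apply: divr_ge0 => //; exact: ltW.
    have Dn : (0 < rootn 7 Y)%N by rewrite -(ltr_nat R).
    have DY : (rootn 7 Y <= Y)%N.
      have /andP[h8 _] := rootnP 7 Y; apply: leq_trans h8.
      by rewrite -{1}(expn1 (rootn 7 Y)) leq_pexp2l.
    by rewrite lef_pV2 ?posrE ?ltr0n ?ler_nat // (leq_trans Dn).
  rewrite ler_pdivrMr //.
  have hE : E * (bmin * contr R B ell / U%:R) = (bmax + 1) * (81 / lowc R U) + B.+4%:R * C0.
    exact: mulf_div_inv.
  rewrite -hE mulrC ler_wpM2l //; first by apply: divr_ge0; exact: ltW.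
  by apply: le_trans KDD.
have hh' : h \in (corr_set R Y q B ^+ ell)%g by rewrite -eg.
have v00 : (v0 <= v)%N by rewrite leq_addr.
have v8 : (8 * (3 + B.+4) <= v)%N by rewrite leq_addl.
have h2C : 2 * C0 <= bmax by rewrite /bmax; lra.
have wU : (4 ^ n * v * B' <= U)%N by rewrite leq_addr.
have := final_decay q1 qY (le_trans k1 KU) KL KD U0 (le_trans k2 KU) (le_trans k3 KU) (leqnn v0) (ltW C00) HF Qell bm bb Herr v00 v8 h2C hn wU B'0 hB' g hh' hs.
by rewrite /discr /bmin; have -> : 2 * (eps / 2) = eps by field.
Qed.

Lemma uniform_bound (P : nat -> nat -> Prop) n :
  (forall i x x', (x <= x')%N -> P i x -> P i x') -> (forall i, (i < n)%N -> exists x, P i x) ->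
  exists x, forall i, (i < n)%N -> P i x.
Proof.
move=> mono; elim: n => [|n IH] h; first by exists 0%N.
have [x hx] := IH (fun i hi => h i (ltnW hi)); have [x' hx'] := h n (ltnSn n).
exists (maxn x x') => i; rewrite ltnS leq_eqVlt => /orP[/eqP ->|hi].
  by apply: mono hx'; rewrite leq_maxr.
by apply: mono (hx i hi); rewrite leq_maxl.
Qed.

(** Only finitely many pairs [Y], [q] occur, so the thresholds of [fixed_smooth], which depend on
    them, have a maximum. *)
Lemma fixed_case B Ym (eps : R) : 0 < eps -> exists X0, forall Y q, (0 < Y < Ym)%N -> (1 < q)%N ->
  (q <= Y ^ B)%N -> forall (h g : {unit 'Z_q}) s, h \in <<corr_set R Y q B>>%g -> (X0 <= s)%N ->
  `|F R Y g s - F R Y (g * h)%g s| <= eps * (N R Y q s / phi q).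
Proof.
move=> e0.
pose P2 Y q x := (1 < q)%N -> forall (h g : {unit 'Z_q}) s, h \in <<corr_set R Y q B>>%g -> (x <= s)%N ->
  `|F R Y g s - F R Y (g * h)%g s| <= eps * (N R Y q s / phi q).
have one Y q : (0 < Y)%N -> exists x, P2 Y q x.
  move=> Y0; case: (ltnP 1 q) => q1; last by exists 0%N; rewrite /P2 ltnNge q1.
  have p0 : 0 < phi q :> R by rewrite ltr0n totient_gt0 ltnW.
  have /choice[f hf] : forall h : {unit 'Z_q}, exists x0 : nat, h \in <<corr_set R Y q B>>%g ->
      forall x g, (x0 <= x)%N -> `|F R Y g x - F R Y (g * h)%g x| <= eps / phi q * N R Y q x.
    move=> h; case: (boolP (h \in <<corr_set R Y q B>>%g)) => hh; last by exists 0%N.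
    have /smooth_classesP[s [hs s0 es]] := subsetP (corr_set_smooth Y B q1) _ hh.
    have [x0 H] := @fixed_smooth R Y q q1 h (eps / phi q) s Y0 hs s0 es (divr_gt0 e0 p0).
    by exists x0.
  exists (\max_(h : {unit 'Z_q}) f h)%N => _ h g s hh hs.
  have := hf h hh s g (leq_trans (leq_bigmax h) hs).
  by rewrite mulrAC mulrA.
pose P1 Y x := (0 < Y)%N -> forall q, (q < (Ym ^ B).+1)%N -> P2 Y q x.
have m2 Y q x x' : (x <= x')%N -> P2 Y q x -> P2 Y q x'.
  by move=> xx H q1 h g s hh hs; apply: H => //; apply: leq_trans hs.
have m1 Y x x' : (x <= x')%N -> P1 Y x -> P1 Y x'.
  by move=> xx H Y0 q hq; apply: m2 xx _; apply: H.
have e1 Y : (Y < Ym)%N -> exists x, P1 Y x.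
  move=> _; case: (posnP Y) => [->|Y0]; first by exists 0%N.
  have [x hx] := uniform_bound (m2 Y) (fun q (_ : (q < (Ym ^ B).+1)%N) => one Y q Y0).
  by exists x => _ q hq; apply: hx.
have [X0 HX] := uniform_bound m1 e1.
exists X0 => Y q /andP[Y0 YYm] q1 qY; apply: HX => //; rewrite ltnS; apply: leq_trans qY _.
by case: (B) => // b; rewrite leq_exp2r // ltnW.
Qed.

Lemma all_cases B (eps : R) : 0 < eps -> exists Vn : nat, forall Y q X, (0 < Y)%N -> (1 < q)%N ->
  (q <= Y ^ B)%N -> (Y <= X)%N -> (q ^ Vn <= X)%N ->
  forall (h g : {unit 'Z_q}), h \in <<corr_set R Y q B>>%g ->
  `|F R Y g X - F R Y (g * h)%g X| <= eps * (N R Y q X / phi q).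
Proof.
move=> e0; have [w [Y1 H1]] := large_case B e0.
pose u := w.+1; have lu := lowc_gt0 R (isT : 0 < u)%N.
pose delta := eps * lowc R u / 9.
have d0 : 0 < delta by apply: divr_gt0 => //; apply: mulr_gt0.
have [R0 H2] := small_modulus u d0.
have [Y2 HY2] := regime_large (Kreg B 1).
pose Ym := maxn Y1 Y2.
have [X0 H3] := @fixed_case B Ym eps e0.
(* [X0] serves bounded [Y], through [X0 < q ^ X0]. [R0 * w] serves [X < Y ^ w]: then
   [q ^ (R0 * w) <= X] forces [q ^ R0 <= Y]. *)
exists (R0 * w + X0)%N => Y q X Y0 q1 qY YX qX h g hh.
case: (ltnP Y Ym) => hY.
  apply: H3 => //; first by rewrite Y0.
  apply: leq_trans qX; apply: leq_trans (_ : q ^ X0 <= _)%N; first exact: ltnW (ltn_expl X0 q1).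
  by rewrite leq_exp2l // leq_addl.
move: hY; rewrite geq_max => /andP[hY1 hY2].
case: (leqP (Y ^ w) X) => hX; first exact: H1.
have qR : (q ^ R0 <= Y)%N.
  rewrite leqNgt; apply/negP => hq.
  have : (X < q ^ (R0 * w))%N.
    apply: leq_trans hX _; rewrite expnM; case: (w) => // w'; by rewrite leq_exp2r // ltnW.
  apply/negP; rewrite -leqNgt; apply: leq_trans qX; by rewrite leq_exp2l // leq_addr.
have XU : (X <= Y ^ u)%N.
  by apply: leq_trans (ltnW hX) _; rewrite leq_pexp2l.
have := H2 Y q q1 qR g (g * h)%g X; rewrite YX XU => /(_ isT) hd; apply: le_trans hd _.
have [KL KD] := HY2 Y hY2; have [k1 k2 k3] := @Kreg_parts B 1 isT.
have low := @N_lower R Y q B _ q1 qY k1 KL KD u X isT.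
have D2 : (rootn 7 Y ^ 2 <= Y)%N.
  have /andP[h8 _] := rootnP 7 Y; apply: leq_trans h8.
  by case: (posnP (rootn 7 Y)) => [->|D0] //; rewrite leq_pexp2l.

rewrite (leq_trans D2 YX) XU in low; have {}low := low isT.
have p0 : 0 < phi q :> R by rewrite ltr0n totient_gt0 ltnW.
have q0 : 0 < q%:R :> R by rewrite ltr0n ltnW.
have hL := L_le q1 qY k1 KL KD; have lD := lnD_ge k1 KL KD.
have hS := S_phi R Y q1; have NX := N_ge0 R Y q X.
set S := hsum R _ _ in low hS; set lDD := lnn (rootn 7 Y) in hL lD hS.
have l0 : 0 < lDD by lra.
have e1 : lowc R u * X%:R * phi q <= 9 * (q%:R * N R Y q X).
  rewrite -(ler_pM2r l0).
  apply: le_trans (_ : q%:R * (lowc R u * (X%:R * S)) <= _).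
    have -> : lowc R u * X%:R * phi q * lDD = lowc R u * X%:R * (phi q * lDD) by ring.
    have -> : q%:R * (lowc R u * (X%:R * S)) = lowc R u * X%:R * (q%:R * S) by ring.
    by apply: ler_wpM2l => //; apply: mulr_ge0 => //; exact: ltW.
  apply: le_trans (_ : q%:R * (N R Y q X * (9 * lDD)) <= _); last first.
    by rewrite le_eqVlt; apply/orP; left; apply/eqP; ring.
  rewrite ler_wpM2l ?(ltW q0) //; apply: le_trans low _; by rewrite ler_wpM2l.
have -> : delta * (X%:R / q%:R) = eps * (lowc R u * X%:R * phi q / (9 * q%:R * phi q)).
  by rewrite /delta; field; rewrite !gt_eqF.
have -> : eps * (N R Y q X / phi q) = eps * (9 * (q%:R * N R Y q X) / (9 * q%:R * phi q)).
  by field; rewrite !gt_eqF.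
by rewrite ler_wpM2l ?(ltW e0) // ler_wpM2r // invr_ge0 !mulr_ge0 // ltW.
Qed.

End Assembly.

(** * From real parameters to natural numbers *)

Section Translation.
Variable R : realType.

Lemma smoothE (y : R) n : 0 <= y -> smooth y n = (lep (Num.truncn y)).-nat n.
Proof.
move=> y0; rewrite /smooth lep_natE; congr (_ && _); apply: eq_all => p.
by rewrite truncn_ge_nat.
Qed.

Lemma card_sum (P : pred nat) m : ~~ P 0%N ->
  #|[set n : 'I_m.+1 | P n]|%:R = \sum_(1 <= n < m.+1 | P n) 1 :> R.
Proof.
move=> P0; rewrite -sum1dep_card natr_sum.
rewrite -(big_mkord P (fun=> 1%:R)) big_mkcond big_ltn //= (negbTE P0) add0r -big_mkcond /=.
exact: eq_bigr.
Qed.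

Lemma Psi_coprimeE q (x y : R) : 0 <= y ->
  (Psi_coprime q x y)%:R = N R (Num.truncn y) q (Num.truncn x).
Proof.
move=> y0; rewrite /Psi_coprime (card_sum (P := fun n => coprime n q && smooth y n)); last by rewrite /smooth andbF.
by rewrite /N; apply: eq_bigl => n; rewrite smoothE // andbC.
Qed.

Lemma Psi_apE q (x y : R) (a : {unit 'Z_q}) : (1 < q)%N -> 0 <= y ->
  (Psi_ap x y q (val a))%:R = F R (Num.truncn y) a (Num.truncn x).
Proof.
move=> q1 y0; rewrite /Psi_ap (card_sum (P := fun n => (n%:R == val a) && smooth y n)); last by rewrite /smooth andbF.
rewrite /F; apply: eq_bigl => n; rewrite smoothE // natr_eq_unit // /Sm.
by rewrite andbC andbA.
Qed.

(** For [y >= 2] the square of the integer part of [y] is at least [y], so the passage to integers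
    doubles the exponent. *)
Lemma powR_le_truncn (y A : R) q B : 0 < A -> 2 * A <= B%:R -> 2 <= y -> q%:R <= y `^ A ->
  (q <= Num.truncn y ^ B)%N.
Proof.
move=> A0 AB y2 hq; set Y := Num.truncn y.
have y0 : 0 <= y by lra.
have Y2 : (2 <= Y)%N by rewrite truncn_ge_nat.
have Y2r : 2 <= Y%:R :> R by rewrite ler_nat.
have /andP[_ yY] := truncn_itv y0; rewrite -/Y -natr1 in yY.
have yY2 : y <= Y%:R ^+ 2 by rewrite expr2; nra.
rewrite -(ler_nat R) natrX; apply: le_trans hq _.
apply: le_trans (_ : (Y%:R ^+ 2) `^ A <= _).
  by apply: ge0_ler_powR; rewrite ?nnegrE ?exprn_ge0 // ltW.
rewrite -powR_mulrn // -powRrM -powR_mulrn // ler_powR //; lra.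
Qed.
End Translation.

Theorem theorem2 (R : realType) (A : R) (hA : 0 < A) :
  exists (C y0 : R) (V : R -> R),
    forall (y : R) (q : nat),
      y0 <= y -> y0 <= q%:R -> q%:R <= y `^ A ->
      exists H : {group {unit 'Z_q}},
        (#|[set: {unit 'Z_q}] : H|)%g%:R <= C /\
        forall a b : {unit 'Z_q}, (a * b^-1)%g \in H ->
        forall eps x : R, 0 < eps -> y <= x -> V eps <= ln x / ln q%:R ->
          `|(Psi_ap x y q (val a))%:R - (Psi_ap x y q (val b))%:R|
            <= eps * ((Psi_coprime q x y)%:R / (totient q)%:R).
Proof.
pose B := (Num.truncn (2 * A)).+1.
have AB : 2 * A <= B%:R by apply/ltW/truncnS_gt.
have [Y0 HY] := regime_large (Kreg R B 1).
have /choice[Vn HV] : forall eps : R, exists Vn : nat, 0 < eps -> forall Y q X, (0 < Y)%N -> (1 < q)%N ->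
    (q <= Y ^ B)%N -> (Y <= X)%N -> (q ^ Vn <= X)%N ->
    forall (h g : {unit 'Z_q}), h \in <<corr_set R Y q B>>%g ->
    `|F R Y g X - F R Y (g * h)%g X| <= eps * (N R Y q X / (totient q)%:R).
  move=> eps; have [e0|e0] := ltP 0 eps; last by exists 0%N.
  by have [Vn H] := all_cases B e0; exists Vn.
(* [Y0] only has to make the index bound valid, and it is free of [eps]; the thresholds on [Y] that
   depend on [eps] are dealt with inside [all_cases]. *)
exists (growth_radius R B)%:R, (Y0 + 2)%:R, (fun eps => (Vn eps)%:R) => y q hy hq hqy.
have y2 : 2 <= y by apply: le_trans hy; rewrite ler_nat leq_addl.
have y0 : 0 <= y by lra.
have q1 : (1 < q)%N by move: hq; rewrite ler_nat => h; apply: leq_trans h; rewrite leq_addl.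
set Y := Num.truncn y.
have YY0 : (Y0 + 2 <= Y)%N by rewrite truncn_ge_nat.
have Y1 : (0 < Y)%N by apply: leq_trans YY0; rewrite addn_gt0 orbT.
have qY : (q <= Y ^ B)%N by apply: powR_le_truncn hqy.
have [KL KD] := HY Y (leq_trans (leq_addr _ _) YY0).
have [_ hidx] := corr_set_gen q1 qY (lexx _) KL KD.
exists <<corr_set R Y q B>>%G; split; first by rewrite ler_nat.
move=> a b hab eps x e0 yx hV.
have x0 : 0 <= x by lra.
have qX : (q ^ Vn eps <= Num.truncn x)%N.
  rewrite truncn_ge_nat // natrX.
  have q0 : 0 < q%:R :> R by rewrite ltr0n ltnW.
  have lq : 0 < ln q%:R :> R by rewrite ln_gt0 // ltr1n.
  rewrite ler_pdivlMr // in hV.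
  rewrite -ler_ln ?posrE ?exprn_gt0 //; last by lra.
  by rewrite lnXn // -[_ *+ _]mulr_natl.
have := HV eps e0 Y q (Num.truncn x) Y1 q1 qY (le_truncn yx) qX _ b hab.
(* The bound is taken at [g = b] and [h = a / b], so that [g * h = a]. *)
rewrite unit_mulC mulgKV distrC !Psi_apE // Psi_coprimeE //.
Qed.
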